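(* Let $\alpha\in(0,1)$. Let $u_0=K*\omega_0$, so that $\omega_0=\operatorname{curl}u_0$, and suppose that one of the following two sets of assumptions holds. (A) $Y_0$ is a single vector field on $\mathbb{R}^2$ and $\Sigma\subseteq\mathbb{R}^2$ is a closed set such that: $\omega_0\in C^\alpha(\mathbb{R}^2\setminus\Sigma)\cap(L^1\cap L^\infty)(\mathbb{R}^2)$; $Y_0\in C^\alpha(\mathbb{R}^2)$ with $|Y_0|\ge c>0$ on $\{x:d(x,\Sigma)<\delta_0\}$ for some constants $c,\delta_0>0$; and $\operatorname{div}Y_0\in C^\alpha(\mathbb{R}^2)$. (B) $Y_0=(Y_0^{(\lambda)})_{\lambda\in\Lambda}$ is a family of vector fields on $\mathbb{R}^2$ such that: $\omega_0\in(L^1\cap L^\infty)(\mathbb{R}^2)$; $\|Y_0\|_{C^\alpha}<\infty$ and $I(Y_0)>0$; and $\operatorname{div}Y_0\in C^\alpha$. Then $$Y_0\cdot\nabla\omega_0\in C^{\alpha-1}\iff\operatorname{div}(\omega_0Y_0)\in C^{\alpha-1}\iff Y_0\cdot\nabla u_0\in C^\alpha .$$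
   Context: Notation. $K(x)=\frac{1}{2\pi}\frac{x^\perp}{|x|^2}$, $x^\perp=(-x_2,x_1)$, is the Biot–Savart kernel; $\operatorname{curl}u=\partial_1u^2-\partial_2u^1$. For $\alpha\in(0,1)$ and $U\subseteq\mathbb{R}^2$ open, $\|f\|_{C^\alpha(U)}=\|f\|_{L^\infty(U)}+\sup_{x\ne y\in U}|f(x)-f(y)|/|x-y|^\alpha$. $C^{\alpha-1}(\mathbb{R}^2)=\{f+\operatorname{div}v: f,v\in C^\alpha(\mathbb{R}^2)\}$ with norm $\inf\{\|f\|_{C^\alpha}+\|v\|_{C^\alpha}\}$ over all such representations. Products are understood in the sense of distributions: $Y_0\cdot\nabla\omega_0:=\operatorname{div}(\omega_0Y_0)-\omega_0\operatorname{div}Y_0$ and $(Y_0\cdot\nabla u_0)^j:=Y_0^i\partial_iu_0^j=\operatorname{div}(u_0^jY_0)-u_0^j\operatorname{div}Y_0$. Families (case (B)): for a family $Y_0=(Y_0^{(\lambda)})_{\lambda\in\Lambda}$ of vector fields in $C^\alpha(\mathbb{R}^2)$, any $s\in\mathbb{R}$, and any function $f$ on vector fields (such as $f(Y)=\operatorname{div}Y$, $\operatorname{div}(\omega_0Y)$, $Y\cdot\nabla\omega_0$, $Y\cdot\nabla u_0$), $\|f(Y_0)\|_{C^s}:=\sup_{\lambda\in\Lambda}\|f(Y_0^{(\lambda)})\|_{C^s(\mathbb{R}^2)}$, and $f(Y_0)\in C^s$ means that this is finite. $I(Y_0):=\inf_{x\in\mathbb{R}^2}\sup_{\lambda\in\Lambda}|Y_0^{(\lambda)}(x)|$.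 *)

(* Defs.v *)
From HB Require Import structures.
From mathcomp Require Import all_boot all_order all_algebra.
From mathcomp Require Import all_classical all_reals all_analysis.

Set Implicit Arguments.
Unset Strict Implicit.
Unset Printing Implicit Defensive.

Import Order.TTheory GRing.Theory Num.Theory.
Import numFieldNormedType.Exports.

Local Open Scope classical_set_scope.
Local Open Scope ring_scope.

Notation plane R := (measurableTypeR R * measurableTypeR R)%type.

Section Plane.
Variable R : realType.
Implicit Types (x y : plane R) (w : plane R -> R) (Y : plane R -> plane R).

Definition leb2 : {measure set (plane R) -> \bar R} :=
  (@lebesgue_measure R \x @lebesgue_measure R)%E.

(* The library norm on a product type is the max norm. *)
Definition enorm x : R := Num.sqrt (x.1 ^+ 2 + x.2 ^+ 2).

(* Equal to +oo when S is empty. *)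
Definition edist_set x (S : set (plane R)) : \bar R :=
  ereal_inf [set (enorm (x - y))%:E | y in S].

Definition L1_Linfty w : Prop :=
  [/\ measurable_fun setT w, finite_norm leb2 1%E w & finite_norm leb2 +oo%E w].

(* N is the norm of the target: Num.norm for scalar functions, enorm for vector
   fields.  The L^oo norm over U is that of the extension by zero of f, and
   [maxe 0] gives the supremum over an empty set of pairs the value 0. *)
Definition holder_norm (V : zmodType) (N : V -> R) (a : R)
    (U : set (plane R)) (f : plane R -> V) : \bar R :=
  ('N[leb2]_+oo [ EFin \o ((N \o f) \_ U) ] +
   maxe 0 (ereal_sup
     [set (N (f p.1 - f p.2) / enorm (p.1 - p.2) `^ a)%:E
        | p in [set p : plane R * plane R |
                 [/\ p.1 \in U, p.2 \in U & p.1 <> p.2]]]))%E.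

Definition Ca_norm (a : R) := @holder_norm R Num.norm a.
Definition Cav_norm (a : R) := @holder_norm (plane R) enorm a.

Definition in_Ca (a : R) U (w : plane R -> R) := (Ca_norm a U w < +oo)%E.
Definition in_Cav (a : R) U (Y : plane R -> plane R) := (Cav_norm a U Y < +oo)%E.

Definition e1 : plane R := (1, 0).
Definition e2 : plane R := (0, 1).

Definition partial1 (f : plane R -> R) : plane R -> R := fun x => 'D_e1 f x.
Definition partial2 (f : plane R -> R) : plane R -> R := fun x => 'D_e2 f x.

Fixpoint Ck (k : nat) (f : plane R -> R) : Prop :=
  match k with
  | 0%N => continuous f
  | k'.+1 => [/\ continuous f,
                 forall x, derivable f x e1 /\ derivable f x e2,
                 Ck k' (partial1 f) & Ck k' (partial2 f)]
  end.

Definition test_function (phi : plane R -> R) : Prop :=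
  (forall k, Ck k phi) /\ compact (closure [set x | phi x != 0]).

(* A distribution is represented by its action on functions, of which only the
   restriction to test functions matters (see [deq]).  Linearity and continuity
   are not bundled: all functionals below are built from the two explicit
   constructors [dfun] and [ddiv]. *)
Definition distr := (plane R -> R) -> R.

Definition deq (S T : distr) : Prop :=
  forall phi, test_function phi -> S phi = T phi.

Definition dfun w : distr := fun phi => \int[leb2]_x (w x * phi x).

Definition ddiv Y : distr := fun phi =>
  - \int[leb2]_x ((Y x).1 * partial1 phi x + (Y x).2 * partial2 phi x).

Definition dadd (S T : distr) : distr := fun phi => S phi + T phi.
Definition dsub (S T : distr) : distr := fun phi => S phi - T phi.

Definition Cam1_repr (a : R) (T : distr) (p : (plane R -> R) * (plane R -> plane R)) :=
  [/\ in_Ca a setT p.1, in_Cav a setT p.2 & deq T (dadd (dfun p.1) (ddiv p.2))].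

Definition in_Cam1 (a : R) (T : distr) : Prop := exists p, Cam1_repr a T p.

Definition Cam1_norm (a : R) (T : distr) : \bar R :=
  ereal_inf [set (Ca_norm a setT p.1 + Cav_norm a setT p.2)%E
               | p in [set p | Cam1_repr a T p]].

(* A distribution with values in R^2 is the pair of its components; it is in
   C^a when it is given by a C^a vector field. *)
Definition vdistr := (distr * distr)%type.

Definition Cav_repr (a : R) (T : vdistr) Y :=
  [/\ in_Cav a setT Y, deq T.1 (dfun (fun x => (Y x).1))
    & deq T.2 (dfun (fun x => (Y x).2))].

Definition in_Cav_d (a : R) (T : vdistr) : Prop := exists Y, Cav_repr a T Y.

Definition Cav_d_norm (a : R) (T : vdistr) : \bar R :=
  ereal_inf [set Cav_norm a setT Y | Y in [set Y | Cav_repr a T Y]].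

Definition is_div Y (g : plane R -> R) : Prop := deq (ddiv Y) (dfun g).

Definition div_scal w Y : distr := ddiv (fun x => (w x * (Y x).1, w x * (Y x).2)).

(* Y . grad w := div (w Y) - w div Y, where g = div Y. *)
Definition dgrad Y (g : plane R -> R) w : distr :=
  dsub (div_scal w Y) (dfun (fun x => w x * g x)).

Definition dgradv Y (g : plane R -> R) (u : plane R -> plane R) : vdistr :=
  (dgrad Y g (fun x => (u x).1), dgrad Y g (fun x => (u x).2)).

Definition biot_savart_kernel x : plane R :=
  ((2 * pi)^-1 * (- x.2 / enorm x ^+ 2), (2 * pi)^-1 * (x.1 / enorm x ^+ 2)).

Definition biot_savart w : plane R -> plane R := fun x =>
  (\int[leb2]_y ((biot_savart_kernel (x - y)).1 * w y),
   \int[leb2]_y ((biot_savart_kernel (x - y)).2 * w y)).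

(* w is determined only almost everywhere. *)
Definition ae_in_Ca (a : R) U w : Prop :=
  exists2 w', {ae leb2, forall x, U x -> w x = w' x} & in_Ca a U w'.

Definition family_sup (L : Type) (n : L -> \bar R) : \bar R := ereal_sup (range n).

Definition nondegeneracy (L : Type) (Y : L -> plane R -> plane R) : \bar R :=
  ereal_inf (range (fun x => family_sup (fun l => (enorm (Y l x))%:E))).

End Plane.

(* Main.v *)
Require Import Defs.
From HB Require Import structures.
From mathcomp Require Import all_boot all_order all_algebra.
From mathcomp Require Import all_classical all_reals all_analysis.
From mathcomp Require Import measurable_realfun ess_sup_inf.
From mathcomp Require Import ring lra.

Set Implicit Arguments.
Unset Strict Implicit.
Unset Printing Implicit Defensive.

Import Order.TTheory GRing.Theory Num.Theory.
Import numFieldNormedType.Exports.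

Local Open Scope classical_set_scope.
Local Open Scope ring_scope.


(** The first equivalence holds because the two distributions differ by the
    product of the vorticity w and div Y, which is bounded and integrable. Such a
    function is the curl of the velocity that it generates, and this velocity is
    Hoelder of any exponent less than 1; so the difference belongs to
    C^(a - 1) ([Crep_dfun]).

    For the second equivalence let k be the Biot-Savart kernel made smooth on the
    unit disc, k_e its rescaling to scale e, and l_e = k_e - k. The kernels k_e
    are divergence free, their curl is an approximation of a multiple [mass] of
    the Dirac mass, and l_e is a test function, supported in the unit disc
    ([kr], [kre], [lk], [eta]). The derivative of the regularized velocity k_e * w
    along Y tends weakly to Y . grad u, by the definition of div Y
    ([regdir_weak]). It is the sum of three terms ([regdir_rest]):
    - a convolution with the fixed smooth kernel, multiplied by Y;
    - the commutators of the multiplication by the components of Y with the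
      convolution by the derivatives of l_e, applied to w;
    - the value S_e(x) of the distribution div (w Y) at the test function
      l_e (x - _) ([divk]).
    Commutators with a kernel of order -2 are estimated once and for all
    ([comm_bound], [comm_cauchy], [comm_holder], collected in [hfam_comm]): they
    are Hoelder of exponent a, uniformly in e, and converge at the rate e^a,
    provided that the integrals of the truncated kernels against w, that is, the
    truncated velocity gradients [grade], are bounded.

    This bound is where the hypotheses on Y and on the singular set enter. The
    truncated velocity gradient has zero trace and bounded antisymmetric part, so
    at a point where |Y| is bounded below it is controlled by its product with Y
    ([grade_of_dirgrad]). That product is bounded if div (w Y) is in C^(a - 1),
    since S_e is ([dirgrad_of_divk]). It is also bounded if Y . grad u is Hoelder:
    the velocity gradient is then tested with the gradient of a bump, and the
    increments of u, Hoelder of exponent 1 - a, and of Y compensate one derivative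
    ([dirgrad_of_dgrad]). Where w is Hoelder the bound is classical
    ([grade_smooth]).

    If div (w Y) = f + div v with f and v Hoelder, then S_e is the convolution of
    f with l_e minus the commutators of v applied to the constant 1, hence it is
    uniformly Hoelder and converges at the rate e^a ([divk_hfam]); so does the
    derivative of the regularized velocity ([dgrad_of_div]). Conversely, if Y . grad u is Hoelder, then S_e has
    a weak limit that is Hoelder; its curl is [mass] times div (w Y) up to a
    convolution with a smooth kernel, because the curl of l_e is an
    approximate Dirac mass minus a bump ([curl_divk], [div_of_dgrad]).

    All constants depend only on the bounds in the hypotheses, whence the
    uniformity for families ([regularity_equiv]). *)

(** * The plane: Euclidean norm, Borel measurability, Lebesgue measure *)

Section PlaneNorm.
Variable R : realType.
Implicit Types (x y z : plane R).

Lemma sqr_enorm x : enorm x ^+ 2 = x.1 ^+ 2 + x.2 ^+ 2.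
Proof. by rewrite sqr_sqrtr// addr_ge0// sqr_ge0. Qed.

Lemma enorm_ge0 x : 0 <= enorm x. Proof. exact: sqrtr_ge0. Qed.

Lemma enorm0 : enorm (0 : plane R) = 0.
Proof. by rewrite /enorm /= expr0n addr0 sqrtr0. Qed.

Lemma enormN x : enorm (- x) = enorm x.
Proof. by rewrite /enorm /= !sqrrN. Qed.

Lemma enormZ (s : R) x : enorm (s *: x) = `|s| * enorm x.
Proof.
rewrite /enorm -sqrtr_sqr -sqrtrM ?sqr_ge0//; congr Num.sqrt.
by rewrite /= /GRing.scale /=; ring.
Qed.

Lemma enorm_le_sqr x (r : R) : 0 <= r -> (enorm x <= r) = (x.1 ^+ 2 + x.2 ^+ 2 <= r ^+ 2).
Proof. by move=> r0; rewrite -sqr_enorm ler_sqr ?nnegrE ?enorm_ge0. Qed.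

Lemma enorm_triangle x y : enorm (x + y) <= enorm x + enorm y.
Proof.
have ex := enorm_ge0 x; have ey := enorm_ge0 y.
rewrite enorm_le_sqr ?addr_ge0//.
have CS : x.1 * y.1 + x.2 * y.2 <= enorm x * enorm y.
  apply: le_trans (ler_norm _) _.
  rewrite -ler_sqr ?nnegrE ?mulr_ge0// real_normK ?num_real// exprMn !sqr_enorm.
  have := sqr_ge0 (x.1 * y.2 - x.2 * y.1); nra.
have sx := sqr_enorm x; have sy := sqr_enorm y.
have -> : (x + y).1 ^+ 2 + (x + y).2 ^+ 2 =
    enorm x ^+ 2 + enorm y ^+ 2 + (x.1 * y.1 + x.2 * y.2) *+ 2.
  by rewrite sx sy /=; ring.
by rewrite sqrrD; lra.
Qed.

Lemma enorm_distC x y : enorm (x - y) = enorm (y - x).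
Proof. by rewrite -enormN opprB. Qed.

Lemma ler_enorm_dist x y : enorm x <= enorm y + enorm (x - y).
Proof. by have := enorm_triangle y (x - y); rewrite addrC subrK. Qed.

Lemma ler_coord1_enorm x : `|x.1| <= enorm x.
Proof. by rewrite -sqrtr_sqr ler_sqrt ?lerDl ?addr_ge0 ?sqr_ge0. Qed.

Lemma ler_coord2_enorm x : `|x.2| <= enorm x.
Proof. by rewrite -sqrtr_sqr ler_sqrt ?lerDr ?addr_ge0 ?sqr_ge0. Qed.

Lemma enorm_le_coords x : enorm x <= `|x.1| + `|x.2|.
Proof.
rewrite enorm_le_sqr ?addr_ge0// sqrrD !real_normK ?num_real//.
by rewrite addrAC lerDl mulrn_wge0// mulr_ge0.
Qed.

Lemma enorm_eq0 x : enorm x = 0 -> x = 0.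
Proof.
move=> e0; have := ler_coord1_enorm x; have := ler_coord2_enorm x.
rewrite e0 !normr_le0 => /eqP h2 /eqP h1.
by case: x h1 h2 {e0} => a b /= -> ->.
Qed.

Lemma enorm_gt0 x : x != 0 -> 0 < enorm x.
Proof.
move=> x0; rewrite lt_neqAle enorm_ge0 andbT eq_sym.
by apply: contra x0 => /eqP/enorm_eq0 ->.
Qed.

Lemma continuous_enorm : continuous (@enorm R).
Proof.
move=> x; rewrite /enorm; apply: continuous_comp; last exact: sqrt_continuous.
by apply: cvgD; apply: cvgM; solve [exact: cvg_fst | exact: cvg_snd].
Qed.

End PlaneNorm.

Section PlaneMeasure.
Variable R : realType.
Notation leb := (@lebesgue_measure R).
Notation leb2 := (@leb2 R).

(** The plane carries the product sigma-algebra; it contains the open sets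
    because each of them is a countable union of boxes with rational centres
    and radii. *)
Lemma open_measurable_plane (A : set (plane R)) : open A -> measurable A.
Proof.
move=> oA.
pose box (p : rat * rat * nat) : set (plane R) :=
  ball (ratr p.1.1 : R) (p.2.+1%:R^-1) `*` ball (ratr p.1.2 : R) (p.2.+1%:R^-1).
have -> : A = \bigcup_(p in [set p | box p `<=` A]) box p.
  apply/seteqP; split => [x Ax|x [p /= pA]]; last exact: pA.
  have [e /= e0 eA] := (nbhs_ballP _ _).1 (oA x Ax).
  have [n _ /(_ n (leqnn n)) ne] := near_infty_natSinv_lt (PosNum (divr_gt0 e0 (ltr0Sn R 1))).
  have n0 : 0 < n.+1%:R^-1 :> R by rewrite invr_gt0.
  have [d dE] : exists d : R, n.+1%:R^-1 = d by exists n.+1%:R^-1.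
  rewrite /= dE in ne n0.
  have rt (t : R) : exists q : rat, `|t - ratr q| < d.
    have : t - d < t + d by lra.
    move=> /rat_in_itvoo[q]; rewrite in_itv /= => /andP[q1 q2]; exists q.
    by rewrite ltr_norml; apply/andP; split; lra.
  have [q1 h1] := rt x.1; have [q2 h2] := rt x.2.
  exists (q1, q2, n); rewrite /box /= dE; last first.
    by split; rewrite /= -ball_normE /= distrC.
  move=> y [/=]; rewrite -!ball_normE /= => y1 y2; apply: eA.
  have close (s t q : R) : `|t - q| < d -> `|q - s| < d -> `|t - s| < e.
    by rewrite !ltr_norml => /andP[? ?] /andP[? ?]; apply/andP; split; lra.
  by split; rewrite -ball_normE /=; [exact: close h1 y1|exact: close h2 y2].
rewrite bigcup_mkcond; apply: countable_bigcupT_measurable => [|p].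
  exact: countableP.
by case: ifP => // _; apply: measurableX; exact: measurable_ball.
Qed.

Lemma continuous_measurable_plane (f : plane R -> R) :
  continuous f -> measurable_fun setT f.
Proof.
move=> /continuousP cf; apply: (measurability _ (RGenOpens.measurableE R)).
move=> _ [_ [a [b ->] <-]]; rewrite setTI.
by apply: open_measurable_plane; apply: cf; exact: interval_open.
Qed.

Lemma measurable_enorm : measurable_fun setT (@enorm R).
Proof. by apply: continuous_measurable_plane => x; exact: continuous_enorm. Qed.

Lemma leb2X (A B : set (measurableTypeR R)) : measurable A -> measurable B ->
  leb2 (A `*` B) = (leb A * leb B)%E.
Proof. by move=> mA mB; exact: (product_measure1E leb leb). Qed.

Lemma leb2_sigma_finite : sigma_finite setT leb2.
Proof.
have /sigma_finiteP[F [TF ndF Foo]] := sigma_finiteT leb.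
exists (fun n => F n `*` F n).
  rewrite -setXTT TF predeqE => -[x y]; split => [[/= [n _ Fnx] [k _ Fky]]|].
    exists (maxn n k) => //; split.
    - by move: x Fnx; exact/subsetPset/ndF/leq_maxl.
    - by move: y Fky; exact/subsetPset/ndF/leq_maxr.
  by move=> [n _ []/= ? ?]; split; exists n.
move=> k; have [mF oF] := Foo k; split; first exact: measurableX.
by rewrite leb2X// lte_mul_pinfty// ge0_fin_numE.
Qed.

End PlaneMeasure.

(** The same measure, as a constant of its own that can carry the canonical
    structure of a sigma-finite measure which Fubini's theorem asks for. *)
Definition leb2_sf (R : realType) : set (plane R) -> \bar R := @leb2 R.

HB.instance Definition _ (R : realType) := isMeasure.Build _ _ _ (@leb2_sf R)
  (@measure0 _ _ _ (@leb2 R)) (@measure_ge0 _ _ _ (@leb2 R))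
  (@measure_semi_sigma_additive _ _ _ (@leb2 R)).

HB.instance Definition _ (R : realType) :=
  Measure_isSigmaFinite.Build _ _ _ (@leb2_sf R) (@leb2_sigma_finite R).

(** * Integrals over the plane *)

Section PlaneIntegral.
Variable R : realType.
Notation leb := (@lebesgue_measure R).
Notation leb2 := (@leb2 R).
Implicit Types (f g : plane R -> R).

Definition integ f : Prop := leb2.-integrable setT (EFin \o f).

Lemma integ_measurable f : integ f -> measurable_fun setT f.
Proof. by move=> /integrableP[/measurable_EFinP]. Qed.

Lemma integ_le f g : measurable_fun setT f -> (forall x, `|f x| <= g x) ->
  integ g -> integ f.
Proof.
move=> mf fg ig; apply: le_integrable ig => //; first exact/measurable_EFinP.
by move=> x _; rewrite /= lee_fin (le_trans (fg x))// ler_norm.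
Qed.

Lemma integ_norm f : integ f -> integ (fun x => `|f x|).
Proof. exact: integrable_norm. Qed.

Lemma integD f g : integ f -> integ g -> integ (fun x => f x + g x).
Proof. by move=> hf hg; apply: (integrableD measurableT hf hg). Qed.

Lemma integB f g : integ f -> integ g -> integ (fun x => f x - g x).
Proof. by move=> hf hg; apply: (integrableB measurableT hf hg). Qed.

Lemma integZ (c : R) f : integ f -> integ (fun x => c * f x).
Proof. by move=> hf; apply: (integrableZl measurableT c hf). Qed.

Lemma eq_integ f g : f =1 g -> integ f -> integ g.
Proof. by move=> /funext ->. Qed.

Lemma integM_bdd f g (M : R) : measurable_fun setT f ->
  (forall x, `|f x| <= M) -> integ g -> integ (fun x => f x * g x).
Proof.
move=> mf fM ig; apply: (@integ_le _ (fun x => M * `|g x|)).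
- by apply: measurable_funM => //; exact: integ_measurable.
- by move=> x; rewrite normrM ler_wpM2r.
- exact/integZ/integ_norm.
Qed.

Lemma int_ext f g : f =1 g -> \int[leb2]_x f x = \int[leb2]_x g x.
Proof. by move=> fg; apply: eq_Rintegral => x _; exact: fg. Qed.

Lemma intD f g : integ f -> integ g ->
  \int[leb2]_x (f x + g x) = \int[leb2]_x f x + \int[leb2]_x g x.
Proof. exact: RintegralD. Qed.

Lemma intB f g : integ f -> integ g ->
  \int[leb2]_x (f x - g x) = \int[leb2]_x f x - \int[leb2]_x g x.
Proof. exact: RintegralB. Qed.

Lemma intZ (c : R) f : integ f ->
  \int[leb2]_x (c * f x) = c * \int[leb2]_x f x.
Proof. by move=> hf; rewrite RintegralZl. Qed.

Lemma intN f : integ f -> \int[leb2]_x (- f x) = - \int[leb2]_x f x.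
Proof.
move=> hf; rewrite -[RHS]mulN1r -intZ//.
by apply: int_ext => x; rewrite mulN1r.
Qed.

Lemma int_ge0 f : (forall x, 0 <= f x) -> 0 <= \int[leb2]_x f x.
Proof. by move=> f0; apply: Rintegral_ge0. Qed.

Lemma int0 : \int[leb2]_x (0 : R) = 0.
Proof. by rewrite /Rintegral integral0. Qed.

Lemma int_le f g : integ f -> integ g -> (forall x, f x <= g x) ->
  \int[leb2]_x f x <= \int[leb2]_x g x.
Proof. by move=> hf hg fg; apply: le_Rintegral. Qed.

Lemma norm_int_le f g : measurable_fun setT f -> (forall x, `|f x| <= g x) ->
  integ g -> `|\int[leb2]_x f x| <= \int[leb2]_x g x.
Proof.
move=> mf fg ig; have hf := integ_le mf fg ig.
apply: le_trans (le_normr_Rintegral measurableT hf) _.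
by apply: int_le => //; exact: integ_norm.
Qed.

Lemma int_eq_ae f g : measurable_fun setT f -> measurable_fun setT g ->
  {ae leb2, forall x, f x = g x} -> \int[leb2]_x f x = \int[leb2]_x g x.
Proof.
move=> mf mg fg; congr fine; apply: ae_eq_integral => //.
- exact/measurable_EFinP.
- exact/measurable_EFinP.
- by apply: filterS fg => x /= ->.
Qed.

End PlaneIntegral.

Section AffineSubstitution.
Variable R : realType.
Notation leb := (@lebesgue_measure R).
Notation leb2 := (@leb2 R).

Lemma measurable_affine1 (a s : R) :
  measurable_fun [set: measurableTypeR R] (fun t : measurableTypeR R => a + s * t : measurableTypeR R).
Proof. by apply: measurable_funD => //; apply: measurable_funM. Qed.

(** Lebesgue measure and the rescaled pushforward of Lebesgue measure by the
    affine map agree on intervals, hence are equal. *)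
Lemma ge0_integral_affine1 (a s : R) (f : measurableTypeR R -> \bar R) : s != 0 ->
  measurable_fun setT f -> (forall t, 0 <= f t)%E ->
  (\int[leb]_t f (a + s * t)%R = (`|s|^-1)%:E * \int[leb]_t f t)%E.
Proof.
move=> s0 mf f0.
pose phi (t : measurableTypeR R) : measurableTypeR R := a + s * t.
have mphi : measurable_fun setT phi by exact: measurable_affine1.
have ns0 : 0 <= `|s| by [].
pose push : {measure set (measurableTypeR R) -> \bar R} :=
  measure_function_pushforward__canonical__measure_function_Measure leb mphi.
have ens : forall A : set (measurableTypeR R), measurable A ->
    leb A = mscale (NngNum ns0) push A.
  apply: (@lebesgue_measure_unique R (mscale (NngNum ns0) push)) => _ [[u v]] _ <-.
  change (leb `]u, v]%classic = (`|s|%:E * leb (phi @^-1` `]u, v]%classic))%E).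
  have [sp|sn] : 0 < s \/ s < 0 by apply/orP; rewrite orbC -neq_lt.
  - have -> : phi @^-1` `]u, v]%classic = `](u - a) / s, (v - a) / s]%classic.
      by apply/seteqP; split => t /=; rewrite !in_itv/= ltr_pdivrMr// ler_pdivlMr// /phi
        => /andP[? ?]; apply/andP; split; lra.
    rewrite !lebesgue_measure_itv/= !lte_fin ltr_pM2r ?invr_gt0// ltrD2r.
    case: ifP => _; last by rewrite mule0.
    by rewrite -!EFinB -EFinM gtr0_norm//; congr EFin; field.
  - have -> : phi @^-1` `]u, v]%classic = `[(v - a) / s, (u - a) / s[%classic.
      by apply/seteqP; split => t /=; rewrite !in_itv/= ler_ndivrMr// ltr_ndivlMr// /phi
        => /andP[? ?]; apply/andP; split; lra.
    rewrite !lebesgue_measure_itv/= !lte_fin ltr_nM2r ?invr_lt0// ltrD2r.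
    case: ifP => _; last by rewrite mule0.
    by rewrite -!EFinB -EFinM ltr0_norm//; congr EFin; field.
rewrite [X in (_ * X)%E](eq_measure_integral (mscale (NngNum ns0) push)).
  rewrite ge0_integral_mscale//= ge0_integral_pushforward//=.
  rewrite muleA -EFinM mulVf ?normr_eq0// mul1e preimage_setT.
  by apply: eq_integral.
by move=> A mA _; exact: ens.
Qed.

Lemma measurable_affine (a : plane R) (s : R) :
  measurable_fun [set: plane R] (fun z : plane R => a + s *: z).
Proof.
apply: measurable_fun_pair => /=.
  exact: (measurableT_comp (measurable_affine1 a.1 s) measurable_fst).
exact: (measurableT_comp (measurable_affine1 a.2 s) measurable_snd).
Qed.

Lemma leb2_tonelli (F : plane R -> \bar R) :
  measurable_fun setT F -> (forall z, 0 <= F z)%E ->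
  (\int[leb2]_z F z = \int[leb]_x \int[leb]_y F (x, y))%E.
Proof. by move=> mF F0; exact: (@fubini_tonelli1 _ _ _ _ _ leb leb). Qed.

(** One coordinate at a time, by Tonelli's theorem. *)
Lemma ge0_integral_affine (a : plane R) (s : R) (F : plane R -> \bar R) :
  s != 0 -> measurable_fun setT F -> (forall z, 0 <= F z)%E ->
  (\int[leb2]_z F (a + s *: z)%R = (`|s|^-1 ^+ 2)%:E * \int[leb2]_z F z)%E.
Proof.
move=> s0 mF F0.
have mFa := measurableT_comp mF (measurable_affine a s).
rewrite (leb2_tonelli mFa (fun z => F0 _)) (leb2_tonelli mF F0) /=.
have inner x : (\int[leb]_y F (a.1 + s * x, a.2 + s * y)%R =
    (`|s|^-1)%:E * \int[leb]_y F ((a.1 + s * x)%R, y))%E.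
  apply: (@ge0_integral_affine1 a.2 s (fun y => F ((a.1 + s * x)%R, y))) => //.
  exact: measurableT_comp.
under eq_integral do rewrite inner.
pose Phi (x : measurableTypeR R) := (\int[leb]_y F (x, y))%E.
have mPhi : measurable_fun setT Phi by exact: (@measurable_fun_fubini_tonelli_F _ _ _ _ _ leb).
have Phi0 x : (0 <= Phi x)%E by exact: integral_ge0.
have c0 : (0 <= (`|s|^-1)%:E)%E by rewrite lee_fin invr_ge0.
have mPa := measurableT_comp mPhi (measurable_affine1 a.1 s).
rewrite [LHS](ge0_integralZl leb measurableT mPa (fun x _ => Phi0 _) c0).
rewrite (ge0_integral_affine1 a.1 s0 mPhi Phi0) muleA.
by rewrite -EFinM -expr2.
Qed.

Lemma integ_affine (a : plane R) (s : R) (f : plane R -> R) : s != 0 ->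
  integ f -> integ (fun z => f (a + s *: z)).
Proof.
move=> s0 /integrableP[mf iof]; apply/integrableP; split.
  exact: (measurableT_comp mf (measurable_affine a s)).
have mnf : measurable_fun setT (fun z => `|(f z)%:E|)%E.
  exact: (measurableT_comp (@abse_measurable R setT) mf).
rewrite (ge0_integral_affine a s0 mnf (fun=> abse_ge0 _)).
by rewrite lte_mul_pinfty// lee_fin exprn_ge0// invr_ge0.
Qed.

Lemma int_affine (a : plane R) (s : R) (f : plane R -> R) : s != 0 ->
  integ f ->
  \int[leb2]_z f (a + s *: z) = `|s|^-1 ^+ 2 * \int[leb2]_z f z.
Proof.
move=> s0 hf; have mf := measurable_int _ hf.
rewrite /Rintegral -[X in X * _]/(fine (`|s|^-1 ^+ 2)%:E) -fineM//; last first.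
  exact: integrable_fin_num.
congr fine; rewrite [in LHS]integralE [in RHS]integralE.
have E g : measurable_fun setT g -> (forall z, 0 <= g z)%E -> 
  (\int[leb2]_z g (a + s *: z)%R = (`|s|^-1 ^+ 2)%:E * \int[leb2]_z g z)%E.
  by move=> mg g0; exact: ge0_integral_affine.
have := E (EFin \o f)^\+%E (measurable_funepos mf) (funepos_ge0 _).
have := E (EFin \o f)^\-%E (measurable_funeneg mf) (funeneg_ge0 _).
have -> : (fun x => (f (a + s *: x))%:E)^\+%E = (fun x => (EFin \o f)^\+%E (a + s *: x)) by rewrite !unlock.
have -> : (fun x => (f (a + s *: x))%:E)^\-%E = (fun x => (EFin \o f)^\-%E (a + s *: x)) by rewrite !unlock.
move=> -> ->; rewrite -muleBr//.
by apply: fin_num_adde_defr; exact: integrable_pos_fin_num.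
Qed.

(** The substitution that turns an integral against [k (x - y)] into an integral
    against the kernel [k] itself. *)
Lemma integ_reflect (x : plane R) (f : plane R -> R) :
  integ f -> integ (fun y => f (x - y)).
Proof.
move=> hf; have := @integ_affine x (-1) f; rewrite oppr_eq0 oner_eq0 => /(_ isT hf).
by apply: eq_integ => z; rewrite scaleN1r.
Qed.

Lemma int_reflect (x : plane R) (f : plane R -> R) : integ f ->
  \int[leb2]_y f (x - y) = \int[leb2]_z f z.
Proof.
move=> hf; have := @int_affine x (-1) f; rewrite oppr_eq0 oner_eq0 => /(_ isT hf).
by under eq_Rintegral do rewrite scaleN1r; rewrite normrN1 invr1 expr1n mul1r.
Qed.

End AffineSubstitution.

Section PlaneFubini.
Variable R : realType.
Notation leb := (@lebesgue_measure R).
Notation leb2 := (@leb2 R).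
Notation leb2_sf := (@leb2_sf R).

(** Fubini's theorem for integrands dominated by a product: the convolution
    integrals below are all of this form. *)
Variables (H : plane R -> plane R -> R) (g h : plane R -> R).
Hypothesis mH : measurable_fun setT (fun p : plane R * plane R => H p.1 p.2).
Hypothesis Hgh : forall x y, `|H x y| <= g x * h y.
Hypothesis (ig : integ g) (ih : integ h).

Let H2 (p : plane R * plane R) : \bar R := (H p.1 p.2)%:E.

Let iH : (leb2_sf \x leb2_sf)%E.-integrable setT H2.
Proof.
have mH2 : measurable_fun setT H2 by exact/measurable_EFinP.
apply/(integrable12ltyP leb2_sf leb2_sf mH2).
have /integrableP[mg iog] := ig; have /integrableP[mh ioh] := ih.
apply: (@le_lt_trans _ _
    (\int[leb2]_x (`|(g x)%:E| * \int[leb2]_y `|(h y)%:E|))%E).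
  apply: ge0_le_integral => //.
  - by move=> x _; exact: integral_ge0.
  - apply: (@measurable_fun_fubini_tonelli_F _ _ _ _ _ leb2_sf (abse \o H2)) => //.
      exact: measurableT_comp.
    by move=> x; exact: abse_ge0.
  - apply: emeasurable_funM => //; exact: measurableT_comp.
  - move=> x _; rewrite -ge0_integralZl//; last exact: measurableT_comp.
    apply: ge0_le_integral => //.
    + apply/measurableT_comp => //; apply/measurable_EFinP.
      exact: (measurableT_comp mH (pair1_measurable x)).
    + apply: emeasurable_funM => //; exact: measurableT_comp.
    + move=> y _; rewrite -abseM lee_fin.
      by apply: le_trans (Hgh x y) _; exact: ler_norm.
rewrite ge0_integralZr//; last 2 first.
- exact: measurableT_comp.
- exact: integral_ge0.
by rewrite lte_mul_pinfty ?integral_ge0// ge0_fin_numE ?integral_ge0.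
Qed.

Let slice_integrable x : integ (fun y => H x y).
Proof.
apply: (@integ_le _ _ (fun y => g x * h y)).
- exact: (measurableT_comp mH (pair1_measurable x)).
- by move=> y; exact: Hgh.
- exact: integZ.
Qed.

Let slice_integrable2 y : integ (fun x => H x y).
Proof.
apply: (@integ_le _ _ (fun x => h y * g x)).
- exact: (measurableT_comp mH (pair2_measurable y)).
- by move=> x; rewrite mulrC; exact: Hgh.
- exact: integZ.
Qed.

Lemma integ_marginal : integ (fun x => \int[leb2]_y H x y).
Proof.
have := integrable_fubini_F iH; apply: eq_integrable => // x _.
rewrite /fubini_F /= /Rintegral fineK//.
exact: (integrable_fin_num _ (slice_integrable x)).
Qed.

Lemma integ_marginal2 : integ (fun y => \int[leb2]_x H x y).
Proof.
apply: (integ_le _ _ (integZ (\int[leb2]_x g x) ih)).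
  apply/measurable_EFinP; have := measurable_fubini_G iH.
  apply: eq_measurable_fun => y _; rewrite /fubini_G /= /Rintegral fineK//.
  exact: (integrable_fin_num _ (slice_integrable2 y)).
move=> y; rewrite mulrC -intZ//; apply: norm_int_le.
- exact: integ_measurable (slice_integrable2 y).
- by move=> x; rewrite mulrC; exact: Hgh.
- exact: integZ.
Qed.

Lemma fubini_plane : \int[leb2]_x \int[leb2]_y H x y = \int[leb2]_y \int[leb2]_x H x y.
Proof.
have := Fubini iH; rewrite /H2 /= => E; rewrite {1 3}/Rintegral; congr fine.
transitivity (\int[leb2]_x \int[leb2]_y (H x y)%:E)%E.
  apply: eq_integral => x _; rewrite /Rintegral fineK//.
  exact: (integrable_fin_num _ (slice_integrable x)).
rewrite [LHS]E; apply: eq_integral => y _; rewrite /Rintegral fineK//.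
exact: (integrable_fin_num _ (slice_integrable2 y)).
Qed.

End PlaneFubini.

(** * Partial derivatives and smooth functions on the plane *)

Section Partials.
Variable R : realType.
Notation leb := (@lebesgue_measure R).
Notation leb2 := (@leb2 R).
Implicit Types (f g : plane R -> R) (x z : plane R) (b : bool).

(** Coordinates and partial derivatives are indexed by booleans, [false] for
    the first one and [true] for the second, so that each statement about the
    two components is proved once. *)
Definition co b x : R := if b then x.2 else x.1.
Definition ee b : plane R := if b then e2 R else e1 R.
Definition pd b f : plane R -> R := fun x => 'D_(ee b) f x.

(** The line through [x] in the direction [ee b], parametrized by the
    coordinate that varies. *)
Definition line b x (t : R) : plane R := if b then (x.1, t) else (t, x.2).

Lemma line_co b x : line b x (co b x) = x. Proof. by case: b; case: x. Qed.

Lemma co_line b x t : co b (line b x t) = t. Proof. by case: b. Qed.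

Lemma line_line b x s t : line b (line b x s) t = line b x t. Proof. by case: b. Qed.

Lemma co_negb_line b x t : co (~~ b) (line b x t) = co (~~ b) x.
Proof. by case: b. Qed.

Lemma co_le_enorm b x : `|co b x| <= enorm x.
Proof. by case: b; [exact: ler_coord2_enorm|exact: ler_coord1_enorm]. Qed.

Lemma enorm_line b x s t : enorm (line b x s - line b x t) = `|s - t|.
Proof.
by rewrite /enorm /line; case: b; rewrite /= subrr expr0n ?addr0 ?add0r sqrtr_sqr.
Qed.

Lemma continuous_line b x : continuous (line b x).
Proof.
move=> t; rewrite /line; case: b.
  by apply: (@cvg_pair _ _ _ _ (nbhs (x.1 : R)) (nbhs (t : R))); [exact: cvg_cst|exact: cvg_id].
by apply: (@cvg_pair _ _ _ _ (nbhs (t : R)) (nbhs (x.2 : R))); [exact: cvg_id|exact: cvg_cst].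
Qed.

Lemma continuous_co b : continuous (co b).
Proof. by move=> x; rewrite /co; case: b; [exact: cvg_snd|exact: cvg_fst]. Qed.

Lemma line_growth b f x :
  (fun h : R => h^-1 *: ((f \o shift x) (h *: ee b) - f x)) =
  (fun h : R => h^-1 *: (((f \o line b x) \o shift (co b x)) (h *: (1 : R))
                         - (f \o line b x) (co b x))).
Proof.
apply/funext => h; rewrite /= line_co; congr (_ *: (f _ - _)).
case: b; case: x => x1 x2; rewrite /ee /e1 /e2 /line /co /=; congr pair.
- by rewrite /= /GRing.scale /= mulr0 add0r.
- by rewrite /= /GRing.scale /= mulr0 add0r.
Qed.

(** Partial derivatives are derivatives of functions of one variable; all
    computations are done there. *)
Lemma is_derive_line b f x (d : R) :
  is_derive x (ee b) f d <-> is_derive (co b x) 1 (f \o line b x) d.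
Proof.
split=> -[ex de]; apply: DeriveDef.
- by move: ex; rewrite /derivable (line_growth b f x).
- by move: de; rewrite /derive (line_growth b f x).
- by rewrite /derivable (line_growth b f x).
- by rewrite /derive (line_growth b f x).
Qed.

Lemma pd_derive b f x : derivable f x (ee b) -> is_derive x (ee b) f (pd b f x).
Proof. exact: derivableP. Qed.

Lemma derive_pd b f x d : is_derive x (ee b) f d -> pd b f x = d.
Proof. by move=> h; rewrite /pd derive_val. Qed.

Lemma pdD b f g x : derivable f x (ee b) -> derivable g x (ee b) ->
  pd b (fun y => f y + g y) x = pd b f x + pd b g x.
Proof. exact: deriveD. Qed.

Lemma pdM b f g x : derivable f x (ee b) -> derivable g x (ee b) ->
  pd b (fun y => f y * g y) x = f x * pd b g x + g x * pd b f x.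
Proof. exact: deriveM. Qed.

Lemma pdZ b (c : R) f x : derivable f x (ee b) ->
  pd b (fun y => c * f y) x = c * pd b f x.
Proof. exact: deriveZ. Qed.

Lemma pd_cst b (c : R) : pd b (fun=> c) = fun=> 0.
Proof. by apply/funext => x; exact: derive_cst. Qed.

Lemma is_derive_co b c x : is_derive x (ee b) (co c) (b == c)%:R.
Proof.
apply/is_derive_line; have [<-|bc] := eqVneq b c.
  have -> : co b \o line b x = id :> (R -> R) by apply/funext => t /=; rewrite co_line.
  exact: is_derive_id.
have -> : co c \o line b x = cst (co c x) :> (R -> R).
  by apply/funext => t /=; case: b c bc => -[].
exact: is_derive_cst.
Qed.

Lemma is_derive_affine b f (a : plane R) (s : R) x (d : R) :
  is_derive (a + s *: x) (ee b) f d ->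
  is_derive x (ee b) (fun z => f (a + s *: z)) (s * d).
Proof.
move=> /is_derive_line h; apply/is_derive_line.
have -> : (fun z => f (a + s *: z)) \o line b x =
    (f \o line b (a + s *: x)) \o (fun t : R => co b a + s * t).
  apply/funext => t /=; congr f.
  by rewrite /line /co; case: b {h}; case: a => ? ?; case: x => ? ? /=.
rewrite mulrC; apply: is_derive1_comp.
  by rewrite (_ : co b a + s * co b x = co b (a + s *: x))//; case: b {h}.
have := is_deriveD (is_derive_cst (co b a) (co b x) (1 : R))
  (is_deriveZ s (is_derive_id (co b x) (1 : R))).
by rewrite add0r /GRing.scale /= mulr1.
Qed.

Lemma pd_affine b f (a : plane R) (s : R) x : derivable f (a + s *: x) (ee b) ->
  pd b (fun z => f (a + s *: z)) x = s * pd b f (a + s *: x).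
Proof. by move=> /pd_derive/is_derive_affine/derive_pd. Qed.

Lemma derivable_affine b f (a : plane R) (s : R) x : derivable f (a + s *: x) (ee b) ->
  derivable (fun z => f (a + s *: z)) x (ee b).
Proof. by move=> /pd_derive/is_derive_affine[]. Qed.

Lemma continuous_affine (a : plane R) (s : R) : continuous (fun z : plane R => a + s *: z).
Proof. by move=> z; apply: cvgD; [exact: cvg_cst|apply: cvgZr; exact: cvg_id]. Qed.

Lemma continuous_aff f (a : plane R) (s : R) :
  continuous f -> continuous (fun z => f (a + s *: z)).
Proof. by move=> cf z; apply: continuous_comp; [exact: continuous_affine|exact: cf]. Qed.

Definition csupp (r : R) f := forall z, r < enorm z -> f z = 0.

Lemma open_enorm_gt (r : R) : open [set z : plane R | r < enorm z].
Proof.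
have -> : [set z : plane R | r < enorm z] = @enorm R @^-1` [set t | r < t] by [].
by apply: open_comp; [move=> z _; exact: continuous_enorm|exact: open_gt].
Qed.

Lemma csupp_pd (r : R) b f : csupp r f -> csupp r (pd b f).
Proof.
move=> sf z rz; rewrite /pd.
have -> : 'D_(ee b) f z = 'D_(ee b) (cst 0) z; last by rewrite derive_cst.
apply: near_eq_derive.
have : nbhs z [set y : plane R | r < enorm y].
  by apply: open_nbhs_nbhs; split=> //; exact: open_enorm_gt.
by apply: filterS => y; exact: sf.
Qed.

Lemma compact_box (r : R) : compact [set z : plane R | `|z.1| <= r /\ `|z.2| <= r].
Proof.
have -> : [set z : plane R | `|z.1| <= r /\ `|z.2| <= r] =
    `[-r, r]%classic `*` `[-r, r]%classic.
  by apply/seteqP; split => z /=; rewrite !in_itv /= !ler_norml.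
by apply: compact_setX; exact: segment_compact.
Qed.

Lemma continuous_bounded_disc f (r : R) : continuous f ->
  exists2 M, 0 < M & forall z, enorm z <= r -> `|f z| <= M.
Proof.
move=> cf; have cimg := continuous_compact (continuous_subspaceT cf) (@compact_box r).
have [N [Nr NM]] := compact_bounded cimg.
exists (`|N| + 1) => [|z zr]; first by rewrite ltr_wpDl.
apply: NM; first by rewrite (le_lt_trans (ler_norm N))// ltrDl.
exists z => //=; split.
  exact: le_trans (ler_coord1_enorm z) zr.
exact: le_trans (ler_coord2_enorm z) zr.
Qed.

Lemma csupp_bounded f (r : R) : continuous f -> csupp r f ->
  exists2 M, 0 < M & forall z, `|f z| <= M.
Proof.
move=> cf sf; have [M M0 fM] := continuous_bounded_disc r cf.
exists M => // z; have [/fM//|rz] := leP (enorm z) r.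
by rewrite sf// normr0 ltW.
Qed.

Lemma integ_indic_box (r : R) :
  integ (\1_[set z : plane R | `|z.1| <= r /\ `|z.2| <= r] : plane R -> R).
Proof.
have -> : [set z : plane R | `|z.1| <= r /\ `|z.2| <= r] =
    `[-r, r]%classic `*` `[-r, r]%classic.
  by apply/seteqP; split => z /=; rewrite !in_itv /= !ler_norml.
have mB : measurable (`[-r, r]%classic `*` `[-r, r]%classic : set (plane R)).
  by apply: measurableX; exact: measurable_itv.
apply/integrableP; split; first exact/measurable_EFinP.
rewrite (eq_integral (fun x => (\1_(`[-r, r]%classic `*` `[-r, r]%classic) x)%:E)); last first.
  by move=> t _; rewrite gee0_abs// lee_fin.
rewrite integral_indic// setIT leb2X; try exact: measurable_itv.
rewrite /= !lebesgue_measure_itv /=; case: ifP => _; last by rewrite mule0.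
by rewrite -EFinB -EFinM ltry.
Qed.

Lemma integ_csupp f (r : R) : continuous f -> csupp r f -> integ f.
Proof.
move=> cf sf; have [M M0 fM] := csupp_bounded cf sf.
apply: integ_le (integZ M (integ_indic_box r)); first exact: continuous_measurable_plane.
move=> z; have [zr|rz] := leP (enorm z) r; last first.
  by rewrite sf// normr0; apply: mulr_ge0; [exact: ltW|rewrite indicE].
have Bz : [set z : plane R | `|z.1| <= r /\ `|z.2| <= r] z.
  split => /=; first exact: le_trans (ler_coord1_enorm z) zr.
  exact: le_trans (ler_coord2_enorm z) zr.
by rewrite indicE (mem_set Bz) mulr1 fM.
Qed.

(** The fundamental theorem of calculus on each line in the direction [ee b],
    integrated over the lines. *)
Lemma int_pd_eq0 b f (r : R) : continuous f ->
  (forall x, derivable f x (ee b)) -> continuous (pd b f) -> csupp r f ->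
  \int[leb2]_x pd b f x = 0.
Proof.
move=> cf df cpf sf.
have ipf := integ_csupp cpf (@csupp_pd r b f sf).
pose a := `|r| + 1.
have a0 : 0 < a by rewrite ltr_wpDl.
have ra : r < a by rewrite (le_lt_trans (ler_norm r))// ltrDl.
have slice x : (\int[leb]_t (pd b f (line b x t))%:E = 0)%E.
  pose F t := f (line b x t).
  have out (t : R) : a <= `|t| -> F t = 0.
    move=> at_; apply: sf; apply: lt_le_trans ra _.
    apply: le_trans at_ _; rewrite -{1}(co_line b x t); exact: co_le_enorm.
  have dF (t : R) : is_derive t 1 F (pd b f (line b x t)).
    have /pd_derive/is_derive_line := df (line b x t).
    rewrite co_line; congr (is_derive _ _ _ _).
    by apply/funext => s /=; rewrite line_line.
  have cF' : continuous (fun t : R => pd b f (line b x t)).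
    by move=> t; apply: continuous_comp; [exact: continuous_line|exact: cpf].
  have cF : continuous F.
    by move=> t; apply: continuous_comp; [exact: continuous_line|exact: cf].
  rewrite (_ : (fun t => _) = (fun t => (pd b f (line b x t))%:E) \_ `[-a, a]%classic).
    rewrite -integral_mkcond.
    have Fa : F a = 0 by apply: out; rewrite ger0_norm// ltW.
    have FNa : F (- a) = 0 by apply: out; rewrite normrN ger0_norm// ltW.
    rewrite (@continuous_FTC2 R _ F).
    - by rewrite Fa FNa sube0.
    - by rewrite gtrN.
    - exact: continuous_subspaceT.
    - split => [t _||]; first by have [] := dF t.
        exact/cvg_at_right_filter/cF.
      exact/cvg_at_left_filter/cF.
    - by move=> t _; rewrite derive1E; have [_ ->] := dF t.
  apply/funext => t; rewrite patchE; case: ifPn => // /negP nt.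
  have at_ : a < `|t|.
    rewrite ltNge; apply/negP => ta; apply: nt; rewrite inE /= in_itv /=.
    by rewrite -ler_norml.
  rewrite (@csupp_pd r b f sf)//; apply: lt_trans ra _.
  by apply: lt_le_trans at_ _; rewrite -{1}(co_line b x t); exact: co_le_enorm.
rewrite /Rintegral; case: b df cpf ipf slice => df cpf ipf slice.
  rewrite -(@integral12_prod_meas1 _ _ _ _ R leb leb _ ipf) /fubini_F.
  under eq_integral => x _ do rewrite (slice (x, 0)).
  by rewrite integral0.
rewrite -(@integral21_prod_meas1 _ _ _ _ R leb leb _ ipf) /fubini_G.
under eq_integral => y _ do rewrite (slice (0, y)).
by rewrite integral0.
Qed.

Lemma mvt_line b f x (s t : R) : s < t -> (forall y, derivable f y (ee b)) ->
  exists2 c, s < c < t &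
    f (line b x t) - f (line b x s) = pd b f (line b x c) * (t - s).
Proof.
move=> st df; pose F u := f (line b x u).
have dF (u : R) : is_derive u 1 F (pd b f (line b x u)).
  have /pd_derive/is_derive_line := df (line b x u).
  rewrite co_line; congr (is_derive _ _ _ _).
  by apply/funext => v /=; rewrite line_line.
have cF : {within `[s, t], continuous F}.
  apply: continuous_subspaceT => u; apply: differentiable_continuous.
  by apply/derivable1_diffP; have [] := dF u.
have [c cts Fc] := MVT st (fun u _ => dF u) cF.
by exists c => //; move: cts; rewrite in_itv.
Qed.

Lemma ler_dist_line b f x (s t M : R) : (forall y, derivable f y (ee b)) ->
  (forall u, Num.min s t <= u <= Num.max s t -> `|pd b f (line b x u)| <= M) ->
  `|f (line b x s) - f (line b x t)| <= M * `|s - t|.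
Proof.
move=> df; wlog st : s t / t < s => [W|].
  move=> fM; have [->|] := eqVneq s t; first by rewrite !subrr normr0 mulr0.
  rewrite neq_lt => /orP[st|ts]; last exact: W.
  rewrite distrC (distrC s); apply: W => // u; rewrite minC maxC; exact: fM.
rewrite (min_idPr (ltW st)) (max_idPl (ltW st)) => fM.
have [c /andP[tc cs] ->] := mvt_line x st df.
by rewrite normrM ler_wpM2r// fM// !ltW.
Qed.

End Partials.

(** ** Smooth functions *)

Section Smooth.
Variable R : realType.
Notation leb2 := (@leb2 R).
Implicit Types (f g : plane R -> R) (x z : plane R) (b c : bool).

Lemma CkSE k f : Ck k.+1 f <->
  [/\ continuous f, (forall b x, derivable f x (ee R b)) & forall b, Ck k (pd b f)].
Proof.
split=> [[cf df h1 h2]|[cf df h]].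
  split; [exact: cf| |by case; [exact: h2|exact: h1]].
  by case=> x; have [d1 d2] := df x; [exact: d2|exact: d1].
split; [exact: cf| |exact: (h false)|exact: (h true)].
by move=> x; split; [exact: (df false x)|exact: (df true x)].
Qed.

Lemma Ck_continuous k f : Ck k f -> continuous f.
Proof. by case: k => [|k] // /CkSE[]. Qed.

Lemma CkW k f : Ck k.+1 f -> Ck k f.
Proof.
elim: k f => [|k IH] f /CkSE[cf df h]; first exact: cf.
by apply/CkSE; split => // b; exact: IH.
Qed.

Lemma Ck_cst k (a : R) : Ck k (fun=> a).
Proof.
elim: k a => [|k IH] a; first by move=> x; exact: cvg_cst.
apply/CkSE; split=> [x|b x|b]; [exact: cvg_cst|exact: derivable_cst|].
by rewrite pd_cst; exact: IH.
Qed.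

Lemma CkD k f g : Ck k f -> Ck k g -> Ck k (fun x => f x + g x).
Proof.
elim: k f g => [|k IH] f g; first by move=> cf cg x; apply: cvgD; [exact: cf|exact: cg].
move=> /CkSE[cf df hf] /CkSE[cg dg hg]; apply/CkSE; split=> [x|b x|b].
- by apply: cvgD; [exact: cf|exact: cg].
- exact: derivableD.
- have -> : pd b (fun x => f x + g x) = (fun x => pd b f x + pd b g x).
    by apply/funext => x; exact: pdD.
  exact: IH.
Qed.

Lemma CkM k f g : Ck k f -> Ck k g -> Ck k (fun x => f x * g x).
Proof.
elim: k f g => [|k IH] f g; first by move=> cf cg x; apply: cvgM; [exact: cf|exact: cg].
move=> kf kg; have [cf df hf] := (CkSE _ _).1 kf; have [cg dg hg] := (CkSE _ _).1 kg.
apply/CkSE; split=> [x|b x|b].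
- by apply: cvgM; [exact: cf|exact: cg].
- exact: derivableM.
- have -> : pd b (fun x => f x * g x) = (fun x => f x * pd b g x + g x * pd b f x).
    by apply/funext => x; exact: pdM.
  by apply: CkD; apply: IH => //; exact: CkW.
Qed.

Lemma CkZ k (a : R) f : Ck k f -> Ck k (fun x => a * f x).
Proof. by move=> kf; apply: CkM => //; exact: Ck_cst. Qed.

Lemma Ck_affine k f (a : plane R) (s : R) : Ck k f -> Ck k (fun z => f (a + s *: z)).
Proof.
elim: k f => [|k IH] f; first exact: continuous_aff.
move=> /CkSE[cf df hf]; apply/CkSE; split=> [|b x|b].
- exact: continuous_aff.
- exact: derivable_affine.
- have -> : pd b (fun z => f (a + s *: z)) = (fun z => s * pd b f (a + s *: z)).
    by apply/funext => x; exact: pd_affine.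
  exact/CkZ/IH.
Qed.

Lemma Ck_inv k f : Ck k f -> (forall x, f x != 0) -> Ck k (fun x => (f x)^-1).
Proof.
elim: k f => [|k IH] f; first by move=> cf f0 x; apply: cvgV => //; exact: cf.
move=> kf f0; have [cf df hf] := (CkSE _ _).1 kf; apply/CkSE; split=> [x|b x|b].
- by apply: cvgV => //; exact: cf.
- exact: derivableV.
- have -> : pd b (fun x => (f x)^-1) = (fun x => (-1) * ((f x)^-1 * (f x)^-1) * pd b f x).
    apply/funext => x; rewrite /pd deriveV//.
    by rewrite /GRing.scale /= mulN1r expr2 invfM mulNr.
  have IHf : Ck k (fun x => (f x)^-1) by apply: IH => //; exact: CkW.
  by apply: CkM => //; apply: CkZ; exact: CkM.
Qed.

Lemma Ck_co k c : Ck k (@co R c).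
Proof.
have d b x := @is_derive_co R b c x.
case: k => [|k]; first exact: continuous_co.
apply/CkSE; split=> [|b x|b]; [exact: continuous_co|by have [] := d b x|].
have -> : pd b (@co R c) = fun=> (b == c)%:R by apply/funext => x; exact: derive_pd.
exact: Ck_cst.
Qed.

Lemma is_derive_comp1 b (E : R -> R) f x (d : R) :
  is_derive (f x) 1 E d -> derivable f x (ee R b) ->
  is_derive x (ee R b) (fun y => E (f y)) (d * pd b f x).
Proof.
move=> dE /pd_derive/is_derive_line df; apply/is_derive_line.
by apply: (is_derive1_comp _ df); rewrite /= line_co.
Qed.

Definition smooth f := forall k, Ck k f.

Lemma smooth_continuous f : smooth f -> continuous f.
Proof. by move=> sf; exact: (sf 0%N). Qed.

Lemma smooth_derivable f b x : smooth f -> derivable f x (ee R b).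
Proof. by move=> /(_ 1%N)/CkSE[]. Qed.

Arguments smooth_derivable {f} b x _.

Lemma smooth_pd f b : smooth f -> smooth (pd b f).
Proof. by move=> sf k; have /CkSE[] := sf k.+1. Qed.

Arguments smooth_pd {f} b _.

Lemma smoothD f g : smooth f -> smooth g -> smooth (fun x => f x + g x).
Proof. by move=> sf sg k; exact: CkD. Qed.

Lemma smoothM f g : smooth f -> smooth g -> smooth (fun x => f x * g x).
Proof. by move=> sf sg k; exact: CkM. Qed.

Lemma smoothZ (a : R) f : smooth f -> smooth (fun x => a * f x).
Proof. by move=> sf k; exact: CkZ. Qed.

Lemma smoothB f g : smooth f -> smooth g -> smooth (fun x => f x - g x).
Proof.
move=> sf sg; have := smoothD sf (smoothZ (-1) sg).
by rewrite (_ : (fun _ => _) = (fun x => f x - g x))//; apply/funext => x; rewrite mulN1r.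
Qed.

Lemma smooth_affine f (a : plane R) (s : R) : smooth f -> smooth (fun z => f (a + s *: z)).
Proof. by move=> sf k; exact: Ck_affine. Qed.

Lemma smooth_inv f : smooth f -> (forall x, f x != 0) -> smooth (fun x => (f x)^-1).
Proof. by move=> sf f0 k; exact: Ck_inv. Qed.

Lemma smooth_co c : smooth (@co R c).
Proof. by move=> k; exact: Ck_co. Qed.

Lemma smooth_cst (a : R) : smooth (fun=> a).
Proof. by move=> k; exact: Ck_cst. Qed.

Lemma pdB f g b x : smooth f -> smooth g ->
  pd b (fun y => f y - g y) x = pd b f x - pd b g x.
Proof. by move=> sf sg; apply: deriveB; exact: smooth_derivable. Qed.

(** A sequence of functions of one variable that is stable under
    differentiation, composed with a smooth function. *)
Lemma smooth_comp_family (E : nat -> R -> R) (p q : nat -> nat) (a c : nat -> R) f :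
  (forall n (t : R), is_derive t 1 (E n) (a n * E (p n) t + c n * E (q n) t)) ->
  smooth f -> forall n, smooth (fun x => E n (f x)).
Proof.
move=> dE sf n k; elim: k n => [|k IH] n.
  move=> x; apply: continuous_comp; first exact: (smooth_continuous sf).
  by apply: differentiable_continuous; apply/derivable1_diffP; have [] := dE n (f x).
have d b x := is_derive_comp1 (dE n (f x)) (smooth_derivable b x sf).
apply/CkSE; split=> [||b].
- exact: Ck_continuous (IH n).
- by move=> b x; have [] := d b x.
- have -> : pd b (fun x => E n (f x)) =
    (fun x => (a n * E (p n) (f x) + c n * E (q n) (f x)) * pd b f x).
    by apply/funext => x; apply: derive_pd.
  apply: CkM; last exact: smooth_pd.
  by apply: CkD; apply: CkZ; exact: IH.
Qed.

Lemma line_shift b x (h : R) : h *: ee R b + 1 *: x = line b x (co b x + h).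
Proof.
rewrite scale1r; case: b; case: x => x1 x2; rewrite /line /co /ee /e1 /e2.
  by rewrite -[_ + _]/((h * 0 + x1, h * 1 + x2)) mulr0 mulr1 add0r addrC.
by rewrite -[_ + _]/((h * 1 + x1, h * 0 + x2)) mulr0 mulr1 add0r addrC.
Qed.

(** The mixed second difference, computed by applying the mean value theorem
    first in the direction [b] and then in the other one. *)
Lemma mixed_difference b f x (h : R) : 0 < h -> smooth f -> exists p,
  [/\ `|co false p - co false x| <= h, `|co true p - co true x| <= h &
    f (line (~~ b) (line b x (co b x + h)) (co (~~ b) x + h))
    - f (line b x (co b x + h)) - f (line (~~ b) x (co (~~ b) x + h)) + f x
    = h ^+ 2 * pd (~~ b) (pd b f) p].
Proof.
move=> h0 sf; pose G z := f (h *: ee R (~~ b) + 1 *: z) - f z.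
have dG y : derivable G y (ee R b).
  apply: derivableB; last exact: smooth_derivable.
  by apply: derivable_affine; exact: smooth_derivable.
have xh t : t < t + h by rewrite ltrDl.
have [c /andP[c1 c2] Gc] := mvt_line x (xh (co b x)) dG.
have pG : pd b G (line b x c) =
    pd b f (h *: ee R (~~ b) + 1 *: line b x c) - pd b f (line b x c).
  rewrite /G /pd deriveB; last 2 first.
  - by apply: derivable_affine; exact: smooth_derivable.
  - exact: smooth_derivable.
  by have := @pd_affine R b f (h *: ee R (~~ b)) 1 (line b x c) (smooth_derivable _ _ sf);
    rewrite /pd mul1r => ->.
have [d /andP[d1 d2] Gd] := mvt_line (line b x c) (xh (co (~~ b) (line b x c)))
  (fun y => smooth_derivable (~~ b) y (smooth_pd b sf)).
exists (line (~~ b) (line b x c) d); split.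
- rewrite ler_norml; case: b c1 c2 d1 d2 {G dG Gc pG Gd} => /= ? ? ? ?; apply/andP; split; lra.
- rewrite ler_norml; case: b c1 c2 d1 d2 {G dG Gc pG Gd} => /= ? ? ? ?; apply/andP; split; lra.
- have k t : t + h - t = h by ring.
  rewrite k line_co in Gd; rewrite k pG line_shift Gd /G !line_shift line_co co_negb_line in Gc.
  by rewrite expr2 [RHS]mulrC mulrA -Gc; ring.
Qed.

(** Both mixed derivatives are limits of the same second difference, which is
    symmetric in the two directions. *)
Theorem schwarz b c f x : smooth f -> pd b (pd c f) x = pd c (pd b f) x.
Proof.
move=> sf; wlog -> : b c / c = ~~ b => [W|].
  by case: b; case: c; [reflexivity|exact: W|exact: W|reflexivity].
apply/eqP; rewrite -subr_eq0; apply/negP => /negP neq.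
set A := pd b _ x in neq *; set B := pd (~~ b) _ x in neq *.
have e0 : 0 < `|A - B| / 2 by rewrite divr_gt0// normr_gt0.
have cont b' c' : \forall p \near x, `|pd b' (pd c' f) x - pd b' (pd c' f) p| < `|A - B| / 2.
  have ct : {for x, continuous (pd b' (pd c' f))}.
    exact: (smooth_continuous (smooth_pd b' (smooth_pd c' sf))).
  by move: ct => /cvgrPdist_lt/(_ _ e0).
have [r /= r0 rP] := (nbhs_ballP _ _).1 (filterI (cont b (~~ b)) (cont (~~ b) b)).
have h0 : 0 < r / 2 by rewrite divr_gt0.
have near_box p : `|co false p - co false x| <= r / 2 ->
    `|co true p - co true x| <= r / 2 -> ball x r p.
  have rr : r / 2 < r by rewrite ltr_pdivrMr// mulr2n mulrDr mulr1 ltrDl.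
  by move=> h1 h2; split; rewrite -ball_normE /= distrC; exact: le_lt_trans rr.
have [p [p1 p2 pE]] := mixed_difference b x h0 sf.
have [q [q1 q2 qE]] := mixed_difference (~~ b) x h0 sf.
have [_ pB] := rP _ (near_box _ p1 p2); have [qA _] := rP _ (near_box _ q1 q2).
have : pd (~~ b) (pd b f) p = pd b (pd (~~ b) f) q.
  have h2 : (r / 2) ^+ 2 != 0 by rewrite expf_eq0 /= gt_eqF.
  apply: (mulfI h2); rewrite negbK in qE; rewrite -[LHS]pE -[RHS]qE.
  have -> (s t : R) : line b (line (~~ b) x s) t = line (~~ b) (line b x t) s.
    by clear; case: b.
  by clear; ring.
have contra (A' B' u v : R) : u = v -> `|A' - v| < `|A' - B'| / 2 ->
    `|B' - u| < `|A' - B'| / 2 -> False.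
  move=> <- h1 h2; have := ler_distD u A' B'; rewrite (distrC u) leNgt => /negP; apply.
  by rewrite [ltRHS]splitr; exact: ltrD.
by move=> pq; exact: (contra _ _ _ _ pq qA pB).
Qed.

End Smooth.

Arguments smooth_derivable {R f} b x _.
Arguments smooth_pd {R f} b _.

(** * Test functions; two integrable weights *)

Section TestFunctions.
Variable R : realType.
Implicit Types (f : plane R -> R).

Lemma closed_box (r : R) : closed [set z : plane R | `|z.1| <= r /\ `|z.2| <= r].
Proof. by apply: compact_closed; [exact: norm_hausdorff|exact: compact_box]. Qed.

Lemma smooth_test_function f (r : R) : smooth f -> csupp r f -> test_function f.
Proof.
move=> sf rf; split=> //; apply: subclosed_compact (@compact_box R r) _.
  exact: closed_closure.
rewrite [X in _ `<=` X](closure_id _).1; last exact: closed_box.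
apply: closureS => z /= /eqP fz.
have zr : enorm z <= r by rewrite leNgt; apply/negP => /rf.
split; first exact: le_trans (ler_coord1_enorm z) zr.
exact: le_trans (ler_coord2_enorm z) zr.
Qed.

Lemma test_function_smooth f : test_function f -> smooth f.
Proof. by case. Qed.

Lemma test_function_csupp f : test_function f -> exists2 r, 0 < r & csupp r f.
Proof.
move=> [_ /compact_bounded[N [Nr NM]]]; exists (2 * (`|N| + 1)).
  by rewrite mulr_gt0// ltr_wpDl.
move=> z zr; apply/eqP; apply: contraPT zr => fz; apply/negP; rewrite -leNgt.
have : `|z| <= `|N| + 1.
  apply: NM; first by rewrite (le_lt_trans (ler_norm N))// ltrDl.
  exact: subset_closure.
rewrite [`|z|]/(Num.max `|z.1| `|z.2|) ge_max => /andP[h1 h2].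
by apply: le_trans (enorm_le_coords z) _; rewrite mulr2n mulrDl mul1r lerD.
Qed.

End TestFunctions.

Section Weights.
Variable R : realType.
Notation leb2 := (@leb2 R).
Implicit Types (z : plane R).

Lemma measurable_disc (r : R) : measurable [set z : plane R | enorm z <= r].
Proof.
have -> : [set z : plane R | enorm z <= r] = setT `&` @enorm R @^-1` `]-oo, r].
  by apply/seteqP; split => z /=; rewrite in_itv /=; [split|case].
exact: measurable_enorm.
Qed.

Lemma ge0_cindic (M : R) (A : set (plane R)) z : 0 <= M -> 0 <= M * \1_A z.
Proof. by move=> M0; apply: mulr_ge0 => //; rewrite indicE. Qed.

Lemma sum_geometric_le (rho : R) n : 0 <= rho < 1 ->
  \sum_(0 <= k < n) rho ^+ k <= (1 - rho)^-1.
Proof.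
move=> /andP[r0 r1]; have d0 : 0 < 1 - rho by rewrite subr_gt0.
rewrite -[leRHS]mul1r ler_pdivlMr//.
have -> : (\sum_(0 <= k < n) rho ^+ k) * (1 - rho) = 1 - rho ^+ n.
  elim: n => [|n IH]; first by rewrite big_nil mul0r expr0 subrr.
  by rewrite big_nat_recr //= mulrDl IH exprS; ring.
by rewrite gerBl exprn_ge0.
Qed.

(** A function is integrable as soon as it is covered by the images of one
    integrable function under the powers of a dilation, when the integrals of
    those images form a convergent geometric series. *)
Lemma integ_selfsimilar (w f : plane R -> R) (c s : R) :
  measurable_fun setT w -> (forall z, 0 <= w z) ->
  integ f -> (forall z, 0 <= f z) ->
  0 <= c -> 0 < s -> c / s ^+ 2 < 1 ->
  (forall z, exists k : nat, w z <= c ^+ k * f (s ^+ k *: z)) ->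
  integ w.
Proof.
move=> mw w0 hf f0 c0 s0 cs cover; apply/integrableP; split; first exact/measurable_EFinP.
pose F (k : nat) z : \bar R := (c ^+ k * f (s ^+ k *: z))%:E.
have sk k : s ^+ k != 0 by rewrite expf_neq0// gt_eqF.
have hFk k : integ (fun z => f (s ^+ k *: z)).
  by have := integ_affine 0 (sk k) hf; apply: eq_integ => z; rewrite add0r.
have mF k : measurable_fun setT (F k).
  by apply/measurable_EFinP; exact: integ_measurable (integZ _ (hFk k)).
have F0 k z : (0 <= F k z)%E by rewrite lee_fin mulr_ge0// exprn_ge0.
set I := \int[leb2]_z f z.
have iF k : (\int[leb2]_z F k z = ((c / s ^+ 2) ^+ k * I)%:E)%E.
  have hf' := integZ (c ^+ k) (hFk k).
  rewrite -[LHS]fineK; last exact: (integrable_fin_num measurableT hf').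
  congr EFin; rewrite -/(Rintegral _ _ _) intZ//.
  have -> : \int[leb2]_z f (s ^+ k *: z) = (s ^+ k)^-1 ^+ 2 * I.
    rewrite -[X in X^-1](@gtr0_norm _ (s ^+ k)) ?exprn_gt0// -(int_affine 0)//.
    by apply: int_ext => z; rewrite add0r.
  by rewrite mulrA expr_div_n -exprM mulnC exprM exprVn.
apply: (@le_lt_trans _ _ (\int[leb2]_z \sum_(k <oo) F k z)%E).
  apply: ge0_le_integral => //.
  - by apply/measurable_EFinP; exact: measurableT_comp.
  - by apply: ge0_emeasurable_sum => *.
  - move=> z _; rewrite /= ger0_norm//; have [k wk] := cover z.
    apply: (@le_trans _ _ (F k z)); first by rewrite lee_fin.
    rewrite (@nneseriesD1 _ _ k)//=.
    by rewrite leeDl// nneseries_ge0.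
rewrite integral_nneseries//.
have I0 : 0 <= I by exact: int_ge0.
apply: (@le_lt_trans _ _ ((1 - c / s ^+ 2)^-1 * I)%:E); last exact: ltry.
apply: lime_le; first by apply: is_cvg_nneseries => n _ _; exact: integral_ge0.
apply: nearW => n; under eq_bigr do rewrite iF.
rewrite sumEFin lee_fin -mulr_suml ler_wpM2r//; apply: sum_geometric_le.
by rewrite divr_ge0 ?sqr_ge0.
Qed.

Lemma gt1_ltr_powR (a x y : R) : 1 < a -> x < y -> a `^ x < a `^ y.
Proof.
move=> a1 xy; have a0 : a != 0 by rewrite gt_eqF// (lt_trans ltr01).
by rewrite /powR (negbTE a0) ltr_expR ltr_pM2r// ln_gt0.
Qed.

Lemma ler_npowR (x y p : R) : 0 < x -> x <= y -> 0 <= p -> y `^ (- p) <= x `^ (- p).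
Proof.
move=> x0 xy p0; rewrite !powRN lef_pV2 ?posrE ?powR_gt0//; last exact: lt_le_trans xy.
by apply: ge0_ler_powR => //; rewrite nnegrE; [exact: ltW|exact: le_trans (ltW x0) xy].
Qed.

Definition wsing (p : R) z : R := \1_[set z : plane R | enorm z <= 1] z * enorm z `^ (- p).

Lemma wsing_ge0 p z : 0 <= wsing p z.
Proof. by rewrite mulr_ge0 ?powR_ge0// indicE. Qed.

Lemma wsingE p z : enorm z <= 1 -> wsing p z = enorm z `^ (- p).
Proof. by move=> z1; rewrite /wsing indicE mem_set// mul1r. Qed.

Lemma measurable_wsing p : measurable_fun setT (wsing p).
Proof.
apply: measurable_funM; first by apply: measurable_indic; exact: measurable_disc.
exact: (measurableT_comp (@measurable_powR R (- p)) (@measurable_enorm R)).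
Qed.

(** Each dyadic annulus carries [2 ^ (p - 2)] times the integral of the previous,
    larger one. *)
Lemma integ_wsing (p : R) : 0 < p < 2 -> integ (wsing p).
Proof.
move=> /andP[p0 p2]; pose M := 2 `^ p : R.
have M0 : 0 < M by exact: powR_gt0.
apply: (@integ_selfsimilar _ (fun z => M * \1_[set z : plane R | `|z.1| <= 1 /\ `|z.2| <= 1] z)
  (2 `^ p) 2) => //.
- exact: measurable_wsing.
- exact: wsing_ge0.
- exact/integZ/integ_indic_box.
- by move=> z; apply: ge0_cindic; exact: ltW.
- by rewrite ltr_pdivrMr// mul1r -powR_mulrn// gt1_ltr_powR// ltr1n.
move=> z; have [z0|z0] := eqVneq z 0.
  exists 0%N; rewrite z0 /wsing enorm0 powR0 ?mulr0 ?oppr_eq0 ?gt_eqF//.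
  by rewrite expr0 mul1r; apply: ge0_cindic; exact: ltW.
have ez := enorm_gt0 z0; have [z1|z1] := leP (enorm z) 1; last first.
  exists 0%N; rewrite /wsing indicE memNset/=; last by apply/negP; rewrite -ltNge.
  by rewrite mul0r expr0 mul1r; apply: ge0_cindic; exact: ltW.
have [m zm] : exists m, 1 < 2 ^+ m.+1 * enorm z.
  have [m zm] := ltr_add_invr ez.
  exists m; rewrite -ltr_pdivrMl ?exprn_gt0// mulr1 (le_lt_trans _ zm)// add0r.
  by rewrite lef_pV2 ?posrE ?exprn_gt0// -natrX ler_nat; exact/ltnW/ltn_expl.
have exm : exists m, 1 < 2 ^+ m.+1 * enorm z by exists m.
case: (ex_minnP exm) => k zk kmin; exists k.
have ek : enorm (2 ^+ k *: z) <= 1.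
  rewrite enormZ ger0_norm ?exprn_ge0//; case: k zk kmin => [|k] zk kmin.
    by rewrite expr0 mul1r.
  by rewrite leNgt; apply/negP => /kmin; rewrite ltnn.
rewrite wsingE// indicE mem_set; last first.
  split => /=.
    exact: le_trans (ler_coord1_enorm (2 ^+ k *: z)) ek.
  exact: le_trans (ler_coord2_enorm (2 ^+ k *: z)) ek.
rewrite mulr1 /M -exprSr -powR_mulrn ?powR_ge0// -powRrM mulrC powRrM powR_mulrn//.
have k0 : 0 < (2 ^+ k.+1)^-1 :> R by rewrite invr_gt0 exprn_gt0.
have := @ler_npowR (2 ^+ k.+1)^-1 (enorm z) p k0 _ (ltW p0).
rewrite -ltr_pdivrMl ?exprn_gt0// mulr1 in zk => /(_ (ltW zk))/le_trans; apply.
have X0 : 0 <= 2 ^+ k.+1 :> R by rewrite exprn_ge0.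
by rewrite powRN -(powR_inv1 X0) -powRrM mulN1r powRN invrK.
Qed.

Definition wtail (q : R) z : R := (1 + enorm z) `^ (- q).

Lemma wtail_ge0 q z : 0 <= wtail q z. Proof. exact: powR_ge0. Qed.

Lemma measurable_wtail q : measurable_fun setT (wtail q).
Proof.
have m1 : measurable_fun setT (fun z : plane R => 1 + enorm z).
  by apply: measurable_funD => //; exact: measurable_enorm.
exact: (measurableT_comp (@measurable_powR R (- q)) m1).
Qed.

Lemma integ_wtail (q : R) : 2 < q -> integ (wtail q).
Proof.
move=> q2; pose M := 2 `^ q : R; have q0 : 0 < q by exact: lt_trans q2.
have M0 : 0 < M by exact: powR_gt0.
have M1 : 1 <= M by rewrite -(powRr0 2); apply: ler_powR; [rewrite ler1n|exact: ltW].
apply: (@integ_selfsimilar _ (fun z => M * \1_[set z : plane R | `|z.1| <= 1 /\ `|z.2| <= 1] z)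
  (M^-1) 2^-1) => //.
- exact: measurable_wtail.
- exact: wtail_ge0.
- exact/integZ/integ_indic_box.
- by move=> z; apply: ge0_cindic; exact: ltW.
- by rewrite invr_ge0 ltW.
- by rewrite -exprVn invrK mulrC ltr_pdivrMr// mul1r -powR_mulrn// gt1_ltr_powR// ltr1n.
move=> z; have [m zm] : exists m, enorm z <= 2 ^+ m.
  have := archi_boundP (enorm_ge0 z); set n := Num.bound _ => zn.
  exists n; rewrite (le_trans (ltW zn))// -natrX ler_nat; exact/ltnW/ltn_expl.
have exm : exists m, enorm z <= 2 ^+ m by exists m.
case: (ex_minnP exm) => k zk kmin; exists k.
have ek : enorm (2^-1 ^+ k *: z) <= 1.
  rewrite enormZ ger0_norm ?exprn_ge0// exprVn mulrC ler_pdivrMr ?exprn_gt0//.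
  by rewrite mul1r.
rewrite indicE mem_set; last first.
  split => /=.
    exact: le_trans (ler_coord1_enorm (2^-1 ^+ k *: z)) ek.
  exact: le_trans (ler_coord2_enorm (2^-1 ^+ k *: z)) ek.
rewrite mulr1 /wtail; case: k zk kmin {ek} => [|k] zk kmin.
  rewrite expr0 mul1r; apply: le_trans M1.
  have e1 : 1 <= 1 + enorm z by rewrite lerDl enorm_ge0.
  by rewrite -[leRHS](powRr0 (1 + enorm z)); apply: ler_powR => //; rewrite oppr_le0 ltW.
have zk' : 2 ^+ k <= 1 + enorm z.
  have : 2 ^+ k < enorm z by rewrite ltNge; apply/negP => /kmin; rewrite ltnn.
  by move=> /ltW/le_trans; apply; rewrite lerDr.
apply: le_trans (ler_npowR _ zk' (ltW q0)) _; first by rewrite exprn_gt0.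
by rewrite exprSr mulfVK ?gt_eqF// /M -powRN -powR_mulrn ?powR_ge0// powRAC powR_mulrn.
Qed.

End Weights.

(** * The regularized Biot-Savart kernel *)

Section FlatFunctions.
Variable R : realType.

(** The functions [exp (- 1 / t) / t ^ n], extended by zero to [t <= 0]:
    they are smooth because derivation permutes their linear combinations. *)
Definition flat (n : nat) (t : R) : R :=
  if 0 < t then t^-1 ^+ n * expR (- t^-1) else 0.

Lemma flat_ge0 n t : 0 <= flat n t.
Proof.
rewrite /flat; case: ifPn => // t0.
by rewrite mulr_ge0 ?expR_ge0// exprn_ge0// invr_ge0 ltW.
Qed.

Lemma flat_gt0 n t : 0 < t -> 0 < flat n t.
Proof. by move=> t0; rewrite /flat t0 mulr_gt0 ?expR_gt0// exprn_gt0// invr_gt0. Qed.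

Lemma flat_le0 n t : t <= 0 -> flat n t = 0.
Proof. by move=> t0; rewrite /flat ltNge t0. Qed.

Lemma flat_le_sqr n t : flat n t <= (n.+2)`!%:R * t ^+ 2.
Proof.
rewrite /flat; case: ifPn => [t0|_]; last by rewrite mulr_ge0 ?sqr_ge0.
have it : 0 <= t^-1 by rewrite invr_ge0 ltW.
have tn : t != 0 by rewrite gt_eqF.
have f0 : 0 < (n.+2)`!%:R :> R by rewrite ltr0n fact_gt0.
have : t^-1 ^+ n.+2 / (n.+2)`!%:R <= expR t^-1.
  by apply: le_trans (expR_ge1Dxn n.+1 it); rewrite lerDr.
rewrite ler_pdivrMr// expRN ler_pdivrMr ?expR_gt0// => h.
rewrite -(ler_pM2l (_ : 0 < t^-1 ^+ 2)); last by rewrite exprn_gt0// invr_gt0.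
rewrite -exprD add2n (le_trans h)// le_eqVlt; apply/orP; left; apply/eqP.
by rewrite exprVn; field.
Qed.

Lemma is_derive_flat n (t : R) :
  is_derive t 1 (flat n) (1 * flat n.+2 t + - n%:R * flat n.+1 t).
Proof.
have [t0|t0|<-] := ltgtP 0 t.
- pose f (s : R) := s^-1 ^+ n * expR (- s^-1).
  apply: (@near_eq_is_derive _ _ _ f).
    near=> s; rewrite /flat /f; case: ifPn => // /negP; case.
    by near: s; exact: lt_nbhsr.
  have dV : is_derive t 1 (fun s : R => s^-1) (- t ^- 2).
    have := @is_deriveV R id t 1 1 (lt0r_neq0 t0) (is_derive_id t (1 : R)).
    by rewrite /GRing.scale /= mulr1.
  have dX : is_derive t 1 (fun s : R => s^-1 ^+ n) (n%:R * t^-1 ^+ n.-1 * - t ^- 2).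
    apply: (@is_derive1_comp _ (fun s => s ^+ n) (fun s => s^-1)) => //.
    by apply: DeriveDef; [exact: exprn_derivable|rewrite exp_derive /GRing.scale /= mulr1].
  have dE : is_derive t 1 (fun s : R => expR (- s^-1)) (expR (- t^-1) * - (- t ^- 2)).
    by apply: (@is_derive1_comp _ expR (fun s => - s^-1)).
  apply: (is_derive_eq (is_deriveM dX dE)).
  rewrite /flat t0 /GRing.scale /= opprK mul1r.
  have tn : t != 0 by rewrite gt_eqF.
  case: (n) => [|m]; first by rewrite mulr0n !expr0 expr2; field.
  by rewrite /= !exprSr !exprVn; field; rewrite tn expf_neq0.
- apply: (@near_eq_is_derive _ _ _ (cst 0)).
    by near=> s; rewrite flat_le0//; apply: ltW; near: s; exact: lt_nbhsl.
  by rewrite !flat_le0 ?ltW// !mulr0 addr0; exact: is_derive_cst.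
- have E0 k : flat k 0 = 0 by rewrite flat_le0.
  rewrite !E0 !mulr0 addr0.
  have lim0 : (fun h : R => h^-1 *: ((flat n \o shift 0) (h *: (1 : R)) - flat n 0))
      @ 0^' --> (0 : R).
    apply/cvgrPdist_lt => e e0; near=> h.
    have hn : h != 0 by near: h; exact: nbhs_dnbhs_neq.
    rewrite E0 subr0 /= addr0 /GRing.scale /= mulr1 sub0r normrN normrM normfV.
    have f0 : 0 < (n.+2)`!%:R :> R by rewrite ltr0n fact_gt0.
    rewrite (ger0_norm (flat_ge0 _ _)) ltr_pdivrMl ?normr_gt0//.
    apply: le_lt_trans (flat_le_sqr _ _) _.
    rewrite -real_normK ?num_real// expr2 mulrCA ltr_pM2l ?normr_gt0//.
    rewrite mulrC -ltr_pdivlMr//.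
    near: h; apply: dnbhs0_lt; exact: divr_gt0.
  apply: DeriveDef; first by apply/cvg_ex; exists 0.
  exact: cvg_lim.
Unshelve. all: by end_near. Qed.

End FlatFunctions.

Section Kernel.
Variable R : realType.
Notation leb2 := (@leb2 R).
Implicit Types (z x : plane R) (b i j l : bool).

Definition sqn z : R := co false z * co false z + co true z * co true z.

Lemma sqnE z : sqn z = enorm z ^+ 2.
Proof. by rewrite sqr_enorm !expr2. Qed.

Lemma sqn_ge0 z : 0 <= sqn z. Proof. by rewrite sqnE sqr_ge0. Qed.

(** [den] replaces the squared distance in the Biot-Savart kernel: it is smooth
    and positive, and equal to the squared distance outside the unit disc, so
    that the kernel is modified on the unit disc only. *)
Definition den z : R := sqn z + flat 0 (1 - sqn z).

Lemma den_gt0 z : 0 < den z.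
Proof.
rewrite /den; have [s1|s1] := ltP (sqn z) 1.
  by rewrite ltr_wpDl ?sqn_ge0// flat_gt0// subr_gt0.
by rewrite ltr_pwDl ?flat_ge0// (lt_le_trans ltr01).
Qed.

Lemma den_out z : 1 <= enorm z -> den z = enorm z ^+ 2.
Proof.
move=> z1; rewrite /den flat_le0 ?addr0 ?sqnE// subr_le0.
by rewrite expr_ge1// enorm_ge0.
Qed.

Lemma smooth_sqn : smooth sqn.
Proof. by apply: smoothD; apply: smoothM; exact: smooth_co. Qed.

Lemma smooth_flat_sqn n : smooth (fun z => flat n (1 - sqn z)).
Proof.
apply: (@smooth_comp_family R (@flat R) (fun n => n.+2) (fun n => n.+1)
  (fun=> 1) (fun n => - n%:R)); first exact: is_derive_flat.
by apply: smoothB; [exact: smooth_cst|exact: smooth_sqn].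
Qed.

Lemma smooth_den : smooth den.
Proof. by apply: smoothD; [exact: smooth_sqn|exact: smooth_flat_sqn]. Qed.

Lemma smooth_den_inv : smooth (fun z => (den z)^-1).
Proof. by apply: smooth_inv; [exact: smooth_den|move=> z; rewrite gt_eqF ?den_gt0]. Qed.

Lemma pd_co b j z : pd b (@co R j) z = (b == j)%:R.
Proof. exact: derive_pd (is_derive_co b j z). Qed.

Lemma pd_sqn b z : pd b sqn z = 2 * co b z.
Proof.
have sM j : smooth (fun z : plane R => co j z * co j z).
  by apply: smoothM; exact: smooth_co.
rewrite /sqn pdD; [|apply: smooth_derivable; exact: (sM false)
                   |apply: smooth_derivable; exact: (sM true)].
have dco j : derivable (@co R j) z (ee R b) by apply: smooth_derivable; exact: smooth_co.
rewrite !pdM//; try exact: dco.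
by rewrite !pd_co; case: (b) => /=; ring.
Qed.

(** Derivative of the profile of [den] with respect to the squared distance. *)
Definition dden z : R := 1 - flat 2 (1 - sqn z).

Lemma pd_den b z : pd b den z = 2 * co b z * dden z.
Proof.
rewrite /den pdD; [|apply: smooth_derivable; exact: smooth_sqn
                   |apply: smooth_derivable; exact: smooth_flat_sqn].
have s1 : smooth (fun z => 1 - sqn z).
  by apply: smoothB; [exact: smooth_cst|exact: smooth_sqn].
have := is_derive_comp1 (is_derive_flat 0 (1 - sqn z)) (smooth_derivable b z s1).
move=> /derive_pd ->; rewrite pdB; [|exact: smooth_cst|exact: smooth_sqn].
by rewrite pd_cst pd_sqn /dden; ring.
Qed.

Lemma pd_den_inv b z : pd b (fun z => (den z)^-1) z = - (2 * co b z * dden z) / den z ^+ 2.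
Proof.
rewrite /pd deriveV ?gt_eqF ?den_gt0//; last by apply: smooth_derivable; exact: smooth_den.
have := pd_den b z; rewrite /pd => ->.
by rewrite /GRing.scale /=; ring.
Qed.

Definition sg j : R := if j then 1 else -1.

Definition kr j z : R := (2 * pi)^-1 * (sg j * (co (~~ j) z * (den z)^-1)).

Definition kbs j x : R := co j (biot_savart_kernel x).

Lemma kbsE j x : kbs j x = (2 * pi)^-1 * (sg j * (co (~~ j) x / enorm x ^+ 2)).
Proof. by rewrite /kbs /biot_savart_kernel /sg; case: j => /=; rewrite ?mul1r ?mulN1r ?mulNr. Qed.

Lemma kr_out j z : 1 <= enorm z -> kr j z = kbs j z.
Proof. by move=> z1; rewrite kbsE /kr den_out. Qed.

Lemma smooth_co_den j : smooth (fun z => co j z * (den z)^-1).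
Proof. by apply: smoothM; [exact: smooth_co|exact: smooth_den_inv]. Qed.

Lemma smooth_kr j : smooth (kr j).
Proof. by apply: smoothZ; apply: smoothZ; exact: smooth_co_den. Qed.

Lemma pd_kr i j z : pd i (kr j) z = (2 * pi)^-1 * (sg j *
  ((i == ~~ j)%:R / den z - co (~~ j) z * (2 * co i z * dden z) / den z ^+ 2)).
Proof.
rewrite /kr pdZ; last by apply: smooth_derivable; apply: smoothZ; exact: smooth_co_den.
rewrite pdZ; last by apply: smooth_derivable; exact: smooth_co_den.
rewrite pdM; [|apply: smooth_derivable; exact: smooth_co
              |apply: smooth_derivable; exact: smooth_den_inv].
by rewrite pd_co pd_den_inv; ring.
Qed.

(** The kernel is the rotation by a right angle of a radial field. *)
Lemma div_kr z : pd false (kr false) z + pd true (kr true) z = 0.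
Proof. by rewrite !pd_kr /=; ring. Qed.

(** The vorticity of the regularized kernel, an approximate Dirac mass. *)
Definition eta z : R := pd false (kr true) z - pd true (kr false) z.

Lemma smooth_eta : smooth eta.
Proof. by apply: smoothB; apply: smooth_pd; exact: smooth_kr. Qed.

(** The terms that do not involve [flat] cancel: the Biot-Savart kernel is
    irrotational off the origin. What remains is manifestly nonnegative. *)
Lemma etaE z : eta z =
  pi^-1 * ((flat 0 (1 - sqn z) + sqn z * flat 2 (1 - sqn z)) / den z ^+ 2).
Proof.
have d0 : den z != 0 by rewrite gt_eqF// den_gt0.
have p0 : pi != 0 :> R by rewrite gt_eqF// pi_gt0.
have dE : flat 0 (1 - sqn z) = den z - sqn z by rewrite /den; ring.
rewrite /eta !pd_kr /= /dden dE; move: (flat 2 _) (den z) d0 => F D D0.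
by rewrite /sqn; move: (pi) p0 => P P0; field; rewrite D0.
Qed.

Lemma eta_ge0 z : 0 <= eta z.
Proof.
rewrite etaE mulr_ge0 ?invr_ge0 ?pi_ge0// divr_ge0 ?sqr_ge0//.
by rewrite addr_ge0 ?flat_ge0// mulr_ge0 ?flat_ge0 ?sqn_ge0.
Qed.

Lemma eta_gt0 z : enorm z < 1 -> 0 < eta z.
Proof.
move=> z1; rewrite etaE mulr_gt0 ?invr_gt0 ?pi_gt0// divr_gt0 ?exprn_gt0 ?den_gt0//.
rewrite ltr_pwDl ?mulr_ge0 ?flat_ge0 ?sqn_ge0// flat_gt0// subr_gt0 sqnE.
by rewrite expr_lt1 ?enorm_ge0.
Qed.

Lemma csupp_eta : csupp 1 eta.
Proof.
move=> z z1; rewrite etaE !flat_le0 ?mulr0 ?addr0 ?mul0r ?mulr0//.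
  by rewrite subr_le0 sqnE expr_ge1 ?enorm_ge0// ltW.
by rewrite subr_le0 sqnE expr_ge1 ?enorm_ge0// ltW.
Qed.

Lemma integ_eta : integ eta.
Proof. exact: integ_csupp (smooth_continuous smooth_eta) csupp_eta. Qed.

Definition mass : R := \int[leb2]_z eta z.

Lemma mass_gt0 : 0 < mass.
Proof.
rewrite lt_neqAle int_ge0 ?andbT; last exact: eta_ge0.
apply/negP => /eqP m0.
have /eqP : (\int[leb2]_z `|(eta z)%:E| = 0)%E.
  have : (\int[leb2]_z (eta z)%:E = 0)%E.
    rewrite -[LHS]fineK; last exact: (integrable_fin_num measurableT integ_eta).
    by congr EFin; rewrite -/(Rintegral _ _ _) -/mass -m0.
  by under eq_integral do rewrite -[(eta _)%:E]gee0_abs ?lee_fin ?eta_ge0//.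
rewrite eq_le => /andP[+ _].
pose c := eta 0 / 2; have e0 : 0 < eta 0 by apply: eta_gt0; rewrite enorm0.
have c0 : 0 < c by exact: divr_gt0.
have ce : {for (0 : plane R), continuous eta} by exact: (smooth_continuous smooth_eta).
have [r /= r0 rP] := (nbhs_ballP _ _).1 ((cvgrPdist_lt _ _).1 ce _ c0).
have B0 z : `|z.1| <= r / 2 -> `|z.2| <= r / 2 -> c <= eta z.
  move=> z1 z2; have rr : r / 2 < r by rewrite ltr_pdivrMr// mulr2n mulrDr mulr1 ltrDl.
  have := rP z; rewrite /= ltr_norml => /(_ _)/andP[|_].
    by split; rewrite -ball_normE /= sub0r normrN; exact: le_lt_trans rr.
  by rewrite ltrBlDr -ltrBlDl => /ltW; apply: le_trans; rewrite /c; lra.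
pose B := `[- (r / 2), r / 2]%classic `*` `[- (r / 2), r / 2]%classic : set (plane R).
have mB : measurable B by apply: measurableX; exact: measurable_itv.
rewrite leNgt => /negP; apply; apply: (@lt_le_trans _ _ (\int[leb2]_(z in B) (cst c%:E) z)%E).
  rewrite integral_cst// mule_gt0 ?lte_fin// leb2X; try exact: measurable_itv.
  rewrite /= !lebesgue_measure_itv /= lte_fin gtrN ?divr_gt0//.
  by rewrite -EFinB -EFinM lte_fin opprK mulr_gt0// addr_gt0// divr_gt0.
apply: (@le_trans _ _ (\int[leb2]_(z in B) `|(eta z)%:E|)%E).
  apply: ge0_le_integral => //.
  - by move=> z _; rewrite lee_fin ltW.
  - apply: measurable_funTS; apply: measurableT_comp => //.
    by apply/measurable_EFinP; exact: integ_measurable integ_eta.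
  - move=> z [/=]; rewrite !in_itv /= -!ler_norml => z1 z2.
    by rewrite lee_fin (le_trans (B0 z z1 z2))// ler_norm.
apply: ge0_subset_integral => //.
apply: measurableT_comp => //.
by apply/measurable_EFinP; exact: integ_measurable integ_eta.
Qed.

End Kernel.

(** * Scaling of the kernel *)

Section Homogeneity.
Variable R : realType.
Implicit Types (f : plane R -> R) (z x : plane R) (b i j l : bool) (e h C : R).

(** Exact homogeneity of degree [- m] off the unit disc; the regularized kernel
    and its derivatives have it because the Biot-Savart kernel is homogeneous. *)
Definition hom_out (m : nat) f := forall e z, 0 < e <= 1 -> 1 < enorm z ->
  e^-1 ^+ m * f (e^-1 *: z) = f z.

Lemma hom_out_pd m b f : smooth f -> hom_out m f -> hom_out m.+1 (pd b f).
Proof.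
move=> sf hf e z e01 z1.
have -> : pd b f z = pd b (fun y => e^-1 ^+ m * f (0 + e^-1 *: y)) z.
  apply: near_eq_derive.
  have : nbhs z [set y : plane R | 1 < enorm y].
    by apply: open_nbhs_nbhs; split=> //; exact: open_enorm_gt.
  by apply: filterS => y y1; rewrite add0r hf.
rewrite pdZ; last by apply: smooth_derivable; exact: smooth_affine.
rewrite pd_affine; last exact: smooth_derivable.
by rewrite add0r mulrA -exprSr.
Qed.

(** Homogeneity extends a bound on the disc of radius 2 to the whole plane, with
    the decay of degree [m]. *)
Lemma hom_out_bound m f : continuous f -> hom_out m f ->
  exists2 C, 0 < C & forall z, `|f z| * (1 + enorm z) ^+ m <= C.
Proof.
move=> cf hf; have [M M0 fM] := continuous_bounded_disc 2 cf.
exists (M * 4 ^+ m) => [|z]; first by rewrite mulr_gt0// exprn_gt0.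
have z0 := enorm_ge0 z; have [z2|z2] := leP (enorm z) 2.
  apply: ler_pM => //; [by rewrite exprn_ge0// addr_ge0|exact: fM|].
  by apply: lerXn2r; rewrite ?nnegrE ?addr_ge0//; lra.
have zp : 0 < enorm z by rewrite (lt_trans _ z2).
pose e := 2 / enorm z; have e0 : 0 < e by rewrite divr_gt0.
have e1 : e <= 1 by rewrite ler_pdivrMr// mul1r ltW.
have ez : enorm (e *: z) = 2 by rewrite enormZ gtr0_norm// mulfVK// gt_eqF.
have := @hf e (e *: z); rewrite e0 e1 ez ltr1n => /(_ isT isT).
rewrite scalerA mulVf ?gt_eqF// scale1r => E.
have fe : `|f (e *: z)| <= M by rewrite fM// ez.
have -> : `|f z| = e ^+ m * `|f (e *: z)|.
  rewrite -E normrM exprVn normfV (ger0_norm (exprn_ge0 _ (ltW e0))) mulrA.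
  by rewrite mulfV ?mul1r// expf_neq0// gt_eqF.
have ez1 : 0 <= e * (1 + enorm z) by rewrite mulr_ge0 ?addr_ge0// ltW.
rewrite mulrAC -exprMn mulrC; apply: ler_pM => //; first exact: exprn_ge0.
apply: lerXn2r; rewrite ?nnegrE//.
by rewrite /e mulrAC ler_pdivrMr//; lra.
Qed.

(** The weight [1 + enorm] varies by a bounded factor within distance 1, so the
    decay of the gradient passes to increments. *)
Lemma lip_decay m f C : 0 <= C -> (forall b y, derivable f y (ee R b)) ->
  (forall b z, `|pd b f z| * (1 + enorm z) ^+ m <= C) ->
  forall z y, enorm (z - y) <= 1 ->
    `|f z - f y| * (1 + enorm z) ^+ m <= (2 * 3 ^+ m * C) * enorm (z - y).
Proof.
move=> C0 df fC z y zy1; have z0 := enorm_ge0 z.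
have p0 : 0 < (1 + enorm z) ^+ m by rewrite exprn_gt0// ltr_wpDr.
pose B := 3 ^+ m * C / (1 + enorm z) ^+ m.
have near_bound b u : enorm (z - u) <= 2 -> `|pd b f u| <= B.
  move=> zu; have u0 := enorm_ge0 u.
  have pu : 0 < (1 + enorm u) ^+ m by rewrite exprn_gt0// ltr_wpDr.
  rewrite ler_pdivlMr//.
  have zu3 : (1 + enorm z) ^+ m <= 3 ^+ m * (1 + enorm u) ^+ m.
    rewrite -exprMn; apply: lerXn2r; rewrite ?nnegrE ?mulr_ge0 ?addr_ge0//.
    by have := ler_enorm_dist z u; lra.
  apply: (@le_trans _ _ (`|pd b f u| * (3 ^+ m * (1 + enorm u) ^+ m))).
    by rewrite ler_wpM2l.
  by rewrite mulrCA ler_wpM2l ?exprn_ge0.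
pose w := line false z (co false y).
have d1 : `|co false z - co false y| <= enorm (z - y) by exact: (co_le_enorm false (z - y)).
have d2 : `|co true z - co true y| <= enorm (z - y) by exact: (co_le_enorm true (z - y)).
have seg (s t u : R) : Num.min s t <= u <= Num.max s t -> `|s - u| <= `|s - t|.
  by rewrite ge_min le_max !ler_norml => /andP[/orP[] ? /orP[] ?];
    case: (lerP s t) => ?; apply/andP; split; lra.
have step1 : `|f z - f w| <= B * enorm (z - y).
  rewrite -{1}(line_co false z) /w.
  apply: le_trans (ler_dist_line (M := B) _ _) _; [exact: df| |].
    move=> u /seg su; apply: near_bound; rewrite -{1}(line_co false z) enorm_line.
    by apply: le_trans su _; lra.
  by apply: ler_wpM2l => //; rewrite divr_ge0 ?mulr_ge0 ?exprn_ge0 ?addr_ge0.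
have yw : y = line true w (co true y) by rewrite /w; case: (y).
have ww : w = line true w (co true z) by rewrite /w; case: (z).
have step2 : `|f w - f y| <= B * enorm (z - y).
  rewrite {1}ww {1}yw.
  apply: le_trans (ler_dist_line (M := B) _ _) _; [exact: df| |].
    move=> u /seg su; apply: near_bound.
    have -> : z - line true w u = (z - w) + (w - line true w u) by rewrite subrKA.
    apply: le_trans (enorm_triangle _ _) _.
    have -> : enorm (z - w) = `|co false z - co false y|.
      by rewrite -{1}(line_co false z) enorm_line.
    have -> : enorm (w - line true w u) = `|co true z - u|.
      by rewrite {1}ww enorm_line.
    lra.
  by apply: ler_wpM2l => //; rewrite divr_ge0 ?mulr_ge0 ?exprn_ge0 ?addr_ge0.
have : `|f z - f y| <= 2 * B * enorm (z - y).
  by apply: le_trans (ler_distD (f w) _ _) _; rewrite mulr2n mulrDl mul1r mulrDl lerD.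
rewrite -(ler_pM2r p0) => /le_trans; apply.
by rewrite /B le_eqVlt; apply/orP; left; apply/eqP; field; rewrite gt_eqF.
Qed.

Lemma bool_bound (T : bool -> R -> Prop) :
  (forall b C C', C <= C' -> T b C -> T b C') -> (forall b, exists2 C, 0 < C & T b C) ->
  exists2 C, 0 < C & forall b, T b C.
Proof.
move=> mono ex; have [C0 c0 T0] := ex false; have [C1 c1 T1] := ex true.
exists (C0 + C1); first exact: addr_gt0.
by case; [apply: mono T1|apply: mono T0]; rewrite ?lerDl ?lerDr ltW.
Qed.

End Homogeneity.

Section ScaledKernel.
Variable R : realType.
Implicit Types (f : plane R -> R) (z x y : plane R) (b i j l : bool) (e h C : R).

Lemma kbsZ e j z : 0 < e -> kbs j (e *: z) = e^-1 * kbs j z.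
Proof.
move=> e0; rewrite !kbsE enormZ gtr0_norm//.
have -> : co (~~ j) (e *: z) = e * co (~~ j) z by case: j.
have [->|z0] := eqVneq z 0; first by rewrite enorm0 !(mulr0, expr0n) /= invr0 !mulr0.
have ez := lt0r_neq0 (enorm_gt0 z0); have en := lt0r_neq0 e0.
by move: ((2 * pi)^-1) => P; field; rewrite ez en.
Qed.

Definition kre e j z : R := e^-1 * kr j (e^-1 *: z).

Lemma kre_out e j z : 0 < e -> e <= enorm z -> kre e j z = kbs j z.
Proof.
move=> e0 ez; rewrite /kre kr_out.
  by rewrite kbsZ ?invr_gt0// invrK mulrA mulVf ?gt_eqF// mul1r.
by rewrite enormZ gtr0_norm ?invr_gt0// mulrC ler_pdivlMr// mul1r.
Qed.

Lemma hom_out_kr j : hom_out 1 (@kr R j).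
Proof.
move=> e z /andP[e0 e1] z1; rewrite expr1 -/(kre e j z) kre_out// ?kr_out// ltW//.
exact: le_lt_trans z1.
Qed.

Lemma hom_out_dkr i j : hom_out 2 (pd i (@kr R j)).
Proof. by apply: hom_out_pd; [exact: smooth_kr|exact: hom_out_kr]. Qed.

Lemma kr_bound : exists2 C, 0 < C & forall j z, `|@kr R j z| * (1 + enorm z) <= C.
Proof.
apply: bool_bound => [j C C' CC' TC z|j]; first exact: le_trans (TC z) CC'.
apply: (@hom_out_bound _ 1); last exact: hom_out_kr.
by apply: smooth_continuous; exact: smooth_kr.
Qed.

Lemma dkr_bound : exists2 C, 0 < C &
  forall i j z, `|pd i (@kr R j) z| * (1 + enorm z) ^+ 2 <= C.
Proof.
apply: bool_bound => [i C C' CC' TC j z|i]; first exact: le_trans (TC j z) CC'.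
apply: bool_bound => [j C C' CC' TC z|j]; first exact: le_trans (TC z) CC'.
apply: hom_out_bound; last exact: hom_out_dkr.
by apply: smooth_continuous; apply: smooth_pd; exact: smooth_kr.
Qed.

Lemma dkr_lip : exists2 C, 0 < C &
  forall i j z y, enorm (z - y) <= 1 ->
  `|pd i (@kr R j) z - pd i (kr j) y| * (1 + enorm z) ^+ 3 <= C * enorm (z - y).
Proof.
have [C C0 TC] : exists2 C, 0 < C &
    forall i j l z, `|pd l (pd i (@kr R j)) z| * (1 + enorm z) ^+ 3 <= C.
  apply: bool_bound => [i C C' CC' TC j l z|i]; first exact: le_trans (TC j l z) CC'.
  apply: bool_bound => [j C C' CC' TC l z|j]; first exact: le_trans (TC l z) CC'.
  apply: bool_bound => [l C C' CC' TC z|l]; first exact: le_trans (TC z) CC'.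
  have sd : smooth (pd i (@kr R j)) by apply: smooth_pd; exact: smooth_kr.
  apply: hom_out_bound; first by apply: smooth_continuous; exact: smooth_pd.
  by apply: hom_out_pd => //; exact: hom_out_dkr.
exists (2 * 3 ^+ 3 * C) => [|i j z y zy]; first by rewrite !mulr_gt0// exprn_gt0.
apply: lip_decay => //; first exact: ltW.
by move=> b u; apply: smooth_derivable; apply: smooth_pd; exact: smooth_kr.
Qed.

Definition dkre e i j z : R := e^-1 ^+ 2 * pd i (kr j) (e^-1 *: z).

Lemma smooth_scale (c s : R) f : smooth f -> smooth (fun z => c * f (s *: z)).
Proof.
move=> sf; have -> : (fun z => c * f (s *: z)) = (fun z => c * f (0 + s *: z)).
  by apply/funext => z; rewrite add0r.
by apply: smoothZ; exact: smooth_affine.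
Qed.

Lemma smooth_kre e j : smooth (kre e j).
Proof. by apply: smooth_scale; exact: smooth_kr. Qed.

Lemma pd_kre e i j z : pd i (kre e j) z = dkre e i j z.
Proof.
have -> : kre e j = (fun z => e^-1 * kr j (0 + e^-1 *: z)).
  by apply/funext => y; rewrite add0r.
have sk := @smooth_kr R j.
rewrite pdZ; last by apply: smooth_derivable; exact: smooth_affine.
by rewrite pd_affine; [rewrite add0r mulrA|apply: smooth_derivable].
Qed.

Definition etae e z : R := e^-1 ^+ 2 * eta (e^-1 *: z).

Lemma etaeE e z : etae e z = dkre e false true z - dkre e true false z.
Proof. by rewrite /etae /eta /dkre mulrBr. Qed.

Lemma div_kre e z : dkre e false false z + dkre e true true z = 0.
Proof. by rewrite /dkre -mulrDr div_kr mulr0. Qed.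

Lemma etae_ge0 e z : 0 <= etae e z.
Proof. by rewrite mulr_ge0 ?eta_ge0// sqr_ge0. Qed.

Lemma csupp_scale (r : R) f e : 0 < e -> csupp r f -> csupp (e * r) (fun z => f (e^-1 *: z)).
Proof.
move=> e0 sf z ez; apply: sf.
by rewrite enormZ gtr0_norm ?invr_gt0// mulrC ltr_pdivlMr// mulrC.
Qed.

Lemma csupp_etae e : 0 < e -> csupp e (etae e).
Proof.
move=> e0 z ez; have := csupp_scale e0 (@csupp_eta R); rewrite mulr1 => /(_ z ez).
by rewrite /etae => ->; rewrite mulr0.
Qed.

Lemma smooth_etae e : smooth (etae e).
Proof. by apply: smooth_scale; exact: smooth_eta. Qed.

Lemma integ_etae e : 0 < e -> integ (etae e).
Proof.
by move=> e0; exact: integ_csupp (smooth_continuous (smooth_etae e)) (csupp_etae e0).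
Qed.

Lemma int_etae e : 0 < e -> \int[@leb2 R]_z etae e z = mass R.
Proof.
move=> e0; have ei : e^-1 != 0 by rewrite gt_eqF ?invr_gt0.
have := int_affine 0 ei (@integ_eta R); rewrite gtr0_norm ?invr_gt0// invrK => E.
have ia := integ_affine 0 ei (@integ_eta R).
rewrite /etae; transitivity (e^-1 ^+ 2 * \int[@leb2 R]_z eta (0 + e^-1 *: z)).
  by rewrite -(intZ _ ia); apply: int_ext => z; rewrite add0r.
by rewrite E mulrA -exprMn mulVf ?gt_eqF// expr1n mul1r.
Qed.

(** The difference of the kernels at the scales [e] and [1] is a test function:
    all weak identities will be tested with it and its derivatives. *)
Definition lk e j z : R := kre e j z - kr j z.

Lemma smooth_lk e j : smooth (lk e j).
Proof. by apply: smoothB; [exact: smooth_kre|exact: smooth_kr]. Qed.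

Lemma csupp_lk e j : 0 < e <= 1 -> csupp 1 (lk e j).
Proof.
move=> /andP[e0 e1] z z1; rewrite /lk kre_out// ?kr_out ?subrr// ltW//.
exact: le_lt_trans z1.
Qed.

Definition dlk e i j z : R := dkre e i j z - pd i (kr j) z.

Lemma pd_lk e i j : pd i (lk e j) = dlk e i j.
Proof.
apply/funext => z; rewrite /lk pdB; [|exact: smooth_kre|exact: smooth_kr].
by rewrite pd_kre.
Qed.

Lemma smooth_dlk e i j : smooth (dlk e i j).
Proof. by rewrite -pd_lk; apply: smooth_pd; exact: smooth_lk. Qed.

Lemma csupp_dlk e i j : 0 < e <= 1 -> csupp 1 (dlk e i j).
Proof. by move=> e01; rewrite -pd_lk; apply: csupp_pd; exact: csupp_lk. Qed.

(** The integral of a derivative: all scales of the differentiated kernel have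
    zero mean. *)
Lemma int_dlk e i j : 0 < e <= 1 -> \int[@leb2 R]_z dlk e i j z = 0.
Proof.
move=> e01; rewrite -pd_lk; apply: (@int_pd_eq0 _ _ _ 1).
- exact: smooth_continuous (smooth_lk e j).
- by move=> x; apply: smooth_derivable; exact: smooth_lk.
- by apply: smooth_continuous; apply: smooth_pd; exact: smooth_lk.
- exact: csupp_lk.
Qed.

Lemma div_lk e z : dlk e false false z + dlk e true true z = 0.
Proof.
rewrite /dlk addrACA -opprD div_kre; have := @div_kr R z => ->.
by rewrite subr0.
Qed.

Lemma curl_lk e z : dlk e false true z - dlk e true false z = etae e z - eta z.
Proof.
have gen (a b c d : R) : a - b - (c - d) = a - c - (b - d) by ring.
by rewrite etaeE /dlk /eta; exact: gen.
Qed.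

End ScaledKernel.

(** * Commutators with a kernel of degree -2 *)

Section HolderPointwise.
Variable R : realType.
Implicit Types (f F : plane R -> R) (x y z : plane R).

(** One constant bounds the function and its modulus of continuity, so that
    estimates compose without tracking two constants. *)
Definition holderM (a M : R) f := (forall x, `|f x| <= M) /\
  (forall x y, `|f x - f y| <= M * enorm (x - y) `^ a).

Lemma holderM_ge0 a M f : holderM a M f -> 0 <= M.
Proof. by move=> [fM _]; exact: le_trans (normr_ge0 _) (fM 0). Qed.

Lemma holderMW a M M' f : M <= M' -> holderM a M f -> holderM a M' f.
Proof.
move=> MM' [h1 h2]; split=> [x|x y]; first exact: le_trans (h1 x) MM'.
by apply: le_trans (h2 x y) _; rewrite ler_wpM2r// powR_ge0.
Qed.

(** Moduli of continuity need only be estimated for close points. *)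
Lemma holderM_local a M f : 0 < a -> (forall x, `|f x| <= M) ->
  (forall x y, 0 < enorm (x - y) <= 1 -> `|f x - f y| <= M * enorm (x - y) `^ a) ->
  holderM a (2 * M) f.
Proof.
move=> a0 fM fH; have M0 : 0 <= M by exact: le_trans (normr_ge0 _) (fM 0).
split=> [x|x y]; first by apply: le_trans (fM x) _; rewrite mulr2n mulrDl mul1r lerDl.
have [e0|e0] := eqVneq (enorm (x - y)) 0.
  have /eqP := enorm_eq0 e0; rewrite subr_eq0 => /eqP ->.
  by rewrite subrr normr0 mulr_ge0 ?powR_ge0// mulr_ge0.
have [e1|e1] := leP (enorm (x - y)) 1.
  apply: le_trans (fH _ _ _) _; first by rewrite e1 lt_neqAle eq_sym e0 enorm_ge0.
  by rewrite -mulrA mulr2n mulrDl mul1r lerDl mulr_ge0 ?powR_ge0.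
apply: (@le_trans _ _ (2 * M)).
  by apply: le_trans (ler_normB _ _) _; rewrite mulr2n mulrDl mul1r lerD.
rewrite ler_peMr ?mulr_ge0// -(powRr0 (enorm (x - y))).
by apply: ler_powR; exact: ltW.
Qed.

Lemma holder_continuous a M f : 0 < a ->
  (forall x y, `|f x - f y| <= M * enorm (x - y) `^ a) -> continuous f.
Proof.
move=> a0 fH x.
have M1 : 0 < `|M| + 1 by rewrite ltr_wpDl.
have c0 : continuous (fun y => enorm (x - y)).
  have := @continuous_aff R (@enorm R) x (-1) (@continuous_enorm R).
  by rewrite (_ : (fun z => _) = (fun y => enorm (x - y)))//; apply/funext => y; rewrite scaleN1r.
apply/cvgrPdist_lt => e e0.
pose d := (e / (`|M| + 1)) `^ a^-1.
have d0 : 0 < d by rewrite powR_gt0// divr_gt0.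
have ct : {for x, continuous (fun y => enorm (x - y))} by exact: c0.
have near_d := (cvgrPdist_lt _ _).1 ct _ d0; rewrite subrr enorm0 in near_d.
near=> y; have yd : enorm (x - y) < d.
  have : `|0 - enorm (x - y)| < d by near: y; exact: near_d.
  by rewrite sub0r normrN ger0_norm ?enorm_ge0.
apply: le_lt_trans (fH x y) _.
apply: (@le_lt_trans _ _ ((`|M| + 1) * enorm (x - y) `^ a)).
  by rewrite ler_wpM2r ?powR_ge0// (le_trans (ler_norm M))// lerDl.
rewrite -ltr_pdivlMl// mulrC.
have -> : e / (`|M| + 1) = d `^ a.
  by rewrite -powRrM mulVf ?gt_eqF// powRr1// ltW// divr_gt0.
by apply: gt0_ltr_powR => //; rewrite nnegrE ?enorm_ge0 ?ltW.
Unshelve. all: by end_near. Qed.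

Lemma holderM_continuous a M f : 0 < a -> holderM a M f -> continuous f.
Proof. by move=> a0 [_]; exact: holder_continuous. Qed.

Lemma holderM_measurable a M f : 0 < a -> holderM a M f -> measurable_fun setT f.
Proof. by move=> a0 /(holderM_continuous a0); exact: continuous_measurable_plane. Qed.

Lemma measurable_reflect x f : measurable_fun setT f -> measurable_fun setT (fun y => f (x - y)).
Proof.
move=> mf; have := measurableT_comp mf (measurable_affine x (-1)).
by apply: eq_measurable_fun => y _ /=; rewrite scaleN1r.
Qed.

Lemma conv_le (G w : plane R -> R) x (c : R) : measurable_fun setT G -> integ w ->
  (forall y, `|G y| <= c * w (x - y)) ->
  integ G /\ `|\int[leb2 R]_y G y| <= c * \int[leb2 R]_z w z.
Proof.
move=> mG iw Gw; have iw' := integZ c (integ_reflect x iw).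
split; first exact: integ_le iw'.
apply: le_trans (norm_int_le mG Gw iw') _.
by rewrite intZ ?int_reflect//; exact: integ_reflect.
Qed.

End HolderPointwise.

Section Commutator.
Variable R : realType.
Notation leb2 := (@leb2 R).
Implicit Types (x y z : plane R) (e h : R).
(** [k] stands for a derivative of the regularized Biot-Savart kernel, of which
    only these decay and homogeneity properties matter. *)
Variables (k : plane R -> R) (C a : R).
Hypothesis (a0 : 0 < a) (a1 : a < 1) (C0 : 0 < C).
Hypothesis ck : continuous k.
Hypothesis kb : forall z, `|k z| * (1 + enorm z) ^+ 2 <= C.
Hypothesis kl : forall z y, enorm (z - y) <= 1 ->
  `|k z - k y| * (1 + enorm z) ^+ 3 <= C * enorm (z - y).
Hypothesis kh : hom_out 2 k.

Definition scaled e z : R := e^-1 ^+ 2 * k (e^-1 *: z).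
Definition cut e z : R := scaled e z - k z.

Lemma continuous_scaled e : continuous (scaled e).
Proof.
have -> : scaled e = (fun z => e^-1 ^+ 2 * k (0 + e^-1 *: z)).
  by apply/funext => z; rewrite add0r.
by move=> z; apply: cvgM; [exact: cvg_cst|exact: (continuous_aff ck)].
Qed.

Lemma continuous_cut e : continuous (cut e).
Proof. by move=> z; apply: cvgB; [exact: continuous_scaled|exact: ck]. Qed.

Lemma scaled1 : scaled 1 = k.
Proof. by apply/funext => z; rewrite /scaled invr1 expr1n mul1r scale1r. Qed.

Lemma scaled_bound e z : 0 < e -> z != 0 -> `|scaled e z| <= C * enorm z `^ (- 2).
Proof.
move=> e0 z0; have ez := enorm_gt0 z0.
have n0 : 0 <= enorm (e^-1 *: z) by exact: enorm_ge0.
rewrite powRN -[2]/(2%:R) powR_mulrn ?enorm_ge0// ler_pdivlMr ?exprn_gt0//.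
apply: le_trans (kb (e^-1 *: z)).
rewrite /scaled normrM mulrAC mulrC (ger0_norm (sqr_ge0 e^-1)) -exprMn.
apply: ler_wpM2l => //; apply: lerXn2r.
- by rewrite nnegrE mulr_ge0 ?enorm_ge0// invr_ge0 ltW.
- by rewrite nnegrE addr_ge0.
by rewrite enormZ gtr0_norm ?invr_gt0// ltW// ltr_pwDl.
Qed.

Lemma scaled_out e h z : 0 < e -> e <= h -> h <= 1 -> h < enorm z -> scaled e z = scaled h z.
Proof.
move=> e0 eh h1 hz; have h0 := lt_le_trans e0 eh.
have := @kh (e / h) (h^-1 *: z); rewrite divr_gt0// ler_pdivrMr// mul1r eh.
rewrite enormZ gtr0_norm ?invr_gt0// mulrC ltr_pdivlMr// mul1r => /(_ isT hz) E.
rewrite /scaled -E invf_div scalerA.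
rewrite (_ : h / e * h^-1 = e^-1); last by rewrite mulrAC mulfV ?mul1r// gt_eqF.
by rewrite mulrA -exprMn (_ : h^-1 * (h / e) = e^-1)// mulrA mulVf ?mul1r// gt_eqF.
Qed.

Lemma cut_out e z : 0 < e <= 1 -> 1 < enorm z -> cut e z = 0.
Proof. by move=> /andP[e0 e1] z1; rewrite /cut (scaled_out e0 e1)// scaled1 subrr. Qed.

Lemma powR_wsing z : enorm z `^ a * enorm z `^ (- 2) <= enorm z `^ (- (2 - a)).
Proof.
have [->|z0] := eqVneq z 0; first by rewrite enorm0 powR0 ?gt_eqF// mul0r powR_ge0.
have ez : enorm z != 0 by rewrite gt_eqF// enorm_gt0.
rewrite -powRD; last by rewrite ez implybT.
by rewrite (_ : a + - 2 = - (2 - a))//; ring.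
Qed.

(** The scales between [e] and [h] contribute a singular weight cut at [h]. *)
Lemma scaled_diff e h z : 0 < e -> e <= h -> h <= 1 ->
  enorm z `^ a * `|scaled e z - scaled h z| <= 2 * C * h `^ (a - 2) * wsing (2 - a) (h^-1 *: z).
Proof.
move=> e0 eh h1; have h0 := lt_le_trans e0 eh.
have [->|z0] := eqVneq z 0.
  rewrite enorm0 powR0 ?gt_eqF// mul0r mulr_ge0 ?wsing_ge0//.
  by rewrite !mulr_ge0 ?powR_ge0// ltW.
have ez := enorm_gt0 z0; have [hz|zh] := ltP h (enorm z).
  by rewrite (scaled_out e0 eh)// subrr normr0 mulr0 !mulr_ge0 ?powR_ge0 ?wsing_ge0// ltW.
have -> : 2 * C * h `^ (a - 2) * wsing (2 - a) (h^-1 *: z) = 2 * C * enorm z `^ (- (2 - a)).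
  rewrite wsingE; last first.
    by rewrite enormZ gtr0_norm ?invr_gt0// mulrC ler_pdivrMr// mul1r.
  rewrite enormZ gtr0_norm ?invr_gt0// powRM ?invr_ge0 ?ltW// -mulrA; congr (_ * _).
  rewrite -powR_inv1 ?ltW// -powRrM mulrA -powRD; last by rewrite (gt_eqF h0) implybT.
  by rewrite (_ : a - 2 + -1 * - (2 - a) = 0) ?powRr0 ?mul1r//; ring.
have c2 : 0 <= 2 * C by rewrite mulr_ge0// ltW.
apply: (@le_trans _ _ (2 * C * (enorm z `^ a * enorm z `^ (- 2)))); last first.
  by rewrite ler_wpM2l// powR_wsing.
rewrite mulrCA ler_wpM2l ?powR_ge0//; apply: le_trans (ler_normB _ _) _.
by have := scaled_bound e0 z0; have := scaled_bound h0 z0; lra.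
Qed.

Lemma cut_weight e z : 0 < e <= 1 ->
  enorm z `^ a * `|cut e z| <= 2 * C * wsing (2 - a) z.
Proof.
move=> /andP[e0 e1]; have := scaled_diff z e0 e1 (lexx 1).
by rewrite scaled1 powR1 mulr1 invr1 scale1r.
Qed.

(** At scale [e], a displacement at most [e] gains the factor [enorm (z - y) / e]
    and one power of decay, which makes the weight integrable at infinity. *)
Lemma scaled_lip e z y : 0 < e -> enorm (z - y) <= e ->
  enorm z `^ a * `|scaled e z - scaled e y| <=
  C * enorm (z - y) * e `^ (a - 3) * wtail (3 - a) (e^-1 *: z).
Proof.
move=> e0 zye; have ei : 0 < e^-1 by rewrite invr_gt0.
have zy : enorm (e^-1 *: z - e^-1 *: y) = e^-1 * enorm (z - y).
  by rewrite -scalerBr enormZ gtr0_norm.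
have := @kl (e^-1 *: z) (e^-1 *: y); rewrite zy mulrC ler_pdivrMr// mul1r => /(_ zye).
have t0 : 0 < 1 + enorm (e^-1 *: z) by rewrite ltr_pwDl// enorm_ge0.
rewrite -ler_pdivlMr ?exprn_gt0// => H.
rewrite /scaled -mulrBr normrM (ger0_norm (sqr_ge0 _)).
apply: le_trans (ler_wpM2l (powR_ge0 _ _) (ler_wpM2l (sqr_ge0 _) H)) _.
have -> : enorm z = e * enorm (e^-1 *: z) by rewrite enormZ gtr0_norm// mulrA mulfV ?mul1r ?gt_eqF.
have n0 : 0 <= enorm (e^-1 *: z) by exact: enorm_ge0.
rewrite /wtail; move: (enorm (e^-1 *: z)) n0 t0 {H zy} => t n0 t0.
rewrite powRM ?(ltW e0)//.
have ta : t `^ a <= (1 + t) `^ a.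
  by apply: ge0_ler_powR; rewrite ?nnegrE ?(ltW a0) ?(ltW t0) ?lerDr.
have -> : C * enorm (z - y) * e `^ (a - 3) * (1 + t) `^ (- (3 - a)) =
    e `^ a * (1 + t) `^ a * (e^-1 ^+ 2 * (C * (enorm (z - y) / e) / (1 + t) ^+ 3)).
  have -> : - (3 - a) = a - 3 by ring.
  have P3 (s : R) : 0 < s -> s `^ (a - 3) = s `^ a / s ^+ 3.
    move=> s0; rewrite powRB ?(gt_eqF s0) ?implybT//.
    by rewrite -(powR_mulrn 3 (ltW s0)).
  rewrite !P3//; move: (_ `^ _) (_ `^ _) (enorm _) => A B D.
  by field; rewrite !gt_eqF.
apply: ler_wpM2r; last by rewrite ler_wpM2l ?powR_ge0.
rewrite mulr_ge0 ?sqr_ge0// divr_ge0 ?exprn_ge0 ?(ltW t0)// mulr_ge0 ?(ltW C0)//.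
by rewrite divr_ge0 ?enorm_ge0// ltW.
Qed.

Lemma wsing_scaled_int h : 0 < h ->
  h `^ (a - 2) * \int[leb2]_z wsing (2 - a) (h^-1 *: z) = h `^ a * \int[leb2]_z wsing (2 - a) z.
Proof.
move=> h0; have hi : h^-1 != 0 by rewrite gt_eqF ?invr_gt0.
have iw : integ (@wsing R (2 - a)).
  by apply: integ_wsing; rewrite subr_gt0 gtrBl a0 (lt_trans a1)// ltr1n.
have -> : \int[leb2]_z wsing (2 - a) (h^-1 *: z) = h ^+ 2 * \int[leb2]_z wsing (2 - a) z.
  have := int_affine 0 hi iw; rewrite gtr0_norm ?invr_gt0// invrK => <-.
  by apply: int_ext => z; rewrite add0r.
rewrite mulrA; congr (_ * _); rewrite -(powR_mulrn 2 (ltW h0)) -powRD ?subrK//.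
by rewrite (gt_eqF h0) implybT.
Qed.

Lemma wtail_scaled_int h : 0 < h ->
  h `^ (a - 3) * \int[leb2]_z wtail (3 - a) (h^-1 *: z) = h `^ (a - 1) * \int[leb2]_z wtail (3 - a) z.
Proof.
move=> h0; have hi : h^-1 != 0 by rewrite gt_eqF ?invr_gt0.
have iw : integ (@wtail R (3 - a)) by apply: integ_wtail; move: a1; lra.
have -> : \int[leb2]_z wtail (3 - a) (h^-1 *: z) = h ^+ 2 * \int[leb2]_z wtail (3 - a) z.
  have := int_affine 0 hi iw; rewrite gtr0_norm ?invr_gt0// invrK => <-.
  by apply: int_ext => z; rewrite add0r.
rewrite mulrA; congr (_ * _); rewrite -(powR_mulrn 2 (ltW h0)) -powRD.
  by congr (_ `^ _); ring.
by rewrite (gt_eqF h0) implybT.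
Qed.

Lemma integ_wsing_a : integ (@wsing R (2 - a)).
Proof. by apply: integ_wsing; rewrite subr_gt0 gtrBl a0 (lt_trans a1)// ltr1n. Qed.

Lemma integ_wtail_a : integ (@wtail R (3 - a)).
Proof. by apply: integ_wtail; move: a1; lra. Qed.

Lemma integ_dilate (f : plane R -> R) h : 0 < h -> integ f -> integ (fun z => f (h^-1 *: z)).
Proof.
move=> h0 hf; have hi : h^-1 != 0 by rewrite gt_eqF ?invr_gt0.
by have := integ_affine 0 hi hf; apply: eq_integ => z; rewrite add0r.
Qed.

Variables (F rho : plane R -> R) (M N : R).
Hypothesis FH : forall x y, `|F x - F y| <= M * enorm (x - y) `^ a.
Hypotheses (M0 : 0 <= M) (mrho : measurable_fun setT rho) (rhoN : forall y, `|rho y| <= N).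

(** The commutator of the multiplication by [F] with the convolution by the
    truncated kernel: the increment of [F] absorbs the singularity of order -2. *)
Definition comm e x : R := \int[leb2]_y ((F x - F y) * (cut e (x - y) * rho y)).

Let W1 := \int[leb2]_z wsing (2 - a) z.
Let W2 := \int[leb2]_z wtail (3 - a) z.

Let N0 : 0 <= N. Proof. exact: le_trans (normr_ge0 _) (rhoN 0). Qed.
Let W10 : 0 <= W1. Proof. by apply: int_ge0 => z; exact: wsing_ge0. Qed.
Let W20 : 0 <= W2. Proof. by apply: int_ge0 => z; exact: wtail_ge0. Qed.

Let mF : measurable_fun setT F.
Proof. by apply: continuous_measurable_plane; exact: holder_continuous a0 FH. Qed.

Let mscaled e : measurable_fun setT (scaled e).
Proof. by apply: continuous_measurable_plane; exact: continuous_scaled. Qed.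

Let mcut e : measurable_fun setT (cut e).
Proof. by apply: continuous_measurable_plane; exact: continuous_cut. Qed.

(** The Hoelder increment of [F] turns a bound on a kernel, multiplied by the
    power [a] of the distance, into a bound on the commutator. *)
Let comm_le (g : plane R -> R) (w : plane R -> R) x (c : R) :
  measurable_fun setT g -> integ w ->
  (forall y, enorm (x - y) `^ a * `|g y| <= c * w (x - y)) ->
  integ (fun y => (F x - F y) * (g y * rho y)) /\
  `|\int[leb2]_y ((F x - F y) * (g y * rho y))| <= M * N * c * \int[leb2]_z w z.
Proof.
move=> mg iw gw; apply: (conv_le (x := x)) => //.
  apply: measurable_funM; last exact: measurable_funM.
  by apply: measurable_funB.
move=> y; rewrite !normrM.
apply: (@le_trans _ _ ((M * enorm (x - y) `^ a) * (`|g y| * N))).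
  by apply: ler_pM => //; exact: ler_wpM2l.
rewrite [leLHS](_ : _ = M * N * (enorm (x - y) `^ a * `|g y|)); last by ring.
by rewrite -[leRHS]mulrA ler_wpM2l ?mulr_ge0.
Qed.

Lemma integ_comm e x : 0 < e <= 1 ->
  integ (fun y => (F x - F y) * (cut e (x - y) * rho y)).
Proof.
move=> e01; apply: (proj1 (comm_le (w := @wsing R (2 - a)) (c := 2 * C) _ _ _)).
- exact: measurable_reflect.
- exact: integ_wsing_a.
- by move=> y; exact: cut_weight.
Qed.

Lemma comm_bound e x : 0 < e <= 1 -> `|comm e x| <= M * N * (2 * C) * W1.
Proof.
move=> e01; apply: (proj2 (comm_le (w := @wsing R (2 - a)) (c := 2 * C) _ _ _)).
- exact: measurable_reflect.
- exact: integ_wsing_a.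
- by move=> y; exact: cut_weight.
Qed.

(** Only distances at most [h] contribute, and there the integrand is of size
    [enorm (x - y) `^ (a - 2)]. *)
Lemma comm_cauchy e h x : 0 < e -> e <= h -> h <= 1 ->
  `|comm e x - comm h x| <= M * N * (2 * C) * W1 * h `^ a.
Proof.
move=> e0 eh h1; have h0 := lt_le_trans e0 eh.
have e01 : 0 < e <= 1 by rewrite e0 (le_trans eh).
have h01 : 0 < h <= 1 by rewrite h0.
rewrite /comm -intB; [|exact: integ_comm|exact: integ_comm].
have -> : \int[leb2]_y ((F x - F y) * (cut e (x - y) * rho y) -
      (F x - F y) * (cut h (x - y) * rho y)) =
    \int[leb2]_y ((F x - F y) * ((scaled e (x - y) - scaled h (x - y)) * rho y)).
  by apply: int_ext => y; rewrite /cut; ring.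
have [|||_] := @comm_le (fun y => scaled e (x - y) - scaled h (x - y))
  (fun z => wsing (2 - a) (h^-1 *: z)) x (2 * C * h `^ (a - 2)).
- by apply: measurable_funB; apply: measurable_reflect.
- exact/integ_dilate/integ_wsing_a.
- by move=> y; exact: scaled_diff.
move=> /le_trans; apply.
have -> : M * N * (2 * C * h `^ (a - 2)) * \int[leb2]_z wsing (2 - a) (h^-1 *: z) =
    M * N * (2 * C) * (h `^ (a - 2) * \int[leb2]_z wsing (2 - a) (h^-1 *: z)) by ring.
by rewrite wsing_scaled_int// -/W1 [leRHS]mulrAC mulrA.
Qed.

(** The increment is that of the kernel at fixed increments of [F], plus that of
    [F] against the truncated kernel, which is bounded by [P]. *)
Lemma comm_lip (P : R) e x x' : 0 < e <= 1 -> 0 < enorm (x - x') -> enorm (x - x') <= e ->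
  `|\int[leb2]_y (cut e (x' - y) * rho y)| <= P ->
  `|comm e x - comm e x'| <= M * (N * (2 * C) * W2 + P) * enorm (x - x') `^ a.
Proof.
move=> /andP[e0 e1] d0 de cP; have e01 : 0 < e <= 1 by rewrite e0.
set d := enorm (x - x') in d0 de *.
pose g y := scaled e (x - y) - scaled e (x' - y).
pose g1 y := k (x' - y) - k (x - y).
have zz y : (x - y) - (x' - y) = x - x' by rewrite opprB addrA subrK.
have mk : measurable_fun setT k by exact: continuous_measurable_plane.
have [|||ig Ig] := @comm_le g (fun z => wtail (3 - a) (e^-1 *: z)) x (C * d * e `^ (a - 3)).
- by apply: measurable_funB; apply: measurable_reflect.
- exact/integ_dilate/integ_wtail_a.
- by move=> y; have := @scaled_lip e (x - y) (x' - y) e0; rewrite zz; exact.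
have [|||ig1 Ig1] := @comm_le g1 (wtail (3 - a)) x (C * d).
- by apply: measurable_funB; apply: measurable_reflect.
- exact: integ_wtail_a.
- move=> y; have := @scaled_lip 1 (x - y) (x' - y) ltr01.
  rewrite zz scaled1 powR1 mulr1 invr1 scale1r /g1 distrC; apply.
  exact: le_trans e1.
have icut : integ (fun y => cut e (x' - y) * rho y).
  have ic : integ (cut e).
    by apply: (@integ_csupp _ _ 1); [exact: continuous_cut|move=> z; exact: cut_out].
  have := integM_bdd mrho rhoN (integ_reflect x' ic).
  by apply: eq_integ => y; rewrite mulrC.
have -> : comm e x - comm e x' =
    \int[leb2]_y ((F x - F y) * (g y * rho y)) + \int[leb2]_y ((F x - F y) * (g1 y * rho y))
    + (F x - F x') * \int[leb2]_y (cut e (x' - y) * rho y).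
  rewrite -(intZ _ icut) -(intD ig ig1) -intD; [|exact: integD|exact: integZ].
  rewrite /comm -intB; [|exact: integ_comm|exact: integ_comm].
  by apply: int_ext => y; rewrite /g /g1 /cut; ring.
have P0 : 0 <= P by exact: le_trans cP.
have dP : `|(F x - F x') * \int[leb2]_y (cut e (x' - y) * rho y)| <= M * d `^ a * P.
  by rewrite normrM; apply: ler_pM => //; exact: FH.
have dn : d != 0 by rewrite gt_eqF.
have d_le : d <= d `^ a.
  by apply: ger1_powR; [rewrite d0 (le_trans de)|exact: ltW].
have de_le : d * e `^ (a - 1) <= d `^ a.
  have -> : d `^ a = d * d `^ (a - 1) by rewrite mulr_powRB1// ltW.
  apply: ler_wpM2l; first exact: ltW.
  by rewrite -[a - 1]opprB; apply: ler_npowR => //; rewrite subr_ge0 ltW.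
have Ig' : `|\int[leb2]_y ((F x - F y) * (g y * rho y))| <= M * N * C * d `^ a * W2.
  apply: le_trans Ig _.
  have -> : M * N * (C * d * e `^ (a - 3)) * \int[leb2]_z wtail (3 - a) (e^-1 *: z) =
      M * N * C * (d * (e `^ (a - 3) * \int[leb2]_z wtail (3 - a) (e^-1 *: z))) by ring.
  rewrite wtail_scaled_int// -/W2.
  rewrite [leLHS](_ : _ = M * N * C * (d * e `^ (a - 1)) * W2); last by ring.
  by apply: ler_wpM2r => //; apply: ler_wpM2l => //; rewrite !mulr_ge0// ltW.
have Ig1' : `|\int[leb2]_y ((F x - F y) * (g1 y * rho y))| <= M * N * C * d `^ a * W2.
  apply: le_trans Ig1 _; apply: ler_wpM2r; first exact: W20.
  by rewrite mulrA; apply: ler_wpM2l => //; rewrite !mulr_ge0// ltW.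
apply: le_trans (ler_normD _ _) _; apply: le_trans (lerD (ler_normD _ _) dP) _.
apply: le_trans (lerD (lerD Ig' Ig1') (lexx _)) _.
by rewrite le_eqVlt; apply/orP; left; apply/eqP; ring.
Qed.

(** The scales below the distance of the two points are discarded by
    [comm_cauchy]; the others are handled by [comm_lip]. Without the bound [P]
    a logarithm of the distance would be lost. *)
Lemma comm_holder (P : R) e x x' : 0 < e <= 1 -> 0 < enorm (x - x') <= 1 ->
  (forall h z, 0 < h <= 1 -> `|\int[leb2]_y (cut h (z - y) * rho y)| <= P) ->
  `|comm e x - comm e x'| <=
    M * (N * (2 * C) * (2 * W1 + W2) + P) * enorm (x - x') `^ a.
Proof.
move=> /andP[e0 e1] /andP[d0 d1] cP; set d := enorm (x - x') in d0 d1 *.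
have d01 : 0 < d <= 1 by rewrite d0.
have [de|ed] := leP d e.
  have e01 : 0 < e <= 1 by rewrite e0.
  apply: le_trans (comm_lip e01 d0 de (cP e x' e01)) _.
  apply: ler_wpM2r; first exact: powR_ge0.
  apply: ler_wpM2l => //; rewrite lerD2r; apply: ler_wpM2l.
    by rewrite !mulr_ge0// ltW.
  by rewrite lerDr mulr_ge0.
have h1 := comm_cauchy x e0 (ltW ed) d1; have h2 := comm_cauchy x' e0 (ltW ed) d1.
have h3 := comm_lip d01 d0 (lexx _) (cP d x' d01).
have -> : comm e x - comm e x' =
  (comm e x - comm d x) + (comm d x - comm d x') + (comm d x' - comm e x') by ring.
apply: le_trans (ler_normD _ _) _; rewrite (distrC (comm d x')).
apply: le_trans (lerD (ler_normD _ _) h2) _.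
apply: le_trans (lerD (lerD h1 h3) (lexx _)) _.
by rewrite le_eqVlt; apply/orP; left; apply/eqP; rewrite -/d; ring.
Qed.

End Commutator.

(** * Test functions and convolutions *)

Section TestCalculus.
Variable R : realType.
Notation leb2 := (@leb2 R).
Implicit Types (f g phi : plane R -> R) (x y z : plane R) (b i j l : bool).

Lemma csuppM r f g : csupp r g -> csupp r (fun x => f x * g x).
Proof. by move=> sg z rz; rewrite sg// mulr0. Qed.

Lemma int_pdM b f g r : smooth f -> smooth g -> csupp r g ->
  \int[leb2]_x (f x * pd b g x) = - \int[leb2]_x (pd b f x * g x).
Proof.
move=> sf sg rg.
have sd h : smooth h -> smooth (pd b h) by move=> sh; exact: smooth_pd.
have i1 : integ (fun x => f x * pd b g x).
  apply: (@integ_csupp _ _ r).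
    by apply: smooth_continuous; apply: smoothM => //; exact: sd.
  by apply: csuppM; exact: csupp_pd.
have i2 : integ (fun x => pd b f x * g x).
  apply: (@integ_csupp _ _ r).
    by apply: smooth_continuous; apply: smoothM => //; exact: sd.
  exact: csuppM.
apply/eqP; rewrite -addr_eq0 -intD//; apply/eqP.
have sfg : smooth (fun x => f x * g x) by exact: smoothM.
rewrite -[RHS](@int_pd_eq0 R b (fun x => f x * g x) r).
- apply: int_ext => x; rewrite pdM; [|exact: smooth_derivable|exact: smooth_derivable].
  by rewrite [g x * _]mulrC.
- exact: smooth_continuous.
- by move=> x; apply: smooth_derivable.
- by apply: smooth_continuous; exact: sd.
- exact: csuppM.
Qed.

Lemma reflE x f : (fun y => f (x - y)) = (fun y => f (x + (-1) *: y)).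
Proof. by apply/funext => y; rewrite scaleN1r. Qed.

Lemma smooth_refl x f : smooth f -> smooth (fun y => f (x - y)).
Proof. by move=> sf; rewrite reflE; exact: smooth_affine. Qed.

Lemma pd_refl b x f y : smooth f -> pd b (fun y => f (x - y)) y = - pd b f (x - y).
Proof.
move=> sf; rewrite reflE pd_affine; last by apply: smooth_derivable.
by rewrite scaleN1r mulN1r.
Qed.

Lemma csupp_refl r x f : csupp r f -> csupp (r + enorm x) (fun y => f (x - y)).
Proof.
move=> rf z rz; apply: rf; have := ler_enorm_dist z x.
by rewrite -enorm_distC; lra.
Qed.

Lemma transE y f : (fun x => f (x - y)) = (fun x => f (- y + 1 *: x)).
Proof. by apply/funext => x; rewrite scale1r addrC. Qed.

Lemma smooth_trans y f : smooth f -> smooth (fun x => f (x - y)).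
Proof. by move=> sf; rewrite transE; exact: smooth_affine. Qed.

Lemma pd_trans b y f x : smooth f -> pd b (fun x => f (x - y)) x = pd b f (x - y).
Proof.
move=> sf; rewrite transE pd_affine; last by apply: smooth_derivable.
by rewrite mul1r scale1r addrC.
Qed.

Lemma int_conv_pd b f phi r y : smooth f -> smooth phi -> csupp r phi ->
  \int[leb2]_x (f (x - y) * pd b phi x) = - \int[leb2]_x (pd b f (x - y) * phi x).
Proof.
move=> sf sphi rphi; rewrite (int_pdM (r := r) b (smooth_trans y sf) sphi rphi).
apply: (congr1 (fun t : R => - t)); apply: int_ext => x.
by apply: (congr1 (fun t : R => t * phi x)); exact: pd_trans.
Qed.

Lemma csupp_lip f r : smooth f -> csupp r f ->
  exists2 D, 0 < D & forall z y, `|f z - f y| <= D * enorm (z - y).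
Proof.
move=> sf rf.
have [C C0 fC] : exists2 C, 0 < C & forall b z, `|pd b f z| <= C.
  apply: bool_bound => [b C C' CC' TC z|b]; first exact: le_trans (TC z) CC'.
  apply: (@csupp_bounded _ _ r); last exact: csupp_pd.
  by apply: smooth_continuous; exact: smooth_pd.
have [M M0 fM] := csupp_bounded (smooth_continuous sf) rf.
exists (2 * 3 ^+ 0 * C + 2 * M) => [|z y].
  by rewrite addr_gt0// !mulr_gt0.
have [zy|zy] := leP (enorm (z - y)) 1.
  have := @lip_decay R 0 f C (ltW C0) (fun b y => smooth_derivable b y sf) _ z y zy.
  rewrite expr0 mulr1 => h; apply: le_trans (h _) _.
    by move=> b u; rewrite expr0 mulr1; exact: fC.
  by rewrite ler_wpM2r ?enorm_ge0// lerDl mulr_ge0// ltW.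
apply: (@le_trans _ _ (2 * M)).
  by apply: le_trans (ler_normB _ _) _; rewrite mulr2n mulrDl mul1r lerD.
apply: (@le_trans _ _ ((2 * 3 ^+ 0 * C + 2 * M) * 1)).
  by rewrite mulr1 lerDr !mulr_ge0// ltW.
by rewrite ler_wpM2l ?ltW// addr_gt0// !mulr_gt0.
Qed.

Lemma eq_of_small (A B D : R) : (forall e, 0 < e <= 1 -> `|A - B| <= D * e) -> A = B.
Proof.
move=> h; apply/eqP; rewrite -subr_eq0 -normr_le0.
have D0 : 0 <= D.
  by have := h 1; rewrite ltr01 lexx mulr1 => /(_ isT); exact: le_trans.
apply/ler_addgt0Pr => e e0; rewrite add0r.
pose d := Num.min 1 (e / (D + 1)).
have d0 : 0 < d by rewrite lt_min ltr01 divr_gt0// ltr_wpDl.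
apply: le_trans (h d _) _; first by rewrite d0 ge_min lexx.
apply: (@le_trans _ _ ((D + 1) * (e / (D + 1)))).
  by apply: ler_pM; rewrite ?lerDl ?(ltW d0)// ge_min lexx orbT.
by rewrite mulrC mulfVK// gt_eqF// ltr_wpDl.
Qed.

Definition cv f (rho : plane R -> R) x : R := \int[leb2]_y (f (x - y) * rho y).

Lemma measurable_convolution f : measurable_fun setT f ->
  measurable_fun setT (fun p : plane R * plane R => f (p.1 - p.2)).
Proof.
move=> mf; apply: (measurableT_comp mf).
apply: measurable_fun_pair => /=.
  apply: measurable_funB.
    exact: (measurableT_comp (@measurable_fst _ _ _ _) (@measurable_fst _ _ _ _)).
  exact: (measurableT_comp (@measurable_fst _ _ _ _) (@measurable_snd _ _ _ _)).
apply: measurable_funB.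
  exact: (measurableT_comp (@measurable_snd _ _ _ _) (@measurable_fst _ _ _ _)).
exact: (measurableT_comp (@measurable_snd _ _ _ _) (@measurable_snd _ _ _ _)).
Qed.

(** Fubini's theorem moves a convolution onto the test function. *)
Lemma int_cv f rho phi (C : R) : measurable_fun setT f -> (forall z, `|f z| <= C) ->
  integ rho -> integ phi ->
  [/\ integ (fun x => cv f rho x * phi x),
    integ (fun y => rho y * \int[leb2]_x (f (x - y) * phi x)) &
    \int[leb2]_x (cv f rho x * phi x) =
      \int[leb2]_y (rho y * \int[leb2]_x (f (x - y) * phi x))].
Proof.
move=> mf fC irho iphi; pose H x y := f (x - y) * rho y * phi x.
have C0 : 0 <= C by exact: le_trans (fC 0).
have mH : measurable_fun setT (fun p : plane R * plane R => H p.1 p.2).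
  apply: measurable_funM; last exact: (measurableT_comp (integ_measurable iphi) measurable_fst).
  apply: measurable_funM; last exact: (measurableT_comp (integ_measurable irho) measurable_snd).
  exact: measurable_convolution.
have Hb x y : `|H x y| <= (C * `|phi x|) * `|rho y|.
  rewrite !normrM [leRHS]mulrAC; apply: ler_wpM2r => //; exact: ler_wpM2r.
have i1 := integZ C (integ_norm iphi); have i2 := integ_norm irho.
have irow x : integ (fun y => f (x - y) * rho y).
  apply: (@integM_bdd _ _ _ C) => //; exact: measurable_reflect.
have icol y : integ (fun x => f (x - y) * phi x).
  apply: (@integM_bdd _ _ _ C) => //.
  rewrite transE; have := measurableT_comp mf (measurable_affine (- y) 1); exact.
have E1 : (fun x => cv f rho x * phi x) = (fun x => \int[leb2]_y H x y).
  apply/funext => x; rewrite mulrC -(intZ _ (irow x)); apply: int_ext => y.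
  by rewrite /H mulrC.
have E2 : (fun y => rho y * \int[leb2]_x (f (x - y) * phi x)) = (fun y => \int[leb2]_x H x y).
  apply/funext => y; rewrite -(intZ _ (icol y)); apply: int_ext => x.
  by rewrite /H mulrCA mulrA.
rewrite E1 E2; split; first exact: (integ_marginal mH Hb i1 i2).
  exact: (integ_marginal2 mH Hb i1 i2).
exact: (fubini_plane mH Hb i1 i2).
Qed.

End TestCalculus.

(** * The velocity field *)

Section KernelDifferences.
Variable R : realType.
Notation leb2 := (@leb2 R).
Implicit Types (x y z : plane R) (b i j l : bool) (e h : R).

Lemma pi2_inv : 0 < (2 * @pi R)^-1 <= 1.
Proof.
have p2 : 1 <= 2 * pi :> R by have := @pi_ge2 R; move: (pi : R) => p; lra.
have p0 : 0 < 2 * pi :> R by exact: lt_le_trans p2.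
by rewrite invr_gt0 p0 invf_le1.
Qed.

Lemma kbs_normE j z : `|kbs j z| = (2 * pi)^-1 * `|co (~~ j) z / enorm z ^+ 2|.
Proof.
have /andP[p0 _] := pi2_inv.
rewrite kbsE normrM gtr0_norm// normrM /sg.
by case: j; rewrite ?normrN normr1 mul1r.
Qed.

Lemma kbs_bound j z : `|kbs j z| <= enorm z `^ (- 1).
Proof.
have /andP[p0 p1] := pi2_inv.
rewrite kbs_normE powR_inv1 ?enorm_ge0//.
have [->|z0] := eqVneq z 0; first by rewrite enorm0 expr0n invr0 mulr0 normr0 mulr0.
have ez := enorm_gt0 z0.
apply: (@le_trans _ _ (1 * (enorm z / enorm z ^+ 2))).
  apply: ler_pM => //; first exact: ltW.
  rewrite normrM normfV (ger0_norm (sqr_ge0 (enorm z))).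
  by rewrite ler_wpM2r ?invr_ge0 ?sqr_ge0// co_le_enorm.
by rewrite mul1r expr2 invfM mulrA mulfV ?mul1r// gt_eqF.
Qed.

Lemma measurable_kbs j : measurable_fun setT (@kbs R j).
Proof.
rewrite (_ : kbs j = fun z => (2 * pi)^-1 * (sg R j * (co (~~ j) z * enorm z `^ (- 2)))).
  do 2 (apply: measurable_funM; first exact: measurable_cst).
  apply: measurable_funM.
    by apply: continuous_measurable_plane; exact: continuous_co.
  exact: (measurableT_comp (@measurable_powR R (- 2)) (@measurable_enorm R)).
apply/funext => z; rewrite kbsE; congr (_ * (_ * (_ * _))).
by rewrite powRN -[2]/(2%:R) powR_mulrn ?enorm_ge0.
Qed.

(** The kernel is the conjugate of the inverse in the complex plane, up to a
    constant factor, and 1/a - 1/b = (b - a) / (a b). *)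
Lemma kbs_diff j z y : z != 0 -> y != 0 ->
  `|kbs j z - kbs j y| <= enorm (z - y) / (enorm z * enorm y).
Proof.
move=> z0 y0; have ez := enorm_gt0 z0; have ey := enorm_gt0 y0.
have /andP[p0 p1] := pi2_inv.
have zn : enorm z != 0 by rewrite gt_eqF. have yn : enorm y != 0 by rewrite gt_eqF.
rewrite !kbsE -mulrBr normrM gtr0_norm// -mulrBr normrM.
have -> : `|sg R j| = 1 by rewrite /sg; case: j; rewrite ?normrN normr1.
rewrite mul1r; apply: (@le_trans _ _ (1 * (enorm (z - y) / (enorm z * enorm y)))); last by rewrite mul1r.
apply: ler_pM => //; first exact: ltW.
pose d c := co c z / enorm z ^+ 2 - co c y / enorm y ^+ 2.
have dd : d false ^+ 2 + d true ^+ 2 = (enorm (z - y) / (enorm z * enorm y)) ^+ 2.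
  rewrite expr_div_n sqr_enorm exprMn.
  have zE := sqr_enorm z; have yE := sqr_enorm y.
  rewrite /d /co /=; move: (enorm z) (enorm y) zn yn zE yE => A B An Bn AE BE.
  apply/eqP; rewrite -subr_eq0; apply/eqP.
  transitivity (((z.1 ^+ 2 + z.2 ^+ 2) / A ^+ 2 - 1) / A ^+ 2
    + ((y.1 ^+ 2 + y.2 ^+ 2) / B ^+ 2 - 1) / B ^+ 2
    - (z.1 ^+ 2 + z.2 ^+ 2 - A ^+ 2) / (A ^+ 2 * B ^+ 2)
    - (y.1 ^+ 2 + y.2 ^+ 2 - B ^+ 2) / (A ^+ 2 * B ^+ 2)).
    by field; rewrite An Bn.
  rewrite -AE -BE !subrr !mul0r mulfV ?expf_neq0// mulfV ?expf_neq0// subrr !mul0r.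
  by rewrite !subr0 addr0.
have n0 : 0 <= enorm (z - y) / (enorm z * enorm y).
  by rewrite divr_ge0 ?enorm_ge0// mulr_ge0 ?enorm_ge0.
rewrite -/(d (~~ j)) -[leLHS]sqrtr_sqr -[leRHS](ger0_norm n0) -sqrtr_sqr -dd ler_sqrt.
  by case: j => /=; rewrite ?lerDl ?lerDr sqr_ge0.
by rewrite addr_ge0 ?sqr_ge0.
Qed.

(** Interpolation between the size of the kernel and its variation. *)
Lemma kbs_holder j z y (b : R) : 0 < b -> b < 1 ->
  `|kbs j z - kbs j y| <=
    2 * enorm (z - y) `^ b * (enorm z `^ (- (1 + b)) + enorm y `^ (- (1 + b))).
Proof.
move=> b0 b1.
have pw u : u != 0 -> enorm u `^ (- 1) = enorm u `^ b * enorm u `^ (- (1 + b)).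
  move=> u0; have eu : enorm u != 0 by rewrite gt_eqF ?enorm_gt0.
  by rewrite -powRD ?eu ?implybT//; congr (_ `^ _); ring.
have kbs0 : kbs j (0 : plane R) = 0.
  by apply/eqP; rewrite -normr_eq0 kbs_normE enorm0 expr0n invr0 mulr0 normr0 mulr0.
have half u : `|kbs j u| <= 2 * enorm u `^ b * enorm u `^ (- (1 + b)).
  apply: le_trans (kbs_bound j u) _; have [->|u0] := eqVneq u 0.
    by rewrite enorm0 (@powR0 R (- 1)) ?oppr_eq0 ?oner_eq0.
  by rewrite pw// -mulrA mulr2n mulrDl mul1r lerDl mulr_ge0 ?powR_ge0.
have [z0|z0] := eqVneq z 0.
  rewrite z0 kbs0 sub0r normrN sub0r enormN; apply: le_trans (half y) _.
  by rewrite ler_wpM2l ?lerDr ?powR_ge0// mulr_ge0 ?powR_ge0.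
have [y0|y0] := eqVneq y 0.
  rewrite y0 kbs0 !subr0; apply: le_trans (half z) _.
  by rewrite ler_wpM2l ?lerDl ?powR_ge0// mulr_ge0 ?powR_ge0.
apply: le_trans (kbs_diff j z0 y0) _.
wlog zy : z y z0 y0 / enorm z <= enorm y => [W|].
  have [zy|/ltW yz] := leP (enorm z) (enorm y); first exact: W.
  by rewrite enorm_distC [enorm z * _]mulrC [X in _ <= _ * X]addrC; exact: W.
have ez := enorm_gt0 z0; have ey := enorm_gt0 y0.
have [d0|d0] := eqVneq (enorm (z - y)) 0.
  by rewrite d0 mul0r !mulr_ge0 ?addr_ge0 ?powR_ge0.
have dp : 0 < enorm (z - y) by rewrite lt_neqAle eq_sym d0 enorm_ge0.
have d2 : enorm (z - y) <= 2 * enorm y.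
  by apply: le_trans (enorm_triangle z (- y)) _; rewrite enormN; lra.
have b1' : 0 <= 1 - b by rewrite subr_ge0 ltW.
have dE : enorm (z - y) = enorm (z - y) `^ b * enorm (z - y) `^ (1 - b).
  by rewrite -powRD ?d0 ?implybT// (_ : b + (1 - b) = 1) ?powRr1 ?(ltW dp)//; ring.
have dy : enorm (z - y) `^ (1 - b) <= 2 * enorm y `^ (1 - b).
  apply: (@le_trans _ _ ((2 * enorm y) `^ (1 - b))).
    by apply: ge0_ler_powR; rewrite ?nnegrE ?mulr_ge0 ?enorm_ge0.
  rewrite powRM ?enorm_ge0// ler_wpM2r ?powR_ge0//.
  by rewrite -[leRHS](@powRr1 _ 2)//; apply: ler_powR; [rewrite ler1n|lra].
rewrite {1}dE -mulrA; rewrite [2 * _]mulrC -mulrA; apply: ler_wpM2l; first exact: powR_ge0.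
apply: (@le_trans _ _ (2 * enorm z `^ (- (1 + b)))); last first.
  by rewrite ler_wpM2l// lerDl powR_ge0.
apply: (@le_trans _ _ ((2 * enorm y `^ (1 - b)) * (enorm z * enorm y)^-1)).
  by rewrite ler_wpM2r// invr_ge0 mulr_ge0// ltW.
rewrite -mulrA ler_wpM2l// invfM mulrCA.
have -> : enorm y `^ (1 - b) / enorm y = enorm y `^ (- b).
  rewrite -powR_inv1 ?(ltW ey)// -powRD ?(gt_eqF ey) ?implybT//.
  by congr (_ `^ _); ring.
have -> : enorm z `^ (- (1 + b)) = (enorm z)^-1 * enorm z `^ (- b).
  rewrite -powR_inv1 ?(ltW ez)// -powRD ?(gt_eqF ez) ?implybT//.
  by congr (_ `^ _); ring.
by rewrite ler_wpM2l ?invr_ge0 ?(ltW ez)//; apply: ler_npowR => //; exact: ltW.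
Qed.

End KernelDifferences.

Section Potentials.
Variable R : realType.
Notation leb2 := (@leb2 R).
Implicit Types (x y z : plane R) (b i j l : bool) (e h : R).
Variables (rho : plane R -> R) (N : R).
Hypotheses (irho : integ rho) (rhoN : forall y, `|rho y| <= N).

Let N1 := \int[leb2]_y `|rho y|.
Let N0 : 0 <= N. Proof. exact: le_trans (normr_ge0 _) (rhoN 0). Qed.
Let mrho : measurable_fun setT rho. Proof. exact: integ_measurable. Qed.

(** Splitting at distance 1: the singularity is integrated against the bound
    of [rho], the rest against its integral. *)
Lemma potential_le (G : plane R -> R) x (p c : R) : 0 < p < 2 -> 0 <= c ->
  measurable_fun setT G ->
  (forall y, `|G y| <= c * enorm (x - y) `^ (- p) * `|rho y|) ->
  integ G /\ `|\int[leb2]_y G y| <= c * (N * (\int[leb2]_z wsing p z) + N1).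
Proof.
move=> p02 c0 mG GB; have iw := integ_wsing p02.
have iwx := integ_reflect x iw.
have i1 := integZ c (integD (integZ N iwx) (integ_norm irho)).
have dom y : `|G y| <= c * (N * wsing p (x - y) + `|rho y|).
  apply: le_trans (GB y) _; rewrite -mulrA; apply: ler_wpM2l => //.
  have [xy|xy] := leP (enorm (x - y)) 1.
    by rewrite wsingE// mulrC ler_wpDr// ler_wpM2r ?powR_ge0.
  apply: (@le_trans _ _ (1 * `|rho y|)).
    rewrite ler_wpM2r// -(powRr0 (enorm (x - y))).
    by apply: ler_powR; [exact: ltW|case/andP: p02 => /ltW; rewrite oppr_le0].
  by rewrite mul1r lerDr mulr_ge0// wsing_ge0.
split; first exact: integ_le i1.
apply: le_trans (norm_int_le mG dom i1) _.
have i2 := integZ N iwx; have i3 := integ_norm irho.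
by rewrite (intZ c (integD i2 i3)) (intD i2 i3) (intZ N iwx) (int_reflect x iw).
Qed.

Let measurable_kernel_rho (f : plane R -> R) x : measurable_fun setT f ->
  measurable_fun setT (fun y => f (x - y) * rho y).
Proof. by move=> mf; apply: measurable_funM => //; exact: measurable_reflect. Qed.

Lemma integ_cv_bs j x : integ (fun y => kbs j (x - y) * rho y).
Proof.
have [] // := @potential_le (fun y => kbs j (x - y) * rho y) x 1 1 _ ler01.
- by rewrite ltr01 ltr1n.
- by apply: measurable_kernel_rho; exact: measurable_kbs.
- by move=> y; rewrite mul1r normrM ler_wpM2r// kbs_bound.
Qed.

Definition vel j := cv (kbs j) rho.

Lemma vel_bound j x : `|vel j x| <= N * (\int[leb2]_z wsing 1 z) + N1.
Proof.
have [] // := @potential_le (fun y => kbs j (x - y) * rho y) x 1 1 _ ler01.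
- by rewrite ltr01 ltr1n.
- by apply: measurable_kernel_rho; exact: measurable_kbs.
- by move=> y; rewrite mul1r normrM ler_wpM2r// kbs_bound.
by rewrite mul1r.
Qed.

Lemma vel_holder (b : R) j x x' : 0 < b -> b < 1 ->
  `|vel j x - vel j x'| <=
     4 * (N * (\int[leb2]_z wsing (1 + b) z) + N1) * enorm (x - x') `^ b.
Proof.
move=> b0 b1; have p02 : 0 < 1 + b < 2 by apply/andP; split; lra.
pose c := 2 * enorm (x - x') `^ b; have c0 : 0 <= c by rewrite mulr_ge0 ?powR_ge0.
have mp u : measurable_fun setT (fun y => c * enorm (u - y) `^ (- (1 + b)) * `|rho y|).
  apply: measurable_funM; last exact: measurableT_comp.
  apply: measurable_funM => //.
  have := measurable_reflect u (@measurable_enorm R).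
  exact: (measurableT_comp (@measurable_powR R (- (1 + b)))).
have bnd u y : `|c * enorm (u - y) `^ (- (1 + b)) * `|rho y| | <=
    c * enorm (u - y) `^ (- (1 + b)) * `|rho y|.
  by rewrite ger0_norm// !mulr_ge0 ?powR_ge0.
have [i1 I1] := potential_le p02 c0 (mp x) (bnd x).
have [i2 I2] := potential_le p02 c0 (mp x') (bnd x').
rewrite /vel /cv -intB; [|exact: integ_cv_bs|exact: integ_cv_bs].
have mG : measurable_fun setT (fun y => kbs j (x - y) * rho y - kbs j (x' - y) * rho y).
  by apply: measurable_funB; apply: measurable_kernel_rho; exact: measurable_kbs.
have dom y : `|kbs j (x - y) * rho y - kbs j (x' - y) * rho y| <=
    c * enorm (x - y) `^ (- (1 + b)) * `|rho y| + c * enorm (x' - y) `^ (- (1 + b)) * `|rho y|.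
  rewrite -mulrBl normrM -!mulrDl -mulrDr ler_wpM2r//.
  have := kbs_holder j (x - y) (x' - y) b0 b1.
  by rewrite (_ : x - y - (x' - y) = x - x')// opprB addrA subrK.
apply: le_trans (norm_int_le mG dom (integD i1 i2)) _; rewrite (intD i1 i2).
have I1' := le_trans (ler_norm _) I1; have I2' := le_trans (ler_norm _) I2.
apply: le_trans (lerD I1' I2') _.
by rewrite le_eqVlt; apply/orP; left; apply/eqP; rewrite /c; ring.
Qed.

Lemma vel_holderM (b : R) j : 0 < b -> b < 1 ->
  holderM b (4 * (N * (\int[leb2]_z wsing (1 + b) z + \int[leb2]_z wsing 1 z) + N1)) (vel j).
Proof.
move=> b0 b1.
have N10 : 0 <= N1 by exact: int_ge0.
have W0 p : 0 <= \int[leb2]_z @wsing R p z by apply: int_ge0 => z; exact: wsing_ge0.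
split=> [x|x y].
  apply: le_trans (vel_bound j x) _; rewrite mulrDr.
  have := mulr_ge0 N0 (W0 (1 + b)); have := mulr_ge0 N0 (W0 1); lra.
apply: le_trans (vel_holder j x y b0 b1) _.
rewrite ler_wpM2r ?powR_ge0// ler_wpM2l// lerD2r ler_wpM2l// lerDl; exact: W0.
Qed.

Lemma continuous_vel j : continuous (vel j).
Proof.
have h0 : 0 < 2^-1 :> R by rewrite invr_gt0.
have h1 : 2^-1 < 1 :> R by rewrite invf_lt1 ?ltr1n.
exact: holderM_continuous h0 (vel_holderM j h0 h1).
Qed.

Lemma measurable_vel j : measurable_fun setT (vel j).
Proof. by apply: continuous_measurable_plane; exact: continuous_vel. Qed.

Lemma integ_velM j f : integ f -> integ (fun x => vel j x * f x).
Proof. by move=> hf; apply: integM_bdd => //; [exact: measurable_vel|exact: vel_bound]. Qed.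

Definition vele e j := cv (kre e j) rho.

Lemma kre_bounded e j : exists C, forall z, `|kre e j z| <= C.
Proof.
have [C C0 kC] := @kr_bound R; exists (`|e^-1| * C) => z.
rewrite /kre normrM ler_wpM2l//; apply: le_trans (kC j (e^-1 *: z)).
by rewrite ler_peMr// lerDl enorm_ge0.
Qed.

Lemma integ_cv_kre e j x : integ (fun y => kre e j (x - y) * rho y).
Proof.
have [C kC] := kre_bounded e j; apply: (@integM_bdd _ _ _ C) => //.
apply: measurable_reflect; apply: continuous_measurable_plane.
by apply: smooth_continuous; exact: smooth_kre.
Qed.

(** The two kernels differ only at distances at most [e], where both are bounded
    by the inverse of the distance; this has integral of order [e]. *)
Lemma vele_vel : exists2 D, 0 <= D & forall e j x, 0 < e <= 1 -> `|vele e j x - vel j x| <= D * e.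
Proof.
have [C C0 kC] := @kr_bound R.
have iw : integ (@wsing R 1) by apply: integ_wsing; rewrite ltr01 ltr1n.
have W0 : 0 <= \int[leb2]_z @wsing R 1 z by apply: int_ge0 => z; exact: wsing_ge0.
exists ((C + 1) * N * \int[leb2]_z wsing 1 z) => [|e j x /andP[e0 e1]].
  by rewrite !mulr_ge0// addr_ge0// ltW.
have ei : e^-1 != 0 by rewrite gt_eqF ?invr_gt0.
rewrite /vele /vel /cv -intB; [|exact: integ_cv_kre|exact: integ_cv_bs].
have iwe : integ (fun z => wsing 1 (e^-1 *: z)).
  by have := integ_affine 0 ei iw; apply: eq_integ => z; rewrite add0r.
have [|||_] := @conv_le R (fun y => kre e j (x - y) * rho y - kbs j (x - y) * rho y)
   (fun z => wsing 1 (e^-1 *: z)) x ((C + 1) * N * e^-1).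
- apply: measurable_funB; apply: measurable_kernel_rho; last exact: measurable_kbs.
  by apply: continuous_measurable_plane; apply: smooth_continuous; exact: smooth_kre.
- exact: iwe.
- move=> y; rewrite -mulrBl normrM; set z := x - y.
  have C1 : 0 <= (C + 1) * N * e^-1 * wsing 1 (e^-1 *: z).
    have c1 : 0 <= C + 1 by rewrite addr_ge0// ltW.
    have e2 : 0 <= e^-1 by rewrite invr_ge0 ltW.
    by apply: mulr_ge0 (wsing_ge0 _ _); rewrite !mulr_ge0.
  have [ez|ze] := ltP e (enorm z).
    by rewrite kre_out ?(ltW ez)// subrr normr0 mul0r.
  have [z0|z0] := eqVneq z 0.
    rewrite z0 {1}/kre scaler0.
    have c0 : co (~~ j) (0 : plane R) = 0 by case: (j).
    have -> : kr j (0 : plane R) = 0 by rewrite /kr c0 mul0r !mulr0.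
    have -> : kbs j (0 : plane R) = 0 by rewrite kbsE c0 mul0r !mulr0.
    by rewrite mulr0 subrr normr0 mul0r; move: C1; rewrite z0 scaler0.
  have ezp := enorm_gt0 z0.
  have w1 : wsing 1 (e^-1 *: z) = e * (enorm z)^-1.
    rewrite wsingE enormZ gtr0_norm ?invr_gt0// ?powR_inv1 ?mulr_ge0 ?invr_ge0 ?(ltW e0) ?enorm_ge0//.
      by rewrite invfM invrK.
    by rewrite mulrC ler_pdivrMr// mul1r.
  rewrite w1; have -> : (C + 1) * N * e^-1 * (e * (enorm z)^-1) = (C + 1) * (enorm z)^-1 * N.
    by field; rewrite !gt_eqF.
  apply: ler_pM => //; apply: le_trans (ler_normB _ _) _; rewrite mulrDl mul1r.
  apply: lerD; last by rewrite -powR_inv1 ?enorm_ge0// kbs_bound.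
  rewrite ler_pdivlMr// /kre normrM gtr0_norm ?invr_gt0//.
  apply: le_trans (kC j (e^-1 *: z)); rewrite mulrAC [leRHS]mulrC ler_wpM2r//.
  by rewrite enormZ gtr0_norm ?invr_gt0// lerDr.
move=> /le_trans; apply.
have := int_affine 0 ei iw; rewrite gtr0_norm ?invr_gt0// invrK => E.
have -> : \int[leb2]_z wsing 1 (e^-1 *: z) = e ^+ 2 * \int[leb2]_z wsing 1 z.
  by rewrite -E; apply: int_ext => z; rewrite add0r.
by rewrite le_eqVlt; apply/orP; left; apply/eqP; field; rewrite gt_eqF.
Qed.

Lemma int_vele_vel j f : integ f -> exists2 D, 0 <= D & forall e, 0 < e <= 1 ->
  `|\int[leb2]_x (vele e j x * f x) - \int[leb2]_x (vel j x * f x)| <= D * e.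
Proof.
move=> hf; have [D D0 vD] := vele_vel.
have n0 : 0 <= \int[leb2]_x `|f x| by exact: int_ge0.
exists (D * \int[leb2]_x `|f x|) => [|e e01]; first exact: mulr_ge0.
have ive : integ (fun x => vele e j x * f x).
  have [C kC] := kre_bounded e j.
  have mk : measurable_fun setT (kre e j).
    by apply: continuous_measurable_plane; apply: smooth_continuous; exact: smooth_kre.
  by have [] := int_cv mk kC irho hf.
have iv := integ_velM j hf; rewrite -(intB ive iv).
have i := integZ (D * e) (integ_norm hf).
apply: le_trans (norm_int_le _ _ i) _.
- exact: integ_measurable (integB ive iv).
- by move=> x; rewrite -mulrBl normrM ler_wpM2r// vD.
- by rewrite (intZ _ (integ_norm hf)) mulrAC.
Qed.

Lemma dkre_bounded e i j : exists C, forall z, `|dkre e i j z| <= C.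
Proof.
have [C _ dC] := @dkr_bound R; exists (`|e^-1 ^+ 2| * C) => z.
rewrite /dkre normrM ler_wpM2l//; apply: le_trans (dC i j (e^-1 *: z)).
by rewrite ler_peMr// expr_ge1 ?addr_ge0 ?enorm_ge0// lerDl enorm_ge0.
Qed.

Lemma integ_dkre_phi e i j phi r : smooth phi -> csupp r phi ->
  integ (fun y => rho y * \int[leb2]_x (dkre e i j (x - y) * phi x)).
Proof.
move=> sphi rphi.
have iphi : integ phi by apply: integ_csupp rphi; exact: smooth_continuous.
have md : measurable_fun setT (dkre e i j).
  apply: continuous_measurable_plane; rewrite (_ : dkre e i j = pd i (kre e j)).
    by apply: smooth_continuous; apply: smooth_pd; exact: smooth_kre.
  by apply/funext => x; rewrite pd_kre.
have [C dC] := dkre_bounded e i j.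
by have [] := int_cv md dC irho iphi.
Qed.

Lemma int_vele_pd e j i phi r : smooth phi -> csupp r phi ->
  \int[leb2]_x (vele e j x * pd i phi x) =
  - \int[leb2]_y (rho y * \int[leb2]_x (dkre e i j (x - y) * phi x)).
Proof.
move=> sphi rphi; have [C kC] := kre_bounded e j.
have mk : measurable_fun setT (kre e j).
  by apply: continuous_measurable_plane; apply: smooth_continuous; exact: smooth_kre.
have ipd : integ (pd i phi).
  apply: (@integ_csupp _ _ r); last exact: csupp_pd.
  by apply: smooth_continuous; exact: smooth_pd.
have [_ _ ->] := int_cv mk kC irho ipd.
have E y : \int[leb2]_x (kre e j (x - y) * pd i phi x) =
   - \int[leb2]_x (dkre e i j (x - y) * phi x).
  rewrite (int_conv_pd i y (smooth_kre e j) sphi rphi).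
  apply: (congr1 (fun t : R => - t)); apply: int_ext => x.
  by rewrite (pd_kre e i j (x - y)).
have i3 := integ_dkre_phi e i j sphi rphi.
rewrite -(intN i3); apply: int_ext => y.
by rewrite E mulrN.
Qed.

End Potentials.

(** * Weak identities for the velocity *)

Section WeakIdentities.
Variable R : realType.
Notation leb2 := (@leb2 R).
Implicit Types (x y z : plane R) (b i j l : bool) (e h : R) (f phi : plane R -> R).

Lemma eq_of_small_powR (A B D a : R) : 0 < a ->
  (forall e, 0 < e <= 1 -> `|A - B| <= D * e `^ a) -> A = B.
Proof.
move=> a0 h; apply: (@eq_of_small _ _ _ D) => t /andP[t0 t1].
have := h (t `^ a^-1); rewrite -powRrM mulVf ?gt_eqF// powRr1 ?(ltW t0)//; apply.
rewrite powR_gt0//=; apply: (@le_trans _ _ (1 `^ a^-1)); last by rewrite powR1.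
apply: ge0_ler_powR => //.
- by rewrite invr_ge0 ltW.
- by rewrite nnegrE ltW.
- by rewrite nnegrE.
Qed.

Lemma integ_trans y f : integ f -> integ (fun x => f (x - y)).
Proof. by move=> hf; have := integ_affine (- y) (oner_neq0 R) hf; rewrite -transE. Qed.

Lemma int_trans y f : integ f -> \int[leb2]_x f (x - y) = \int[leb2]_x f x.
Proof.
move=> hf; have := int_affine (- y) (oner_neq0 R) hf.
rewrite normr1 invr1 expr1n mul1r => <-.
by apply: int_ext => x; rewrite scale1r addrC.
Qed.

(** Averaging with [etae e] moves the values of a function by at most its
    oscillation at scale [e]. *)
Lemma mollify phi (D : R) y e : measurable_fun setT phi -> 0 < e ->
  (forall z, enorm (z - y) <= e -> `|phi z - phi y| <= D) ->
  `|\int[leb2]_x (etae e (x - y) * phi x) - mass R * phi y| <= D * mass R.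
Proof.
move=> mphi e0 phiD.
have D0 : 0 <= D.
  by apply: le_trans (normr_ge0 _) (phiD y _); rewrite subrr enorm0 ltW.
have ie := integ_trans y (integ_etae e0).
have dom x : `|etae e (x - y) * (phi x - phi y)| <= D * etae e (x - y).
  rewrite normrM (ger0_norm (etae_ge0 _ _)) mulrC.
  have [xy|xy] := leP (enorm (x - y)) e; last by rewrite (csupp_etae e0 xy) !mulr0.
  by rewrite ler_wpM2r ?etae_ge0// phiD.
have mm : measurable_fun setT (fun x => etae e (x - y) * (phi x - phi y)).
  by apply: measurable_funM; [exact: integ_measurable ie|exact: measurable_funB].
have i1 := integ_le mm dom (integZ D ie).
have i2 := integZ (phi y) ie.
have -> : \int[leb2]_x (etae e (x - y) * phi x) =
    \int[leb2]_x (etae e (x - y) * (phi x - phi y)) + mass R * phi y.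
  rewrite -(int_etae e0) -(int_trans y (integ_etae e0)) mulrC -(intZ _ ie) -(intD i1 i2).
  by apply: int_ext => x; ring.
rewrite addrK; apply: le_trans (norm_int_le mm dom (integZ D ie)) _.
by rewrite (intZ _ ie) (int_trans y (integ_etae e0)) (int_etae e0).
Qed.

Lemma smooth_dkre e i j : smooth (@dkre R e i j).
Proof.
rewrite (_ : dkre e i j = pd i (kre e j)); last by apply/funext => x; rewrite pd_kre.
by apply: smooth_pd; exact: smooth_kre.
Qed.

Lemma integ_dkre_conv e i j y phi r : smooth phi -> csupp r phi ->
  integ (fun x => dkre e i j (x - y) * phi x).
Proof.
move=> sphi rphi; apply: (@integ_csupp _ _ r); last exact: csuppM.
by apply: smooth_continuous; apply: smoothM => //; apply: smooth_trans; exact: smooth_dkre.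
Qed.

Lemma dist_sum0 (U1 U2 V1 V2 t1 t2 : R) : U1 + U2 = 0 ->
  `|U1 - V1| <= t1 -> `|U2 - V2| <= t2 -> `|V1 + V2 - 0| <= t1 + t2.
Proof.
move=> U0 h1 h2; have -> : V1 + V2 - 0 = - ((U1 - V1) + (U2 - V2)).
  by rewrite addrACA U0 add0r opprD !opprK subr0.
by rewrite normrN; apply: le_trans (ler_normD _ _) _; exact: lerD.
Qed.

Lemma dist_sub (U1 U2 V1 V2 Q t1 t2 t3 : R) : `|U1 - U2 - Q| <= t3 ->
  `|U1 - V1| <= t1 -> `|U2 - V2| <= t2 -> `|V1 - V2 - Q| <= t1 + t2 + t3.
Proof.
move=> h3 h1 h2.
have -> : V1 - V2 - Q = - (U1 - V1) + (U2 - V2) + (U1 - U2 - Q) by ring.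
apply: le_trans (ler_normD _ _) _; apply: lerD => //.
by apply: le_trans (ler_normD _ _) _; rewrite normrN; exact: lerD.
Qed.

Variables (rho : plane R -> R) (N : R).
Hypotheses (irho : integ rho) (rhoN : forall y, `|rho y| <= N).

(** The regularized velocities are divergence free because their kernel is. *)
Lemma vel_div phi r : smooth phi -> csupp r phi ->
  \int[leb2]_x (vel rho false x * pd false phi x)
  + \int[leb2]_x (vel rho true x * pd true phi x) = 0.
Proof.
move=> sphi rphi.
have ipd i : integ (pd i phi).
  apply: (@integ_csupp _ _ r); last exact: csupp_pd.
  by apply: smooth_continuous; exact: smooth_pd.
have [D1 _ h1] := int_vele_vel irho rhoN false (ipd false).
have [D2 _ h2] := int_vele_vel irho rhoN true (ipd true).
apply: (@eq_of_small _ _ _ (D1 + D2)) => e e01.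
have key : \int[leb2]_x (vele rho e false x * pd false phi x)
    + \int[leb2]_x (vele rho e true x * pd true phi x) = 0.
  rewrite !(int_vele_pd irho _ _ _ sphi rphi).
  have i1 := integ_dkre_phi irho e false false sphi rphi.
  have i2 := integ_dkre_phi irho e true true sphi rphi.
  rewrite -opprD -(intD i1 i2); apply/eqP; rewrite oppr_eq0; apply/eqP.
  rewrite -[RHS](@int0 R); apply: int_ext => y.
  have ij i j := integ_dkre_conv e i j y sphi rphi.
  rewrite -mulrDr -(intD (ij false false) (ij true true)).
  rewrite (_ : \int[leb2]_x _ = 0) ?mulr0// -[RHS](@int0 R); apply: int_ext => x.
  by rewrite -mulrDl div_kre mul0r.
by rewrite mulrDl; exact: (dist_sum0 key (h1 e e01) (h2 e e01)).
Qed.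

(** The curl of the kernel at scale [e] is [etae e], an approximation of
    [mass R] times the Dirac mass. *)
Lemma vel_curl phi r : smooth phi -> csupp r phi ->
  \int[leb2]_x (vel rho false x * pd true phi x)
  - \int[leb2]_x (vel rho true x * pd false phi x) = mass R * \int[leb2]_y (rho y * phi y).
Proof.
move=> sphi rphi.
have iphi : integ phi by apply: integ_csupp rphi; exact: smooth_continuous.
have ipd i : integ (pd i phi).
  apply: (@integ_csupp _ _ r); last exact: csupp_pd.
  by apply: smooth_continuous; exact: smooth_pd.
have [L L0 phiL] := csupp_lip sphi rphi.
have [D1 _ h1] := int_vele_vel irho rhoN false (ipd true).
have [D2 _ h2] := int_vele_vel irho rhoN true (ipd false).
have irp : integ (fun y => rho y * phi y).
  by apply: integM_bdd iphi; [exact: integ_measurable|exact: rhoN].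
pose S := \int[leb2]_y `|rho y|.
apply: (@eq_of_small _ _ _ (D1 + D2 + L * mass R * S)) => e e01.
have /andP[e0 e1] := e01.
have i1 := integ_dkre_phi irho e true false sphi rphi.
have i2 := integ_dkre_phi irho e false true sphi rphi.
have ij i j y := integ_dkre_conv e i j y sphi rphi.
have key : `|\int[leb2]_x (vele rho e false x * pd true phi x)
    - \int[leb2]_x (vele rho e true x * pd false phi x)
    - mass R * \int[leb2]_y (rho y * phi y)| <= L * mass R * S * e.
  rewrite !(int_vele_pd irho _ _ _ sphi rphi) opprK [- _ + _]addrC -(intB i2 i1) -(intZ _ irp).
  have i12 := integB i2 i1; have imp := integZ (mass R) irp.
  rewrite -(intB i12 imp).
  have bnd y : `|rho y * \int[leb2]_x (dkre e false true (x - y) * phi x)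
      - rho y * \int[leb2]_x (dkre e true false (x - y) * phi x)
      - mass R * (rho y * phi y)| <= L * mass R * e * `|rho y|.
    rewrite -mulrBr -(intB (ij false true y) (ij true false y)) mulrCA -mulrBr normrM mulrC.
    apply: ler_wpM2r => //.
    have -> : \int[leb2]_x (dkre e false true (x - y) * phi x - dkre e true false (x - y) * phi x)
      = \int[leb2]_x (etae e (x - y) * phi x).
      by apply: int_ext => x; rewrite -mulrBl etaeE.
    rewrite mulrAC; apply: mollify => //; first exact: integ_measurable.
    move=> z zy; apply: le_trans (phiL z y) _; apply: ler_wpM2l => //; exact: ltW.
  have inr := integZ (L * mass R * e) (integ_norm irho).
  apply: le_trans (norm_int_le _ bnd inr) _.
    exact: integ_measurable (integB i12 imp).
  by rewrite (intZ _ (integ_norm irho)) -/S mulrAC.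
by rewrite !mulrDl; exact: (dist_sub key (h1 e e01) (h2 e e01)).
Qed.

(** The velocity gradient, with the kernel cut between the scales [e] and 1. *)
Definition grade e i j := cv (dlk e i j) rho.

Definition deta e z : R := etae e z - eta z.

Lemma smooth_deta e : smooth (deta e).
Proof. by apply: smoothB; [exact: smooth_etae|exact: smooth_eta]. Qed.

Lemma csupp_deta e : 0 < e <= 1 -> csupp 1 (deta e).
Proof.
move=> /andP[e0 e1] z z1.
by rewrite /deta (@csupp_eta R z z1) (csupp_etae e0) ?subrr// (le_lt_trans e1).
Qed.

Lemma pd_deta e i z : pd i (deta e) z =
  pd i (dlk e false true) z - pd i (dlk e true false) z.
Proof.
have -> : deta e = (fun z => dlk e false true z - dlk e true false z).
  by apply/funext => y; rewrite curl_lk.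
by apply: pdB; exact: smooth_dlk.
Qed.

Lemma pd_dlkC e i l j z : pd l (dlk e i j) z = pd i (dlk e l j) z.
Proof. by rewrite -!pd_lk; apply: schwarz; exact: smooth_lk. Qed.

Lemma pd_dlk_div e l z : pd l (dlk e true true) z = - pd l (dlk e false false) z.
Proof.
have s c c' : smooth (@dlk R e c c') by exact: smooth_dlk.
apply/eqP; rewrite -addr_eq0 addrC; apply/eqP.
rewrite -pdD; [|exact: smooth_derivable|exact: smooth_derivable].
have -> : (fun z => dlk e false false z + dlk e true true z) = fun=> 0.
  by apply/funext => y; exact: div_lk.
by rewrite pd_cst.
Qed.

(** The gradient of the velocity is, up to the factor [mass], the mollified
    velocity differentiated once: this transfers a singular integral of the
    vorticity to an integral of the velocity against a test function. *)
Lemma gradeE e i j x : 0 < e <= 1 ->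
  mass R * grade e i j x = cv (pd i (deta e)) (vel rho j) x.
Proof.
move=> e01.
have sr i' j' := smooth_refl x (@smooth_dlk R e i' j').
have cr i' j' := csupp_refl (x := x) (@csupp_dlk R e i' j' e01).
have spr l i' j' := smooth_refl x (smooth_pd l (@smooth_dlk R e i' j')).
have ivp c l i' j' : integ (fun y => vel rho c y * pd l (dlk e i' j') (x - y)).
  apply: (integ_velM irho rhoN).
  have cp : csupp 1 (pd l (@dlk R e i' j')) by apply: csupp_pd; exact: csupp_dlk.
  by apply: integ_csupp (csupp_refl (x := x) cp); exact: smooth_continuous.
have pdr c l i' j' : \int[leb2]_y (vel rho c y * pd l (fun y => dlk e i' j' (x - y)) y)
    = - \int[leb2]_y (vel rho c y * pd l (dlk e i' j') (x - y)).
  rewrite -(intN (ivp c l i' j')); apply: int_ext => y.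
  apply: etrans (congr1 (fun t : R => vel rho c y * t) (pd_refl l x y (@smooth_dlk R e i' j'))) _.
  exact: mulrN.
have curlE j' : mass R * grade e i j' x =
    (- \int[leb2]_y (vel rho false y * pd true (dlk e i j') (x - y)))
    + \int[leb2]_y (vel rho true y * pd false (dlk e i j') (x - y)).
  have gE : grade e i j' x = \int[leb2]_y (rho y * dlk e i j' (x - y)).
    by apply: int_ext => y; exact: mulrC.
  have alg (p q s t u : R) : p - q = u -> p = - s -> q = - t -> u = - s + t.
    by move=> <- -> ->; rewrite opprK.
  rewrite gE.
  exact: (alg _ _ _ _ _ (vel_curl (sr i j') (cr i j')) (pdr false true i j') (pdr true false i j')).
have divE j' : \int[leb2]_y (vel rho false y * pd false (dlk e i j') (x - y))
    = - \int[leb2]_y (vel rho true y * pd true (dlk e i j') (x - y)).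
  have alg (p q s t : R) : p + q = 0 -> p = - s -> q = - t -> s = - t.
    by move=> pq ps qt; move: pq; rewrite ps qt -opprD => /eqP; rewrite oppr_eq0 addr_eq0 => /eqP.
  exact: (alg _ _ _ _ (vel_div (sr i j') (cr i j')) (pdr false false i j') (pdr true true i j')).
have target c : cv (pd i (deta e)) (vel rho c) x =
    \int[leb2]_y (vel rho c y * pd false (dlk e i true) (x - y))
    - \int[leb2]_y (vel rho c y * pd true (dlk e i false) (x - y)).
  rewrite -(intB (ivp c false i true) (ivp c true i false)); apply: int_ext => y.
  by rewrite pd_deta (pd_dlkC e i false true) (pd_dlkC e i true false) mulrC mulrBr.
have swap c : \int[leb2]_y (vel rho c y * pd true (dlk e i true) (x - y))
    = - \int[leb2]_y (vel rho c y * pd false (dlk e i false) (x - y)).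
  rewrite -(intN (ivp c false i false)); apply: int_ext => y.
  by rewrite (pd_dlkC e i true true) pd_dlk_div (pd_dlkC e false i) mulrN.
have algT (m q At Bt Ef Cf : R) : m = - At + Bt -> q = Bt - Ef -> At = - Cf -> Cf = - Ef -> m = q.
  by move=> -> -> -> ->; rewrite !opprK addrC.
have algF (m q Af Bf D Et : R) : m = - Af + Bf -> q = D - Af -> Et = - Bf -> D = - Et -> m = q.
  by move=> -> -> -> ->; rewrite opprK addrC.
case: j.
  exact: (algT _ _ _ _ _ _ (curlE true) (target true) (swap false) (divE false)).
exact: (algF _ _ _ _ _ _ (curlE false) (target false) (swap true) (divE true)).
Qed.

End WeakIdentities.

Section HolderLimit.
Variable R : realType.

(** A family that is uniformly Hoelder, and Cauchy at the matching rate, has a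
    Hoelder limit: the supremum of the lower barriers [F h x - M h^a], all of
    which lie below all upper barriers [F e x + M e^a]. *)
Lemma holder_limit (F : R -> plane R -> R) (a M : R) : 0 < a ->
  (forall e, 0 < e <= 1 -> holderM a M (F e)) ->
  (forall e h x, 0 < e -> e <= h -> h <= 1 -> `|F e x - F h x| <= M * h `^ a) ->
  exists G : plane R -> R, holderM a (4 * M) G /\
    forall e x, 0 < e <= 1 -> `|F e x - G x| <= M * e `^ a.
Proof.
move=> a0 FM FC; have one : 0 < (1 : R) <= 1 by rewrite ltr01 lexx.
have M0 := holderM_ge0 (FM 1 one).
pose S x : set R := [set t | exists2 h, 0 < h <= 1 & t = F h x - M * h `^ a].
pose G x := sup (S x).
have ub e x : 0 < e <= 1 -> ubound (S x) (F e x + M * e `^ a).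
  move=> /andP[e0 e1] _ [h /andP[h0 h1] ->].
  have ph (t : R) : 0 <= M * t `^ a by rewrite mulr_ge0// powR_ge0.
  have [eh|he] := leP e h.
    have := FC e h x e0 eh h1; rewrite ler_norml => /andP[H _].
    by have := ph e; lra.
  have := FC h e x h0 (ltW he) e1; rewrite ler_norml => /andP[_ H].
  by have := ph h; lra.
have hs x : has_sup (S x).
  split; first by exists (F 1 x - M * 1 `^ a); exists 1.
  by exists (F 1 x + M * 1 `^ a); exact: ub.
have FG e x : 0 < e <= 1 -> `|F e x - G x| <= M * e `^ a.
  move=> e01; rewrite ler_norml; apply/andP; split.
    have : G x <= F e x + M * e `^ a by apply: ge_sup (ub e x e01); exact: (proj1 (hs x)).
    lra.
  have : F e x - M * e `^ a <= G x by apply: sup_ubound; [exact: (proj2 (hs x))|exists e].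
  lra.
exists G; split=> //.
have GM x : `|G x| <= 2 * M.
  have := FG 1 x one; rewrite powR1 mulr1 => h; have [h2 _] := FM 1 one.
  have -> : G x = F 1 x - (F 1 x - G x) by ring.
  apply: le_trans (ler_normB _ _) _; have := h2 x; lra.
rewrite (_ : 4 * M = 2 * (2 * M)); last by ring.
have M20 : 0 <= 2 * M by rewrite mulr_ge0.
split=> [x|x y]; first by apply: le_trans (GM x) _; lra.
set d := enorm (x - y); have [d0|d0] := eqVneq d 0.
  have /eqP := enorm_eq0 d0; rewrite subr_eq0 => /eqP ->.
  by rewrite subrr normr0 !mulr_ge0// powR_ge0.
have dp : 0 < d by rewrite lt_neqAle eq_sym d0 enorm_ge0.
have [d1|d1] := leP d 1; last first.
  apply: (@le_trans _ _ (2 * (2 * M) * 1)).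
    by apply: le_trans (ler_normB _ _) _; have := GM x; have := GM y; lra.
  apply: ler_wpM2l; first by rewrite mulr_ge0.
  by rewrite -(powRr0 d); apply: ler_powR; exact: ltW.
have d01 : 0 < d <= 1 by rewrite dp.
have [_ h] := FM d d01; have h1 := FG d x d01; have h2 := FG d y d01; have h3 := h x y.
have -> : G x - G y = - (F d x - G x) + (F d x - F d y) + (F d y - G y) by ring.
apply: le_trans (ler_normD _ _) _; apply: le_trans (lerD (ler_normD _ _) (lexx _)) _.
rewrite normrN; move: h3; rewrite -/d => h3.
by have := powR_ge0 d a; have := mulr_ge0 M0 (powR_ge0 d a); lra.
Qed.

End HolderLimit.

(** * Hoelder families indexed by the scale *)

Section HolderFamilies.
Variable R : realType.
Notation leb2 := (@leb2 R).
Implicit Types (x y z : plane R) (b i j l : bool) (e h : R) (f phi : plane R -> R).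
Variables (a : R).
Hypotheses (a0 : 0 < a) (a1 : a < 1).

Lemma holderMD K1 K2 (f g : plane R -> R) : holderM a K1 f -> holderM a K2 g ->
  holderM a (K1 + K2) (fun x => f x + g x).
Proof.
move=> [f1 f2] [g1 g2]; split=> [x|x y].
  by apply: le_trans (ler_normD _ _) _; exact: lerD.
rewrite opprD addrACA mulrDl; apply: le_trans (ler_normD _ _) _; exact: lerD.
Qed.

Lemma holderMN K f : holderM a K f -> holderM a K (fun x => - f x).
Proof.
by move=> [f1 f2]; split=> [x|x y]; rewrite ?normrN// -opprD normrN.
Qed.

Lemma holderMZ c K f : holderM a K f -> holderM a (`|c| * K) (fun x => c * f x).
Proof.
move=> [f1 f2]; split=> [x|x y]; first by rewrite normrM ler_wpM2l.
by rewrite -mulrBr normrM -mulrA ler_wpM2l.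
Qed.

Lemma holderMM K1 K2 (f g : plane R -> R) : holderM a K1 f -> holderM a K2 g ->
  holderM a (2 * (K1 * K2)) (fun x => f x * g x).
Proof.
move=> hf hg; have k1 := holderM_ge0 hf; have k2 := holderM_ge0 hg.
have [f1 f2] := hf; have [g1 g2] := hg.
split=> [x|x y].
  rewrite normrM; apply: (@le_trans _ _ (K1 * K2)); first exact: ler_pM.
  by rewrite mulr2n mulrDl mul1r lerDl mulr_ge0.
have -> : f x * g x - f y * g y = (f x - f y) * g x + f y * (g x - g y) by ring.
apply: le_trans (ler_normD _ _) _; rewrite !normrM.
have -> : 2 * (K1 * K2) * enorm (x - y) `^ a =
  K1 * enorm (x - y) `^ a * K2 + K1 * (K2 * enorm (x - y) `^ a) by ring.
by apply: lerD; apply: ler_pM.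
Qed.

Lemma holderM_cst (c : R) : holderM a `|c| (fun _ : plane R => c).
Proof. by split=> // x y; rewrite subrr normr0 mulr_ge0// powR_ge0. Qed.

(** Uniform Hoelder bounds, and convergence at the rate [h ^ a] as the scale
    goes to zero. *)
Definition hfam K (F : R -> plane R -> R) :=
  (forall e, 0 < e <= 1 -> holderM a K (F e)) /\
  (forall e h x, 0 < e -> e <= h -> h <= 1 -> `|F e x - F h x| <= K * h `^ a).

Lemma hfamD K1 K2 (F G : R -> plane R -> R) : hfam K1 F -> hfam K2 G ->
  hfam (K1 + K2) (fun e x => F e x + G e x).
Proof.
move=> [f1 f2] [g1 g2]; split=> [e e01|e h x e0 eh h1].
  by apply: holderMD; [exact: f1|exact: g1].
rewrite opprD addrACA mulrDl; apply: le_trans (ler_normD _ _) _.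
by apply: lerD; [exact: f2|exact: g2].
Qed.

Lemma hfamN K F : hfam K F -> hfam K (fun e x => - F e x).
Proof.
move=> [f1 f2]; split=> [e e01|e h x e0 eh h1]; first exact/holderMN/f1.
by rewrite -opprD normrN; exact: f2.
Qed.

Lemma hfam_cst K f : holderM a K f -> hfam K (fun _ => f).
Proof.
move=> hf; split=> // e h x _ _ _; rewrite subrr normr0.
by rewrite mulr_ge0 ?powR_ge0// (holderM_ge0 hf).
Qed.

Lemma hfam_limit K F : hfam K F -> exists G : plane R -> R, holderM a (4 * K) G /\
    forall e x, 0 < e <= 1 -> `|F e x - G x| <= K * e `^ a.
Proof. by move=> [f1 f2]; exact: holder_limit. Qed.

Lemma hfam_local K F :
  (forall e x, 0 < e <= 1 -> `|F e x| <= K) ->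
  (forall e x y, 0 < e <= 1 -> 0 < enorm (x - y) <= 1 ->
     `|F e x - F e y| <= K * enorm (x - y) `^ a) ->
  (forall e h x, 0 < e -> e <= h -> h <= 1 -> `|F e x - F h x| <= K * h `^ a) ->
  hfam (2 * K) F.
Proof.
move=> F1 F2 F3; split=> [e e01|e h x e0 eh h1].
  by apply: holderM_local => // [x|x y xy]; [exact: F1|exact: F2].
apply: le_trans (F3 e h x e0 eh h1) _.
have K0 : 0 <= K by apply: le_trans (F1 1 0 _); rewrite // ltr01 lexx.
by rewrite -mulrA mulr2n mulrDl mul1r lerDl mulr_ge0// powR_ge0.
Qed.

(** Integrability of [rho] suffices: the regularity comes from the kernel. *)
Lemma cv_lip (k rho : plane R -> R) (C : R) : 0 <= C -> continuous k ->
  (forall z, `|k z| <= C) ->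
  (forall z y, enorm (z - y) <= 1 -> `|k z - k y| <= C * enorm (z - y)) ->
  integ rho -> holderM a (2 * (C * \int[leb2]_y `|rho y|)) (cv k rho).
Proof.
move=> C0 ck kC kL irho.
have mk x : measurable_fun setT (fun y => k (x - y)).
  by apply: measurable_reflect; exact: continuous_measurable_plane.
have ik x : integ (fun y => k (x - y) * rho y).
  by apply: integM_bdd irho; [exact: mk|move=> y; exact: kC].
have iC c := integZ c (integ_norm irho).
have nr c : \int[leb2]_y (c * `|rho y|) = c * \int[leb2]_y `|rho y| by exact: intZ (integ_norm irho).
apply: holderM_local => // [x|x y /andP[d0 d1]].
  rewrite -nr; apply: norm_int_le (iC _); first exact: integ_measurable (ik x).
  by move=> y; rewrite normrM ler_wpM2r.
rewrite /cv -(intB (ik x) (ik y)).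
have dom u : `|k (x - u) * rho u - k (y - u) * rho u| <= (C * enorm (x - y)) * `|rho u|.
  rewrite -mulrBl normrM ler_wpM2r//.
  have := kL (x - u) (y - u); rewrite (_ : x - u - (y - u) = x - y); first by apply.
  by rewrite opprB addrA subrK.
apply: le_trans (norm_int_le _ dom (iC _)) _.
  exact: integ_measurable (integB (ik x) (ik y)).
rewrite nr mulrAC ler_wpM2l ?mulr_ge0//; first by rewrite int_ge0.
by apply: ger1_powR; [rewrite d0|exact: ltW].
Qed.

End HolderFamilies.

Section KernelFamilies.
Variable R : realType.
Notation leb2 := (@leb2 R).
Implicit Types (x y z : plane R) (b i j l : bool) (e h : R) (f phi : plane R -> R).
Variables (a C : R).
Hypotheses (a0 : 0 < a) (a1 : a < 1) (C0 : 0 < C).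

Definition kernel_bounds := [/\ 
  (forall i j z, `|pd i (@kr R j) z| * (1 + enorm z) ^+ 2 <= C),
  (forall i j z y, enorm (z - y) <= 1 ->
    `|pd i (@kr R j) z - pd i (kr j) y| * (1 + enorm z) ^+ 3 <= C * enorm (z - y)) &
  (forall e j z, 0 < e -> `|@kre R e j z| * enorm z <= C)].

Hypothesis KB : kernel_bounds.

Let W0 := \int[leb2]_z @wsing R 1 z.
Let W1 := \int[leb2]_z @wsing R (2 - a) z.
Let W2 := \int[leb2]_z @wtail R (3 - a) z.

Definition kcomm i j := @comm R (pd i (kr j)).

Definition Kcomm (M N P : R) := 2 * (M * (N * (2 * C) * (2 * W1 + W2) + P)).

Let ck i j : continuous (pd i (@kr R j)).
Proof. by apply: smooth_continuous; apply: smooth_pd; exact: smooth_kr. Qed.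

Lemma hfam_comm i j (F rho : plane R -> R) (M N P : R) :
  0 <= M -> (forall x y, `|F x - F y| <= M * enorm (x - y) `^ a) ->
  measurable_fun setT rho -> (forall y, `|rho y| <= N) ->
  (forall h z, 0 < h <= 1 -> `|cv (dlk h i j) rho z| <= P) ->
  hfam a (Kcomm M N P) (kcomm i j F rho).
Proof.
move=> M0 FH mrho rhoN cP; have [kb kl _] := KB.
have N0 : 0 <= N by exact: le_trans (rhoN 0).
have P0 : 0 <= P by apply: le_trans (cP 1 0 _); rewrite // ltr01 lexx.
have W10 : 0 <= W1 by apply: int_ge0 => z; exact: wsing_ge0.
have W20 : 0 <= W2 by apply: int_ge0 => z; exact: wtail_ge0.
have c2 : 0 <= 2 * C by rewrite mulr_ge0// ltW.
have le1 : M * N * (2 * C) * W1 <= M * (N * (2 * C) * (2 * W1 + W2) + P).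
  rewrite -!mulrA; apply: ler_wpM2l => //; rewrite !mulrA.
  apply: ler_wpDr => //; rewrite -!mulrA; apply: ler_wpM2l => //; rewrite mulrA.
  by rewrite mulrA; apply: ler_wpM2l => //; lra.
apply: hfam_local => // [e x e01|e x y e01 xy|e h x e0 eh h1].
- apply: le_trans le1.
  exact: (comm_bound a0 a1 C0 (@ck i j) (kb i j) (@hom_out_dkr R i j) FH M0 mrho rhoN x e01).
- exact: (comm_holder a0 a1 C0 (@ck i j) (kb i j) (kl i j) (@hom_out_dkr R i j)
    FH M0 mrho rhoN e01 xy cP).
- apply: le_trans (comm_cauchy a0 a1 C0 (@ck i j) (kb i j) (@hom_out_dkr R i j)
    FH M0 mrho rhoN x e0 eh h1) _.
  by rewrite ler_wpM2r ?powR_ge0.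
Qed.

Lemma integ_kcomm i j (F rho : plane R -> R) (M N : R) e x :
  0 <= M -> (forall x y, `|F x - F y| <= M * enorm (x - y) `^ a) ->
  measurable_fun setT rho -> (forall y, `|rho y| <= N) -> 0 < e <= 1 ->
  integ (fun y => (F x - F y) * (dlk e i j (x - y) * rho y)).
Proof.
move=> M0 FH mrho rhoN e01; have [kb kl _] := KB.
exact: (integ_comm a0 a1 C0 (@ck i j) (kb i j) (@hom_out_dkr R i j) FH M0 mrho rhoN x e01).
Qed.

Let kre0 e j : kre e j (0 : plane R) = 0.
Proof.
have c0 : co (~~ j) (0 : plane R) = 0 by case: (j).
by rewrite /kre scaler0 /kr c0 mul0r !mulr0.
Qed.

(** The kernels agree beyond distance [h], and each is bounded by the inverse of
    the distance. *)
Lemma lk_diff e h j z : 0 < e -> e <= h -> h <= 1 ->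
  `|lk e j z - lk h j z| <= 2 * C * h^-1 * wsing 1 (h^-1 *: z).
Proof.
move=> e0 eh h1; have h0 := lt_le_trans e0 eh; have [_ _ kr_b] := KB.
have -> : lk e j z - lk h j z = kre e j z - kre h j z by rewrite /lk; ring.
have hi : 0 < h^-1 by rewrite invr_gt0.
have c2 : 0 <= 2 * C * h^-1 by rewrite mulr_ge0 ?(ltW hi)// mulr_ge0// ltW.
have [hz|zh] := ltP h (enorm z).
  rewrite !kre_out ?(ltW hz)//; last exact: le_trans eh (ltW hz).
  by rewrite subrr normr0; apply: mulr_ge0 => //; exact: wsing_ge0.
have [->|z0] := eqVneq z 0.
  by rewrite !kre0 subrr normr0; apply: mulr_ge0 => //; exact: wsing_ge0.
have ez := enorm_gt0 z0.
have -> : 2 * C * h^-1 * wsing 1 (h^-1 *: z) = C / enorm z + C / enorm z.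
  rewrite wsingE enormZ gtr0_norm//; last by rewrite mulrC ler_pdivrMr// mul1r.
  rewrite powR_inv1; last by rewrite mulr_ge0 ?ltW.
  by field; rewrite !gt_eqF.
apply: le_trans (ler_normB _ _) _.
by apply: lerD; rewrite ler_pdivlMr//; exact: kr_b.
Qed.

Lemma lk_weight e j z : 0 < e <= 1 -> `|lk e j z| <= 2 * C * wsing 1 z.
Proof.
move=> /andP[e0 e1]; have := lk_diff j z e0 e1 (lexx 1).
have -> : lk 1 j z = 0 by rewrite /lk /kre invr1 mul1r scale1r subrr.
by rewrite subr0 invr1 mulr1 scale1r.
Qed.

(** The undifferentiated kernel is integrable at the origin, uniformly in the
    scale. *)
Lemma hfam_lk j f (B : R) : holderM a B f ->
  hfam a (2 * (B * (2 * C) * W0)) (fun e => cv (lk e j) f).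
Proof.
move=> hf; have B0 := holderM_ge0 hf; have [f1 f2] := hf.
have mf := holderM_measurable a0 hf.
have iw : integ (@wsing R 1) by apply: integ_wsing; rewrite ltr01 ltr1n.
have W00 : 0 <= W0 by apply: int_ge0 => z; exact: wsing_ge0.
have mlk e : measurable_fun setT (lk e j).
  by apply: continuous_measurable_plane; apply: smooth_continuous; exact: smooth_lk.
have mG e x : measurable_fun setT (fun y => lk e j (x - y) * f y).
  by apply: measurable_funM => //; exact: measurable_reflect.
have bnd e x : 0 < e <= 1 -> integ (fun y => lk e j (x - y) * f y) /\
    `|cv (lk e j) f x| <= (B * (2 * C)) * W0.
  move=> e01; apply: conv_le => // y; rewrite normrM mulrC -mulrA.
  by apply: ler_pM => //; exact: lk_weight.
apply: hfam_local => // [e x e01|e x y e01 /andP[d0 d1]|e h x e0 eh h1].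
- exact: (proj2 (bnd e x e01)).
- (* after a reflection the increment falls on [f] *)
  have refl u : cv (lk e j) f u = \int[leb2]_z (lk e j z * f (u - z)) /\
      integ (fun z => lk e j z * f (u - z)).
    have ilk : integ (fun z => lk e j z * f (u - z)).
      have := integ_reflect u (proj1 (bnd e u e01)).
      by apply: eq_integ => z; rewrite subKr.
    split=> //; rewrite -(int_reflect u ilk).
    by apply: int_ext => y'; rewrite subKr.
  have [-> ix] := refl x; have [-> iy] := refl y.
  rewrite -(intB ix iy).
  have dom z : `|lk e j z * f (x - z) - lk e j z * f (y - z)| <=
      (B * (2 * C) * enorm (x - y) `^ a) * wsing 1 z.
    rewrite -mulrBr normrM.
    have := f2 (x - z) (y - z); rewrite (_ : x - z - (y - z) = x - y); last first.
      by rewrite opprB addrA subrK.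
    move=> H; apply: le_trans (ler_pM _ _ (lk_weight j z e01) H) _ => //.
    by rewrite le_eqVlt; apply/orP; left; apply/eqP; ring.
  apply: le_trans (norm_int_le _ dom (integZ _ iw)) _.
    exact: integ_measurable (integB ix iy).
  by rewrite (intZ _ iw) -/W0 mulrAC.
- have h0 := lt_le_trans e0 eh.
  have e01 : 0 < e <= 1 by rewrite e0 (le_trans eh).
  have h01 : 0 < h <= 1 by rewrite h0.
  have ie := proj1 (bnd e x e01); have ih := proj1 (bnd h x h01).
  have hi : h^-1 != 0 by rewrite gt_eqF ?invr_gt0.
  have iwh : integ (fun z => wsing 1 (h^-1 *: z)).
    by have := integ_affine 0 hi iw; apply: eq_integ => z; rewrite add0r.
  rewrite /cv -(intB ie ih).
  have [|||_ I] := @conv_le R (fun y => lk e j (x - y) * f y - lk h j (x - y) * f y)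
    (fun z => wsing 1 (h^-1 *: z)) x (B * (2 * C * h^-1)).
  + exact: integ_measurable (integB ie ih).
  + exact: iwh.
  + move=> y; rewrite -mulrBl normrM mulrC -mulrA.
    by apply: ler_pM => //; exact: lk_diff.
  apply: le_trans I _.
  have := int_affine 0 hi iw; rewrite gtr0_norm ?invr_gt0// invrK => E.
  have -> : \int[leb2]_z wsing 1 (h^-1 *: z) = h ^+ 2 * W0.
    by rewrite -E; apply: int_ext => z; rewrite add0r.
  have -> : B * (2 * C * h^-1) * (h ^+ 2 * W0) = B * (2 * C) * W0 * h.
    by field; rewrite gt_eqF.
  apply: ler_wpM2l; first by rewrite !mulr_ge0// ltW.
  by apply: ger1_powR; [rewrite h0|exact: ltW].
Qed.

End KernelFamilies.

Lemma kernel_bounds_exist (R : realType) : exists2 C, 0 < C & @kernel_bounds R C.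
Proof.
have [C1 c1 b1] := dkr_bound R; have [C2 c2 b2] := dkr_lip R; have [C3 c3 b3] := kr_bound R.
exists (C1 + C2 + C3); first by rewrite !addr_gt0.
split=> [i j z|i j z y zy|e j z e0].
- by apply: le_trans (b1 i j z) _; rewrite -addrA lerDl addr_ge0// ltW.
- apply: le_trans (b2 i j z y zy) _; rewrite ler_wpM2r ?enorm_ge0//.
  by rewrite addrAC lerDr addr_ge0// ltW.
- apply: (@le_trans _ _ C3); last by rewrite lerDr addr_ge0// ltW.
  rewrite /kre normrM gtr0_norm ?invr_gt0//; apply: le_trans (b3 j (e^-1 *: z)).
  rewrite mulrAC mulrC ler_wpM2l//.
  by rewrite enormZ gtr0_norm ?invr_gt0// lerDr.
Qed.

(** * Distributions of divergence form *)

Section DivergenceForm.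
Variable R : realType.
Notation leb2 := (@leb2 R).
Implicit Types (x y z : plane R) (b i j l : bool) (e h : R) (f phi : plane R -> R)
  (Y V : plane R -> plane R).
Variables (a : R).
Hypotheses (a0 : 0 < a) (a1 : a < 1).

Definition bmeas f := measurable_fun setT f /\ exists M, forall x, `|f x| <= M.

Lemma bmeasM f phi : bmeas f -> bmeas phi -> bmeas (fun x => f x * phi x).
Proof.
move=> [mf [A fA]] [mg [B gB]]; split; first exact: measurable_funM.
by exists (A * B) => x; rewrite normrM; apply: ler_pM.
Qed.

Lemma bmeas_holderM K f : holderM a K f -> bmeas f.
Proof. by move=> hf; split; [exact: holderM_measurable hf|exists K; exact: (proj1 hf)]. Qed.

Lemma bmeas_integ N f : integ f -> (forall x, `|f x| <= N) -> bmeas f.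
Proof. by move=> hf fN; split; [exact: integ_measurable|exists N]. Qed.

Lemma bmeas_cst (c : R) : bmeas (fun=> c).
Proof. by split; [exact: measurable_cst|exists `|c|]. Qed.

Lemma integ_bdm f phi : bmeas f -> integ phi -> integ (fun x => f x * phi x).
Proof. by move=> [mf [A fA]]; exact: integM_bdd. Qed.

Lemma integ_test phi r : smooth phi -> csupp r phi -> integ phi.
Proof. by move=> sphi; apply: integ_csupp; exact: smooth_continuous. Qed.

Lemma integ_pd b phi r : smooth phi -> csupp r phi -> integ (pd b phi).
Proof. by move=> sphi rphi; apply: (integ_test (smooth_pd b sphi) (csupp_pd b rphi)). Qed.

Lemma ddivE V phi r : (forall b, bmeas (fun x => co b (V x))) -> smooth phi -> csupp r phi ->
  ddiv V phi = - (\int[leb2]_x (co false (V x) * pd false phi x)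
                  + \int[leb2]_x (co true (V x) * pd true phi x)).
Proof.
move=> bV sphi rphi; apply: (congr1 (fun t : R => - t)).
exact: intD (integ_bdm (bV false) (integ_pd false sphi rphi))
  (integ_bdm (bV true) (integ_pd true sphi rphi)).
Qed.

Lemma integ_refl_test x phi r f : bmeas f -> smooth phi -> csupp r phi ->
  integ (fun y => phi (x - y) * f y).
Proof.
move=> bf sphi rphi; apply: (eq_integ (f := fun y => f y * phi (x - y))).
  by move=> y; exact: mulrC.
exact: integ_bdm bf (integ_test (smooth_refl x sphi) (csupp_refl (x := x) rphi)).
Qed.

Lemma ddiv_refl V phi r x : (forall b, bmeas (fun y => co b (V y))) -> smooth phi ->
  csupp r phi -> ddiv V (fun y => phi (x - y)) =
  cv (pd false phi) (fun y => co false (V y)) x + cv (pd true phi) (fun y => co true (V y)) x.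
Proof.
move=> bV sphi rphi.
rewrite (ddivE bV (smooth_refl x sphi) (csupp_refl (x := x) rphi)).
have E b : \int[leb2]_y (co b (V y) * pd b (fun y => phi (x - y)) y) =
    - cv (pd b phi) (fun y => co b (V y)) x.
  rewrite -(intN (integ_refl_test x (bV b) (smooth_pd b sphi) (csupp_pd b rphi))).
  apply: int_ext => y.
  apply: etrans (congr1 (fun t : R => co b (V y) * t) (pd_refl b x y sphi)) _.
  by rewrite mulrN mulrC.
have alg (p q p' q' : R) : p = - p' -> q = - q' -> - (p + q) = p' + q'.
  by move=> -> ->; rewrite -opprD opprK.
exact: (alg _ _ _ _ (E false) (E true)).
Qed.

Lemma deqE (S T : distr R) : deq S T <->
  forall phi r, smooth phi -> csupp r phi -> S phi = T phi.
Proof.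
split=> [h phi r sphi rphi|h phi tphi]; first by apply: h; exact: smooth_test_function rphi.
have [r _ rphi] := test_function_csupp tphi.
exact: h (test_function_smooth tphi) rphi.
Qed.

(** The quantitative form of [in_Cam1], with real constants instead of norms in
    the extended reals. *)
Definition Crep M (T : distr R) := exists f V, [/\ holderM a M f,
  (forall b, holderM a M (fun x => co b (V x))) & deq T (Defs.dadd (dfun f) (ddiv V))].

Lemma CrepD K1 K2 S T (U : distr R) : Crep K1 S -> Crep K2 T ->
  (forall phi, test_function phi -> U phi = S phi + T phi) -> Crep (K1 + K2) U.
Proof.
move=> [f [V [hf hV /deqE ST]]] [f' [V' [hf' hV' /deqE TT]]] UST.
exists (fun x => f x + f' x), (fun x => V x + V' x); split.
- exact: holderMD.
- by move=> b; have := holderMD (hV b) (hV' b); case: b.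
apply/deqE => phi r sphi rphi.
rewrite (UST _ (smooth_test_function sphi rphi)) (ST _ _ sphi rphi) (TT _ _ sphi rphi) /Defs.dadd.
have bV b := bmeas_holderM (hV b). have bV' b := bmeas_holderM (hV' b).
have bVV b : bmeas (fun x => co b (V x + V' x)).
  by apply: (@bmeas_holderM (K1 + K2)); have := holderMD (hV b) (hV' b); case: b.
rewrite (ddivE bV sphi rphi) (ddivE bV' sphi rphi) (ddivE bVV sphi rphi).
have ip := integ_test sphi rphi.
have E0 : dfun (fun x => f x + f' x) phi = dfun f phi + dfun f' phi.
  rewrite /dfun -(intD (integ_bdm (bmeas_holderM hf) ip) (integ_bdm (bmeas_holderM hf') ip)).
  by apply: int_ext => x; exact: mulrDl.
have E b : \int[leb2]_x (co b (V x + V' x) * pd b phi x) =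
    \int[leb2]_x (co b (V x) * pd b phi x) + \int[leb2]_x (co b (V' x) * pd b phi x).
  rewrite -(intD (integ_bdm (bV b) (integ_pd b sphi rphi)) (integ_bdm (bV' b) (integ_pd b sphi rphi))).
  by apply: int_ext => x; rewrite -mulrDl; case: b.
have alg (d d' d'' p p' p'' q q' q'' : R) : d'' = d + d' -> p'' = p + p' -> q'' = q + q' ->
  d - (p + q) + (d' - (p' + q')) = d'' - (p'' + q'') by move=> -> -> ->; ring.
exact: (alg _ _ _ _ _ _ _ _ _ E0 (E false) (E true)).
Qed.

Lemma CrepN K S : Crep K S -> Crep K (fun phi => - S phi).
Proof.
move=> [f [V [hf hV /deqE ST]]].
have hN b : holderM a K (fun x => co b (- V x)) by have := holderMN (hV b); case: b.
exists (fun x => - f x), (fun x => - V x); split.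
- exact: holderMN.
- exact: hN.
apply/deqE => phi r sphi rphi; rewrite (ST _ _ sphi rphi) /Defs.dadd.
have bV b := bmeas_holderM (hV b).
rewrite (ddivE bV sphi rphi) (ddivE (fun b => bmeas_holderM (hN b)) sphi rphi).
have E0 : dfun (fun x => - f x) phi = - dfun f phi.
  rewrite /dfun -(intN (integ_bdm (bmeas_holderM hf) (integ_test sphi rphi))).
  by apply: int_ext => x; exact: mulNr.
have E b : \int[leb2]_x (co b (- V x) * pd b phi x) = - \int[leb2]_x (co b (V x) * pd b phi x).
  rewrite -(intN (integ_bdm (bV b) (integ_pd b sphi rphi))).
  by apply: int_ext => x; rewrite -mulNr; case: b.
have alg (d d' p p' q q' : R) : d' = - d -> p' = - p -> q' = - q ->
  - (d - (p + q)) = d' - (p' + q') by move=> -> -> ->; ring.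
exact: (alg _ _ _ _ _ _ E0 (E false) (E true)).
Qed.

(** A function is the curl of its velocity field: it loses one derivative when
    measured in the Hoelder scale, although it is not even continuous. *)
Lemma Crep_dfun : exists2 K, 0 <= K & forall rho N N1, integ rho -> (forall y, `|rho y| <= N) ->
  \int[leb2]_y `|rho y| <= N1 -> Crep (K * (N + N1)) (dfun rho).
Proof.
pose W := \int[leb2]_z @wsing R (1 + a) z + \int[leb2]_z @wsing R 1 z.
have W0 : 0 <= W by apply: addr_ge0; apply: int_ge0 => z; exact: wsing_ge0.
have m0 := mass_gt0 R; have mi : 0 < (mass R)^-1 by rewrite invr_gt0.
exists ((mass R)^-1 * (4 * (W + 1))).
  by rewrite mulr_ge0 ?(ltW mi)// mulr_ge0// addr_ge0.
move=> rho N N1 irho rhoN rho1; set K := (mass R)^-1 * _ * _.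
have N0 : 0 <= N by exact: le_trans (rhoN 0).
have N10 : 0 <= N1 by apply: le_trans rho1; exact: int_ge0.
have hv j : holderM a K (fun x => (mass R)^-1 * vel rho j x).
  have := holderMZ (mass R)^-1 (vel_holderM irho rhoN j a0 a1); rewrite -/W gtr0_norm//.
  apply: holderMW; rewrite /K -mulrA ler_wpM2l ?(ltW mi)// -mulrA ler_wpM2l//.
  rewrite -/W; have := mulr_ge0 W0 N10; lra.
pose V x : plane R := ((mass R)^-1 * vel rho true x, - ((mass R)^-1 * vel rho false x)).
have hV b : holderM a K (fun x => co b (V x)) by case: b; [exact: holderMN|exact: hv].
exists (fun=> 0), V; split=> //.
  apply: holderMW (@holderM_cst R a 0); rewrite normr0; exact: holderM_ge0 (hv true).
apply/deqE => phi r sphi rphi; rewrite /Defs.dadd (ddivE (fun b => bmeas_holderM (hV b)) sphi rphi).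
have -> : dfun (fun=> 0) phi = 0.
  by rewrite -[RHS](@int0 R); apply: int_ext => x; rewrite mul0r.
have iv j b := integ_velM irho rhoN j (integ_pd b sphi rphi).
have E0 : \int[leb2]_x (co false (V x) * pd false phi x) =
    (mass R)^-1 * \int[leb2]_x (vel rho true x * pd false phi x).
  by rewrite -(intZ _ (iv true false)); apply: int_ext => x; rewrite mulrA.
have E1 : \int[leb2]_x (co true (V x) * pd true phi x) =
    - (mass R)^-1 * \int[leb2]_x (vel rho false x * pd true phi x).
  by rewrite -(intZ _ (iv false true)); apply: int_ext => x; rewrite /V /co /=; ring.
have curl := vel_curl irho rhoN sphi rphi.
have alg (d c m p q p' q' : R) : m != 0 -> p - q = m * d -> q' = m^-1 * q -> p' = - m^-1 * p ->
    d = 0 + - (q' + p').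
  move=> mn H -> ->; have -> : p = m * d + q by rewrite -H subrK.
  by field.
exact: (alg _ 0 _ _ _ _ _ (lt0r_neq0 m0) curl E0 E1).
Qed.

End DivergenceForm.

(** * Bounds on the truncated velocity gradient *)

Section GradientBounds.
Variable R : realType.
Notation leb2 := (@leb2 R).
Implicit Types (x y z : plane R) (b i j l : bool) (e h : R) (f phi : plane R -> R)
  (Y V : plane R -> plane R).
Variables (a C : R).
Hypotheses (a0 : 0 < a) (a1 : a < 1) (C0 : 0 < C) (KB : @kernel_bounds R C).

Let W1 := \int[leb2]_z @wsing R (2 - a) z.

Lemma integ_dlk_refl e i j x : 0 < e <= 1 -> integ (fun y => dlk e i j (x - y)).
Proof.
move=> e01; have c : csupp 1 (dlk e i j) by exact: csupp_dlk.
exact: integ_test (smooth_refl x (@smooth_dlk R e i j)) (csupp_refl (x := x) c).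
Qed.

Lemma int_dlk_refl e i j x : 0 < e <= 1 -> \int[leb2]_y dlk e i j (x - y) = 0.
Proof.
move=> e01; rewrite (int_reflect x) ?int_dlk//.
by apply: (integ_test (@smooth_dlk R e i j)); exact: csupp_dlk.
Qed.

Lemma integ_cv_dlk e i j x f : 0 < e <= 1 -> bmeas f -> integ (fun y => dlk e i j (x - y) * f y).
Proof.
move=> e01 bf; apply: (eq_integ (f := fun y => f y * dlk e i j (x - y))).
  by move=> y; exact: mulrC.
by apply: integ_bdm => //; exact: integ_dlk_refl.
Qed.

Lemma bmeas_bound rho : bmeas rho -> exists2 N, 0 <= N & forall y : plane R, `|rho y| <= N.
Proof. by move=> [_ [N rN]]; exists N => //; exact: le_trans (rN 0). Qed.

(** The commutator is what separates the derivative of the velocity along a vector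
    field from the divergence of vorticity times vector field. *)
Lemma split_comm i j (F rho : plane R -> R) M e x : holderM a M F -> bmeas rho -> 0 < e <= 1 ->
  F x * cv (dlk e i j) rho x =
  kcomm i j F rho e x + cv (dlk e i j) (fun y => rho y * F y) x.
Proof.
move=> hF brho e01; have M0 := holderM_ge0 hF; have [N N0 rN] := bmeas_bound brho.
have i1 := integ_kcomm a0 a1 C0 KB i j x M0 (proj2 hF) (proj1 brho) rN e01.
have i2 := integ_cv_dlk i j x e01 (bmeasM brho (bmeas_holderM a0 hF)).
have i3 := integ_cv_dlk i j x e01 brho.
have -> : kcomm i j F rho e x = \int[leb2]_y ((F x - F y) * (dlk e i j (x - y) * rho y)) by [].
rewrite /cv -(intD i1 i2) -(intZ _ i3); apply: int_ext => y; ring.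
Qed.

Lemma cv_dlk1 e i j x : 0 < e <= 1 -> cv (dlk e i j) (fun=> 1) x = 0.
Proof.
move=> e01; rewrite -[RHS](int_dlk_refl i j x e01); apply: int_ext => y; exact: mulr1.
Qed.

(** The truncated kernel has zero mean, hence the convolution of [F] is its
    commutator with the constant 1. *)
Lemma cv_dlk_comm i j (F : plane R -> R) M e x : holderM a M F -> 0 < e <= 1 ->
  cv (dlk e i j) F x = - kcomm i j F (fun=> 1) e x.
Proof.
move=> hF e01; have := split_comm i j x hF (bmeas_cst 1) e01.
rewrite cv_dlk1// mulr0 => /esym/eqP; rewrite addrC addr_eq0 => /eqP <-.
by apply: int_ext => y; rewrite mul1r.
Qed.

(** These numbers are all that the proof retains of the divergence of [V], see
    [ddiv_lk]. *)
Definition divk V e j x : R :=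
  cv (dlk e false j) (fun y => co false (V y)) x + cv (dlk e true j) (fun y => co true (V y)) x.

Lemma ddiv_lk V e j x : (forall b, bmeas (fun y => co b (V y))) -> 0 < e <= 1 ->
  ddiv V (fun y => lk e j (x - y)) = divk V e j x.
Proof.
move=> bV e01; have := ddiv_refl x bV (@smooth_lk R e j) (@csupp_lk R e j e01).
by rewrite !pd_lk.
Qed.

Section Vorticity.
Variables (om : plane R -> R) (N : R).
Hypotheses (iom : integ om) (omN : forall y, `|om y| <= N).

Let N0 : 0 <= N. Proof. exact: le_trans (normr_ge0 _) (omN 0). Qed.
Let bom : bmeas om. Proof. exact: bmeas_integ iom omN. Qed.

Definition scalv Y x : plane R := (om x * (Y x).1, om x * (Y x).2).

Lemma co_scalv Y b x : co b (scalv Y x) = om x * co b (Y x).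
Proof. by case: b. Qed.

Lemma bmeas_scalv Y M : (forall b, holderM a M (fun x => co b (Y x))) ->
  forall b, bmeas (fun x => co b (scalv Y x)).
Proof.
move=> hY b; have := bmeasM bom (bmeas_holderM a0 (hY b)).
by rewrite (_ : (fun x => co b (scalv Y x)) = (fun x => om x * co b (Y x)))//; apply/funext => x; rewrite co_scalv.
Qed.

(** The derivative along [Y] of the velocity, restricted to the scales between [e]
    and 1. *)
Definition dirgrad Y e j x : R :=
  co false (Y x) * grade om e false j x + co true (Y x) * grade om e true j x.

Lemma dirgradE Y M e j x : (forall b, holderM a M (fun x => co b (Y x))) -> 0 < e <= 1 ->
  dirgrad Y e j x =
    kcomm false j (fun x => co false (Y x)) om e x
    + kcomm true j (fun x => co true (Y x)) om e x + divk (scalv Y) e j x.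
Proof.
move=> hY e01; rewrite /dirgrad /grade /divk.
rewrite (split_comm false j x (hY false) bom e01) (split_comm true j x (hY true) bom e01).
by rewrite addrACA.
Qed.

Lemma grade_div e x : 0 < e <= 1 -> grade om e false false x + grade om e true true x = 0.
Proof.
move=> e01; rewrite /grade /cv.
rewrite -(intD (integ_cv_dlk false false x e01 bom) (integ_cv_dlk true true x e01 bom)).
rewrite -[RHS](@int0 R); apply: int_ext => y.
by rewrite -mulrDl div_lk mul0r.
Qed.

Lemma integ_deta e : 0 < e <= 1 -> integ (@deta R e).
Proof. by move=> e01; apply: (integ_test (@smooth_deta R e)); exact: csupp_deta. Qed.

Lemma int_norm_deta e : 0 < e <= 1 -> \int[leb2]_z `|deta e z| <= 2 * mass R.
Proof.
move=> /[dup] e01 /andP[e0 e1].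
have i1 := integ_etae e0; have i2 := @integ_eta R.
apply: (@le_trans _ _ (\int[leb2]_z (etae e z + eta z))).
  apply: int_le => [||z]; [exact: integ_norm (integ_deta e01)|exact: integD|].
  by apply: le_trans (ler_normB _ _) _; rewrite !ger0_norm ?etae_ge0 ?eta_ge0.
by rewrite (intD i1 i2) (int_etae e0) -/(mass R) mulr2n mulrDl mul1r.
Qed.

Lemma cv_deta_bound e x f B : 0 < e <= 1 -> measurable_fun setT f -> (forall y, `|f y| <= B) ->
  `|cv (deta e) f x| <= B * (2 * mass R).
Proof.
move=> e01 mf fB; have B0 : 0 <= B by exact: le_trans (fB 0).
have id := integ_deta e01.
have [||y|_ I] := @conv_le R (fun y => deta e (x - y) * f y) (fun z => `|deta e z|) x B.
- apply: measurable_funM => //; apply: measurable_reflect; exact: integ_measurable id.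
- exact: integ_norm.
- by rewrite normrM mulrC ler_wpM2r.
by apply: le_trans I _; rewrite ler_wpM2l// int_norm_deta.
Qed.

Lemma grade_curl e x : 0 < e <= 1 ->
  `|grade om e false true x - grade om e true false x| <= N * (2 * mass R).
Proof.
move=> e01; rewrite /grade /cv.
rewrite -(intB (integ_cv_dlk false true x e01 bom) (integ_cv_dlk true false x e01 bom)).
have -> : \int[leb2]_y (dlk e false true (x - y) * om y - dlk e true false (x - y) * om y) =
    cv (deta e) om x by apply: int_ext => y; rewrite -mulrBl curl_lk.
exact: cv_deta_bound (proj1 bom) omN.
Qed.

(** A matrix with zero trace and given antisymmetric part has two degrees of
    freedom, and these are determined by its action in one direction. *)
Lemma grade_of_dirgrad Y c B e x : 0 < c -> c <= enorm (Y x) -> 0 < e <= 1 ->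
  (forall j, `|dirgrad Y e j x| <= B) ->
  forall i j, `|grade om e i j x| <= 2 * B / c + 2 * (N * (2 * mass R)).
Proof.
move=> c0 cY e01 hB.
suff [] : [/\ `|grade om e false false x| <= 2 * B / c + 2 * (N * (2 * mass R)),
    `|grade om e true true x| <= 2 * B / c + 2 * (N * (2 * mass R)),
    `|grade om e false true x| <= 2 * B / c + 2 * (N * (2 * mass R)) &
    `|grade om e true false x| <= 2 * B / c + 2 * (N * (2 * mass R))] by move=> ? ? ? ? [] [].
have := grade_div x e01; have := grade_curl x e01; have := hB true; have := hB false.
rewrite /dirgrad; set D0 := N * _.
move: (grade om e false false x) (grade om e true true x)
  (grade om e false true x) (grade om e true false x) => p p' q' q Hf Ht Hc.
rewrite addrC => /eqP; rewrite addr_eq0 => /eqP pp; subst p'.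
have D00 : 0 <= D0 by exact: le_trans Hc.
have B0 : 0 <= B by exact: le_trans Hf.
set m := enorm (Y x) in cY; have m0 : 0 < m by exact: lt_le_trans cY.
have mB : B / m <= B / c by rewrite ler_wpM2l// lef_pV2.
have y1 := co_le_enorm false (Y x); have y2 := co_le_enorm true (Y x).
have msq : co false (Y x) ^+ 2 + co true (Y x) ^+ 2 = m ^+ 2 by rewrite sqr_enorm.
move: y1 y2 msq Hf Ht; rewrite -/m; move: (co false (Y x)) (co true (Y x)) => y1 y2.
move=> hy1 hy2 msq Hf Ht.
pose D := q' - q; have qD : q' = q + D by rewrite /D; ring.
set bf := y1 * p + y2 * q in Hf; set bt := y1 * q' + y2 * (- p) in Ht.
have m2 : m ^+ 2 != 0 by rewrite sqrf_eq0 gt_eqF.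
have pE : p = (y1 * bf - y2 * (bt - y1 * D)) / m ^+ 2.
  apply: (mulIf m2); rewrite mulfVK// -msq /bf /bt qD; ring.
have qE : q = (y2 * bf + y1 * (bt - y1 * D)) / m ^+ 2.
  apply: (mulIf m2); rewrite mulfVK// -msq /bf /bt qD; ring.
have bnd (s t : R) : `|s| <= m -> `|t| <= m -> 
    `|(s * bf + t * (bt - y1 * D)) / m ^+ 2| <= 2 * B / c + D0.
  move=> sm tm; rewrite normrM [X in _ * X]ger0_norm ?invr_ge0 ?sqr_ge0//.
  rewrite ler_pdivrMr ?exprn_gt0//.
  apply: (@le_trans _ _ (m * B + m * (B + m * D0))).
    apply: le_trans (ler_normD _ _) _; rewrite !normrM; apply: lerD; first exact: ler_pM.
    apply: ler_pM => //; apply: le_trans (ler_normB _ _) _; apply: lerD => //.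
    by rewrite normrM; apply: ler_pM.
  have -> : m * B + m * (B + m * D0) = (2 * (B / m) + D0) * m ^+ 2 by field; rewrite gt_eqF.
  by rewrite ler_wpM2r ?sqr_ge0// lerD2r -mulrA ler_wpM2l.
have Hp : `|p| <= 2 * B / c + D0.
  by rewrite pE -mulNr; apply: bnd => //; rewrite normrN.
have Hq : `|q| <= 2 * B / c + D0 by rewrite qE; exact: bnd.
have Hq' : `|q'| <= 2 * B / c + D0 + D0.
  by rewrite qD; apply: le_trans (ler_normD _ _) _; exact: lerD.
rewrite normrN; split; lra.
Qed.

End Vorticity.
End GradientBounds.

Section MoreGradientBounds.
Variable R : realType.
Notation leb2 := (@leb2 R).
Implicit Types (x y z : plane R) (b i j l : bool) (e h : R) (f phi : plane R -> R)
  (Y V : plane R -> plane R).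

Lemma pd_scaled c s f i z : smooth f ->
  pd i (fun z => c * f (s *: z)) z = c * (s * pd i f (s *: z)).
Proof.
move=> sf; have -> : (fun z => c * f (s *: z)) = (fun z => c * f (0 + s *: z)).
  by apply/funext => y; rewrite add0r.
rewrite pdZ; last by apply: smooth_derivable; exact: smooth_affine.
by rewrite pd_affine ?add0r//; exact: smooth_derivable.
Qed.

(** The first moment of the gradient of [deta e] is bounded by scaling. *)
Lemma moment_deta : exists2 Th, 0 <= Th & forall e i, 0 < e <= 1 ->
  integ (fun z => enorm z * `|pd i (@deta R e) z|) /\
  \int[leb2]_z (enorm z * `|pd i (@deta R e) z|) <= Th.
Proof.
pose w i z := enorm z * `|pd i (@eta R) z|.
have iw i : integ (w i).
  apply: (@integ_csupp _ _ 1).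
    move=> z; apply: cvgM; first exact: continuous_enorm.
    have := smooth_continuous (smooth_pd i (@smooth_eta R)) (x := z).
    exact: cvg_norm.
  by move=> z z1; rewrite /w (csupp_pd i (@csupp_eta R) z1) normr0 mulr0.
have w0 i z : 0 <= w i z by rewrite mulr_ge0// enorm_ge0.
have I0 i : 0 <= \int[leb2]_z w i z by exact: int_ge0.
exists (2 * (\int[leb2]_z w false z + \int[leb2]_z w true z)).
  by rewrite mulr_ge0// addr_ge0.
move=> e i /[dup] e01 /andP[e0 e1].
have ei : 0 < e^-1 by rewrite invr_gt0.
have eq0 : e^-1 != 0 by rewrite gt_eqF.
have iwe : integ (fun z => w i (e^-1 *: z)).
  by have := integ_affine 0 eq0 (iw i); apply: eq_integ => z; rewrite add0r.
have Ie : \int[leb2]_z w i (e^-1 *: z) = e ^+ 2 * \int[leb2]_z w i z.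
  have := int_affine 0 eq0 (iw i); rewrite gtr0_norm// invrK => <-.
  by apply: int_ext => z; rewrite add0r.
have isum := integD (integZ (e^-1 ^+ 2) iwe) (iw i).
have sd : smooth (pd i (@deta R e)) by apply: smooth_pd; exact: smooth_deta.
have dom z : `|enorm z * `|pd i (@deta R e) z| | <= e^-1 ^+ 2 * w i (e^-1 *: z) + w i z.
  rewrite ger0_norm ?mulr_ge0 ?enorm_ge0//.
  have -> : pd i (@deta R e) z = e^-1 ^+ 2 * (e^-1 * pd i (@eta R) (e^-1 *: z)) - pd i (@eta R) z.
    apply: etrans (pdB i z (@smooth_etae R e) (@smooth_eta R)) _.
    by apply: (congr1 (fun t : R => t - pd i (@eta R) z)); exact: pd_scaled (@smooth_eta R).
  apply: le_trans (ler_wpM2l (enorm_ge0 z) (ler_normB _ _)) _.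
  rewrite mulrDr lerD2r /w enormZ (gtr0_norm ei).
  move: (sqr_ge0 e^-1); move: (e^-1 ^+ 2) => s2 s20.
  rewrite !normrM (gtr0_norm ei) (ger0_norm s20).
  by rewrite le_eqVlt; apply/orP; left; apply/eqP; ring.
have mf : measurable_fun setT (fun z => enorm z * `|pd i (@deta R e) z|).
  apply: measurable_funM; first exact: measurable_enorm.
  by apply: measurableT_comp => //; apply: continuous_measurable_plane; exact: smooth_continuous.
split; first exact: integ_le mf dom isum.
have iF := integ_le mf dom isum.
have dom' z : enorm z * `|pd i (@deta R e) z| <= e^-1 ^+ 2 * w i (e^-1 *: z) + w i z.
  exact: le_trans (ler_norm _) (dom z).
apply: le_trans (int_le iF isum dom') _.
have E := intD (integZ (e^-1 ^+ 2) iwe) (iw i).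
have E1 := intZ (e^-1 ^+ 2) iwe.
have alg (s p q r v : R) : s = p + q -> p = e^-1 ^+ 2 * r -> r = e ^+ 2 * q ->
    q <= v -> 0 <= v -> s <= 2 * v.
  move=> -> -> -> qv v0; have -> : e^-1 ^+ 2 * (e ^+ 2 * q) = q by field; rewrite gt_eqF.
  by rewrite mulr2n mulrDl mul1r; exact: lerD.
apply: (alg _ _ _ _ _ E E1 Ie); last exact: addr_ge0.
by case: (i); [rewrite lerDr|rewrite lerDl].
Qed.

Variables (a C : R).
Hypotheses (a0 : 0 < a) (a1 : a < 1) (C0 : 0 < C) (KB : @kernel_bounds R C).
Variables (om : plane R -> R) (N : R).
Hypotheses (iom : integ om) (omN : forall y, `|om y| <= N).

(** The gradient of the velocity is tested with the gradient of a bump. After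
    subtracting the values at [x], the increments of the velocity, which is
    Hoelder of exponent [1 - a], and of [Y], Hoelder of exponent [a], compensate
    the derivative; the other terms are controlled by the hypotheses. *)
Lemma dirgrad_of_dgrad M Mg B : exists K, forall Y g f e j x,
  (forall b, holderM a M (fun x => co b (Y x))) ->
  bmeas g -> (forall x, `|g x| <= Mg) -> is_div Y g ->
  bmeas f -> (forall x, `|f x| <= B) -> deq (dgrad Y g (vel om j)) (dfun f) ->
  0 < e <= 1 -> `|dirgrad om Y e j x| <= K.
Proof.
have [Th Th0 hTh] := moment_deta.
have a'0 : 0 < 1 - a by rewrite subr_gt0.
have a'1 : 1 - a < 1 by rewrite gtrBl.
pose U := 4 * (N * (\int[leb2]_z wsing (1 + (1 - a)) z + \int[leb2]_z wsing 1 z)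
             + \int[leb2]_y `|om y|).
have hU j : holderM (1 - a) U (vel om j) by exact: vel_holderM.
have U0 := holderM_ge0 (hU true).
pose m2 := 2 * mass R.
have m2_0 : 0 <= m2 by rewrite mulr_ge0// ltW// mass_gt0.
exists ((mass R)^-1 * (B * m2 + U * Mg * m2 + U * (Mg * m2) + 2 * (U * M * Th))).
move=> Y g f e j x hY bg gM dY bf fB dg e01.
set u := vel om j in dg *; have hu := hU j; rewrite -/u in hu.
have bu : bmeas u by exact: bmeas_holderM hu.
have bY b := bmeas_holderM a0 (hY b).
have M0 := holderM_ge0 (hY true).
have sd := @smooth_deta R e; have cd := csupp_deta (R := R) e01.
have sr := smooth_refl x sd; have cr := csupp_refl (x := x) cd.
pose D i y := pd i (@deta R e) (x - y).
have iD f' i : bmeas f' -> integ (fun y => D i y * f' y).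
  by move=> bf'; exact: integ_refl_test bf' (smooth_pd i sd) (csupp_pd i cd).
have buY b : bmeas (fun y => u y * co b (Y y)) by exact: bmeasM.
have co_uY b : (fun y => co b (scalv u Y y)) = (fun y => u y * co b (Y y)).
  by apply/funext => y; rewrite co_scalv.
have buY' b : bmeas (fun y => co b (scalv u Y y)) by rewrite co_uY.
(* the two weak identities, tested with a reflected bump *)
have id1 : cv (pd false (deta e)) (fun y => u y * co false (Y y)) x +
    cv (pd true (deta e)) (fun y => u y * co true (Y y)) x =
    cv (deta e) f x + cv (deta e) (fun y => u y * g y) x.
  have E := ddiv_refl x buY' sd cd; rewrite (co_uY false) (co_uY true) in E.
  have T := (deqE _ _).1 dg _ _ sr cr; rewrite -E.
  have E1 : dfun f (fun y => deta e (x - y)) = cv (deta e) f x.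
    by apply: int_ext => y; exact: mulrC.
  have E2 : dfun (fun y => u y * g y) (fun y => deta e (x - y)) = cv (deta e) (fun y => u y * g y) x.
    by apply: int_ext => y; exact: mulrC.
  by rewrite -E1 -E2 -T /dgrad /Defs.dsub subrK.
have id2 : cv (pd false (deta e)) (fun y => co false (Y y)) x +
    cv (pd true (deta e)) (fun y => co true (Y y)) x = cv (deta e) g x.
  have E := ddiv_refl x bY sd cd; have T := (deqE _ _).1 dY _ _ sr cr; rewrite -E T.
  by apply: int_ext => y; exact: mulrC.
pose T i := \int[leb2]_y ((u y - u x) * (co i (Y y) - co i (Y x)) * D i y).
have T_E i : mass R * (co i (Y x) * grade om e i j x) =
    cv (pd i (deta e)) (fun y => u y * co i (Y y)) x
    - u x * cv (pd i (deta e)) (fun y => co i (Y y)) x - T i.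
  have i1 := iD _ i (buY i); have i2 := iD _ i (bY i); have i3 := iD _ i bu.
  have i4 := iD _ i (@bmeas_cst R 1).
  have z4 : \int[leb2]_y (D i y * 1) = 0.
    have ipd := integ_pd i sd cd.
    rewrite -[RHS](@int_pd_eq0 R i (deta e) 1).
    - by rewrite -(int_reflect x ipd); apply: int_ext => y; rewrite mulr1.
    - exact: smooth_continuous.
    - by move=> y; exact: smooth_derivable.
    - by apply: smooth_continuous; exact: smooth_pd.
    - exact: cd.
  have TE : T i = \int[leb2]_y (D i y * (u y * co i (Y y))) - u x * \int[leb2]_y (D i y * co i (Y y))
      - co i (Y x) * \int[leb2]_y (D i y * u y) + u x * co i (Y x) * \int[leb2]_y (D i y * 1).
    rewrite -(intZ (u x) i2) -(intZ (co i (Y x)) i3) -(intZ (u x * co i (Y x)) i4).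
    have j2 := integZ (u x) i2; have j3 := integZ (co i (Y x)) i3.
    have j4 := integZ (u x * co i (Y x)) i4.
    rewrite -(intB i1 j2) -(intB (integB i1 j2) j3) -(intD (integB (integB i1 j2) j3) j4).
    have alg (p q s c d : R) : (p - c) * (q - d) * s =
        s * (p * q) - c * (s * q) - d * (s * p) + c * d * (s * 1) by ring.
    apply: int_ext => y; exact: alg.
  rewrite mulrCA (gradeE iom omN i j x e01) TE z4.
  have -> : cv (pd i (deta e)) (vel om j) x = \int[leb2]_y (D i y * u y) by [].
  have alg (A B' Q c d : R) : c * Q = A - d * B' - (A - d * B' - c * Q + d * c * 0) by ring.
  exact: alg.
have TB i : `|T i| <= U * M * Th.
  have [iw Iw] := hTh e i e01.
  have [||y|_ I] := @conv_le R (fun y => (u y - u x) * (co i (Y y) - co i (Y x)) * D i y)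
      (fun z => enorm z * `|pd i (@deta R e) z|) x (U * M).
  - apply: measurable_funM.
      by apply: measurable_funM; apply: measurable_funB => //; [exact: (proj1 bu)|exact: (proj1 (bY i))].
    apply: measurable_reflect; apply: continuous_measurable_plane.
    by apply: smooth_continuous; exact: smooth_pd.
  - exact: iw.
  - rewrite !normrM mulrA; apply: ler_wpM2r => //.
    have h1 := (proj2 hu) y x; have h2 := (proj2 (hY i)) y x.
    apply: le_trans (ler_pM (normr_ge0 _) (normr_ge0 _) h1 h2) _.
    rewrite enorm_distC; move: (enorm_ge0 (x - y)); rewrite le_eqVlt => /orP[/eqP <-|t0].
      by rewrite !powR0 ?gt_eqF// !mulr0.
    have -> : U * enorm (x - y) `^ (1 - a) * (M * enorm (x - y) `^ a) =
      U * M * (enorm (x - y) `^ (1 - a) * enorm (x - y) `^ a) by ring.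
    rewrite -powRD ?(gt_eqF t0) ?implybT//.
    by rewrite subrK powRr1 ?(ltW t0).
  by apply: le_trans I _; rewrite ler_wpM2l// mulr_ge0.
have b1 : `|cv (deta e) f x| <= B * m2 by exact: cv_deta_bound (proj1 bf) fB.
have b2 : `|cv (deta e) (fun y => u y * g y) x| <= U * Mg * m2.
  apply: cv_deta_bound => //; first exact: measurable_funM (proj1 bu) (proj1 bg).
  by move=> y; rewrite normrM; apply: ler_pM => //; exact: (proj1 hu).
have b3 : `|u x * cv (deta e) g x| <= U * (Mg * m2).
  rewrite normrM; apply: ler_pM => //; first exact: (proj1 hu).
  exact: cv_deta_bound (proj1 bg) gM.
have key : mass R * dirgrad om Y e j x =
    cv (deta e) f x + cv (deta e) (fun y => u y * g y) x - u x * cv (deta e) g x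
    - (T false + T true).
  have alg (m p q A A' F G H E E' ux t t' : R) : m * p = A - ux * E - t ->
      m * q = A' - ux * E' - t' -> A + A' = F + G -> E + E' = H ->
      m * (p + q) = F + G - ux * H - (t + t').
    by move=> e1 e2 <- <-; rewrite mulrDr e1 e2; ring.
  exact: (alg _ _ _ _ _ _ _ _ _ _ _ _ _ (T_E false) (T_E true) id1 id2).
have m0 := mass_gt0 R.
rewrite ler_pdivlMl// -[X in X * _](gtr0_norm m0) -normrM key.
have t1 := TB false; have t2 := TB true.
apply: le_trans (ler_normB _ _) _; apply: lerD.
  apply: le_trans (ler_normB _ _) _; apply: lerD => //.
  by apply: le_trans (ler_normD _ _) _; exact: lerD.
have alg (s t q : R) : `|s| <= q -> `|t| <= q -> `|s + t| <= 2 * q.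
  by move=> h1 h2; apply: le_trans (ler_normD _ _) _; rewrite mulr2n mulrDl mul1r; exact: lerD.
have e2 : 2 * (U * M * Th) = 2 * U * M * Th by ring.
by have := alg _ _ _ t1 t2; rewrite e2 !mulrA.
Qed.

(** The integrand may be truncated to the interval from [- g] to [g]. *)
Lemma norm_int_le_ae f g : measurable_fun setT f -> {ae leb2, forall x, `|f x| <= g x} ->
  (forall x, 0 <= g x) -> integ g -> `|\int[leb2]_x f x| <= \int[leb2]_x g x.
Proof.
move=> mf fg g0 ig; have mg := integ_measurable ig.
pose f' x := Num.max (- g x) (Num.min (f x) (g x)).
have mf' : measurable_fun setT f'.
  apply: measurable_maxr; last exact: measurable_minr.
  exact: measurableT_comp.
rewrite (@int_eq_ae R f f') //.
  apply: norm_int_le => // x; rewrite /f' ler_norml le_max lexx/= ge_max ge_min lexx orbT andbT.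
  by have := g0 x; lra.
apply: filterS fg => x; rewrite ler_norml /f' => /andP[h1 h2].
by rewrite (min_idPl h2) (max_idPr h1).
Qed.

(** Where the vorticity is Hoelder, the kernel is integrated against the
    increments of the vorticity, since its scales have zero mean. *)
Lemma grade_smooth d M1 : 0 < d <= 1 -> exists K, forall (om' : plane R -> R) e i j x,
  {ae leb2, forall y, enorm (x - y) <= d -> `|om y - om' x| <= M1 * enorm (x - y) `^ a} ->
  0 <= M1 -> 0 < e <= 1 -> `|grade om e i j x| <= K.
Proof.
move=> /[dup] d01 /andP[d0 d1].
pose W1 := \int[leb2]_z @wsing R (2 - a) z.
have W10 : 0 <= W1 by apply: int_ge0 => z; exact: wsing_ge0.
pose N1 := \int[leb2]_y `|om y|.
have N10 : 0 <= N1 by exact: int_ge0.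
pose K1 := 2 * C * d^-1 ^+ 2 * N1.
pose K2 := M1 * (2 * C) * W1.
have [kb _ _] := KB.
have kC i j z : `|pd i (@kr R j) z| <= C.
  apply: le_trans (kb i j z); rewrite ler_peMr// exprn_ege1// lerDl; exact: enorm_ge0.
have bom : bmeas om by exact: bmeas_integ iom omN.
have big e i j x : d <= e -> 0 < e <= 1 -> `|grade om e i j x| <= K1.
  move=> de /[dup] e01 /andP[e0 e1].
  have di : e^-1 <= d^-1 by rewrite lef_pV2.
  have d2 : 1 <= d^-1 ^+ 2 by rewrite exprn_ege1// invf_ge1.
  have e2 : e^-1 ^+ 2 <= d^-1 ^+ 2 by rewrite lerXn2r ?nnegrE ?invr_ge0 ?(ltW e0) ?(ltW d0).
  have i1 := integ_cv_dlk i j x e01 bom.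
  have i2 := integZ (2 * C * d^-1 ^+ 2) (integ_norm iom).
  rewrite /K1 -(intZ _ (integ_norm iom)); apply: norm_int_le i2.
    exact: integ_measurable i1.
  move=> y; rewrite normrM ler_wpM2r// /dlk /dkre; apply: le_trans (ler_normB _ _) _.
  rewrite normrM (ger0_norm (sqr_ge0 _)).
  have h1 := kC i j (e^-1 *: (x - y)); have h2 := kC i j (x - y).
  have -> : 2 * C * d^-1 ^+ 2 = d^-1 ^+ 2 * C + d^-1 ^+ 2 * C by ring.
  apply: lerD; first exact: (ler_pM (sqr_ge0 _) (normr_ge0 _) e2 h1).
  apply: le_trans h2 _; rewrite ler_peMl// ltW//.
exists (K1 + K2) => om' e i j x hae M10 /[dup] e01 /andP[e0 e1].
have K20 : 0 <= K2 by rewrite !mulr_ge0// ltW.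
have [de|ed] := leP d e; first by apply: le_trans (big e i j x de e01) _; rewrite lerDl.
have alg (s t k1 k2 : R) : `|t| <= k1 -> `|s - t| <= k2 -> `|s| <= k1 + k2.
  move=> h1 h2; have -> : s = t + (s - t) by ring.
  by apply: le_trans (ler_normD _ _) _; exact: lerD.
apply: (alg _ (grade om d i j x)); first exact: big.
have i1 := integ_cv_dlk i j x e01 bom; have i2 := integ_cv_dlk i j x d01 bom.
have i3 := integZ (om' x) (integ_dlk_refl i j x e01).
have i4 := integZ (om' x) (integ_dlk_refl i j x d01).
pose G y := (dlk e i j (x - y) - dlk d i j (x - y)) * (om y - om' x).
have -> : grade om e i j x - grade om d i j x = \int[leb2]_y G y.
  have z3 : \int[leb2]_y (om' x * dlk e i j (x - y)) = 0.
    by rewrite (intZ _ (integ_dlk_refl i j x e01)) int_dlk_refl// mulr0.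
  have z4 : \int[leb2]_y (om' x * dlk d i j (x - y)) = 0.
    by rewrite (intZ _ (integ_dlk_refl i j x d01)) int_dlk_refl// mulr0.
  have E0 : \int[leb2]_y G y = \int[leb2]_y (dlk e i j (x - y) * om y - om' x * dlk e i j (x - y)
      - (dlk d i j (x - y) * om y - om' x * dlk d i j (x - y))).
    have alg1 (p q s t : R) : (p - q) * (s - t) = p * s - t * p - (q * s - t * q) by ring.
    apply: int_ext => y; exact: alg1.
  have alg2 (I p q p1 p2 q1 q2 : R) : I = p - q -> p = p1 - p2 -> q = q1 - q2 ->
      p2 = 0 -> q2 = 0 -> p1 - q1 = I by move=> -> -> -> -> ->; rewrite !subr0.
  exact: (alg2 _ _ _ _ _ _ _ (etrans E0 (intB (integB i1 i3) (integB i2 i4)))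
    (intB i1 i3) (intB i2 i4) z3 z4).
have di : d^-1 != 0 by rewrite gt_eqF ?invr_gt0.
have iw := integ_wsing_a a0 a1.
pose w z := d `^ (a - 2) * wsing (2 - a) (d^-1 *: z).
have iwd := integ_dilate d0 iw.
have iw2 : integ w by exact: integZ.
have Iw : \int[leb2]_z w z = d `^ a * W1.
  by rewrite /w (intZ _ iwd) wsing_scaled_int.
have w0 z : 0 <= w z by rewrite mulr_ge0 ?powR_ge0 ?wsing_ge0.
have iwr := integ_reflect x iw2.
have M2C : 0 <= M1 * (2 * C) by rewrite !mulr_ge0// ltW.
apply: (@le_trans _ _ (\int[leb2]_y (M1 * (2 * C) * w (x - y)))).
  apply: norm_int_le_ae.
  - have m1 e' : measurable_fun setT (fun y => dlk e' i j (x - y)).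
      apply: measurable_reflect; apply: continuous_measurable_plane.
      by apply: smooth_continuous; exact: smooth_dlk.
    apply: measurable_funM; first exact: measurable_funB.
    by apply: measurable_funB => //; exact: (proj1 bom).
  - apply: filterS hae => y hy; rewrite /G normrM.
    have sdE : dlk e i j (x - y) - dlk d i j (x - y) =
        scaled (pd i (kr j)) e (x - y) - scaled (pd i (kr j)) d (x - y).
      have alg3 (p q s : R) : p - s - (q - s) = p - q by ring.
      exact: alg3.
    rewrite sdE; have [xy|xy] := leP (enorm (x - y)) d; last first.
      rewrite (scaled_out (@hom_out_dkr R i j) e0 (ltW ed) d1 xy) subrr normr0 mul0r.
      exact: mulr_ge0.
    have sd := scaled_diff a0 C0 (kb i j) (@hom_out_dkr R i j) (x - y) e0 (ltW ed) d1.
    apply: le_trans (ler_wpM2l (normr_ge0 _) (hy xy)) _.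
    have -> : M1 * (2 * C) * w (x - y) =
      M1 * (2 * C * d `^ (a - 2) * wsing (2 - a) (d^-1 *: (x - y))) by rewrite /w; ring.
    by rewrite mulrCA ler_wpM2l// mulrC.
  - by move=> y; rewrite mulr_ge0.
  - exact: integZ.
rewrite (intZ _ iwr) (int_reflect x iw2) Iw mulrA /K2 -/W1; apply: ler_wpM2r => //.
have da1 : d `^ a <= 1 `^ a.
  by apply: ge0_ler_powR => //; rewrite ?nnegrE ?(ltW a0) ?(ltW d0).
by rewrite powR1 in da1; rewrite ler_piMr.
Qed.

End MoreGradientBounds.

(** * Equivalence of the two regularity properties *)

Section RegularizedDerivative.
Variable R : realType.
Notation leb2 := (@leb2 R).
Implicit Types (x y z : plane R) (b i j l : bool) (e h : R) (f phi : plane R -> R)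
  (Y V : plane R -> plane R).

Lemma bmeas_csupp f r : continuous f -> csupp r f -> bmeas f.
Proof.
move=> cf rf; split; first exact: continuous_measurable_plane.
by have [M _ fM] := csupp_bounded cf rf; exists M.
Qed.

Lemma bmeas_dlk e i j : 0 < e <= 1 -> bmeas (@dlk R e i j).
Proof.
by move=> e01; apply: (@bmeas_csupp _ 1); [apply: smooth_continuous; exact: smooth_dlk|exact: csupp_dlk].
Qed.

Lemma int_cv_bdm f rho phi : bmeas f -> integ rho -> integ phi ->
  [/\ integ (fun x => cv f rho x * phi x),
    integ (fun y => rho y * \int[leb2]_x (f (x - y) * phi x)) &
    \int[leb2]_x (cv f rho x * phi x) =
      \int[leb2]_y (rho y * \int[leb2]_x (f (x - y) * phi x))].
Proof. by move=> [mf [M fM]]; exact: int_cv. Qed.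

(** The truncated kernel is a gradient, and second derivatives commute. *)
Lemma dlk_swap e i j l phi r y : smooth phi -> csupp r phi ->
  \int[leb2]_x (dlk e i j (x - y) * pd l phi x) =
  \int[leb2]_x (dlk e l j (x - y) * pd i phi x).
Proof.
move=> sphi rphi; have sl := @smooth_lk R e j.
have A b c : \int[leb2]_x (lk e j (x - y) * pd b (pd c phi) x) =
    - \int[leb2]_x (dlk e b j (x - y) * pd c phi x).
  by have := int_conv_pd b y sl (smooth_pd c sphi) (csupp_pd c rphi); rewrite pd_lk.
have alg (p q p' q' : R) : p = - p' -> q = - q' -> p = q -> p' = q'.
  by move=> -> -> /oppr_inj.
apply: (alg _ _ _ _ (A i l) (A l i)); apply: int_ext => x.
by apply: (congr1 (fun t : R => lk e j (x - y) * t)); exact: schwarz.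
Qed.

(** The curl of the truncated kernels is [etae e - eta]: the first term gives back
    the test function in the limit, the second one is a smooth kernel. *)
Lemma curl_conv i (F : plane R -> R) phi r : integ F -> smooth phi -> csupp r phi ->
  exists D, forall e, 0 < e <= 1 ->
  `|\int[leb2]_x (cv (dlk e i false) F x * pd true phi x)
    - \int[leb2]_x (cv (dlk e i true) F x * pd false phi x)
    - (- (mass R * \int[leb2]_x (F x * pd i phi x))
       - \int[leb2]_x (cv (pd i (@eta R)) F x * phi x))| <= D * e.
Proof.
move=> iF sphi rphi.
have sp := smooth_pd i sphi; have cp := csupp_pd i rphi.
have [L L0 pL] := csupp_lip sp cp.
have ip b : integ (pd b phi) by exact: integ_pd sphi rphi.
have bp : bmeas (pd i phi) by apply: bmeas_csupp cp; exact: smooth_continuous.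
have seta := @smooth_eta R; have ceta := @csupp_eta R.
have beta : bmeas (@eta R) by apply: bmeas_csupp ceta; exact: smooth_continuous.
have bdeta : bmeas (pd i (@eta R)).
  by apply: (bmeas_csupp (r := 1)); [apply: smooth_continuous; exact: smooth_pd|exact: csupp_pd].
have iFp : integ (fun y => F y * pd i phi y).
  by apply: (eq_integ (f := fun y => pd i phi y * F y)) => [y|]; [exact: mulrC|exact: integ_bdm].
exists (L * mass R * \int[leb2]_y `|F y|) => e /[dup] e01 /andP[e0 e1].
have bet : bmeas (etae e).
  by apply: (bmeas_csupp (r := e)); [apply: smooth_continuous; exact: smooth_etae|exact: csupp_etae].
have [_ i1 E1] := int_cv_bdm (bmeas_dlk i false e01) iF (ip true).
have [_ i2 E2] := int_cv_bdm (bmeas_dlk i true e01) iF (ip false).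
have [_ i3 E3] := int_cv_bdm bdeta iF (integ_test sphi rphi).
have [_ i4 _] := int_cv_bdm bet iF (ip i).
have iphi f y : bmeas f -> integ (fun x => f (x - y) * pd i phi x).
  move=> [mf [K fK]]; apply: (@integM_bdd _ _ _ K) => //.
  by rewrite transE; exact: (measurableT_comp mf (measurable_affine (- y) 1)).
pose J y := \int[leb2]_x (etae e (x - y) * pd i phi x).
have point y : F y * \int[leb2]_x (dlk e i false (x - y) * pd true phi x)
    - F y * \int[leb2]_x (dlk e i true (x - y) * pd false phi x)
    + F y * \int[leb2]_x (pd i (@eta R) (x - y) * phi x) = - (F y * J y).
  have S1 := dlk_swap e i false true y sphi rphi.
  have S2 := dlk_swap e i true false y sphi rphi.
  have S3 := int_conv_pd i y seta sphi rphi.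
  have j1 := iphi _ y (bmeas_dlk true false e01); have j2 := iphi _ y (bmeas_dlk false true e01).
  have j3 := iphi _ y beta.
  have EJ : J y = \int[leb2]_x (dlk e false true (x - y) * pd i phi x)
      - \int[leb2]_x (dlk e true false (x - y) * pd i phi x) + \int[leb2]_x (eta (x - y) * pd i phi x).
    rewrite -(intB j2 j1) -(intD (integB j2 j1) j3); apply: int_ext => x.
    by rewrite -mulrBl curl_lk -mulrDl subrK.
  have alg (c p p' q q' s s' J0 : R) : p = p' -> q = q' -> s' = - s -> J0 = q' - p' + s' ->
      c * p - c * q + c * s = - (c * J0) by move=> -> -> -> ->; ring.
  exact: (alg _ _ _ _ _ _ _ _ S1 S2 S3 EJ).
have E5 : \int[leb2]_x (cv (dlk e i false) F x * pd true phi x)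
    - \int[leb2]_x (cv (dlk e i true) F x * pd false phi x)
    + \int[leb2]_x (cv (pd i (@eta R)) F x * phi x) = - \int[leb2]_y (F y * J y).
  have alg (A A' B B' D D' p q Q : R) : A = A' -> B = B' -> D = D' -> p = A' - B' -> q = p + D' -> 
    q = Q -> A - B + D = Q by move=> -> -> -> -> -> <-.
  apply: (alg _ _ _ _ _ _ _ _ _ E1 E2 E3 (intB i1 i2) (intD (integB i1 i2) i3)).
  by rewrite -(intN i4); apply: int_ext => y; exact: point.
have bnd y : `|mass R * (F y * pd i phi y) - F y * J y| <= (L * mass R * e) * `|F y|.
  have mo : `|J y - mass R * pd i phi y| <= L * e * mass R.
    apply: mollify => //; first exact: proj1 bp.
    by move=> z zy; apply: le_trans (pL z y) _; rewrite ler_wpM2l// ltW.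
  have -> : mass R * (F y * pd i phi y) - F y * J y = F y * - (J y - mass R * pd i phi y).
    by move: (J y) => Jy; ring.
  by rewrite normrM normrN mulrC; apply: ler_wpM2r => //; rewrite mulrAC.
have iM := integZ (mass R) iFp.
have fin := norm_int_le (integ_measurable (integB iM i4)) bnd (integZ (L * mass R * e) (integ_norm iF)).
have alg (A B D mF Fp FJ Q m c s : R) : A - B + D = - FJ -> mF = m * Fp -> Q = mF - FJ ->
    `|Q| <= c -> c = s -> `|A - B - (- (m * Fp) - D)| <= s.
  move=> H -> -> h <-; have -> : A - B - (- (m * Fp) - D) = (A - B + D) + m * Fp by ring.
  by rewrite H addrC.
apply: (alg _ _ _ _ _ _ _ _ _ _ E5 (intZ (mass R) iFp) (intB iM i4) fin).
by rewrite (intZ _ (integ_norm iF)) mulrAC.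
Qed.

(** A divergence can be recovered, up to a smooth convolution, as the curl of its
    values at the truncated kernels. *)
Lemma curl_divk V phi r : (forall b, bmeas (fun x => co b (V x))) ->
  (forall b, integ (fun x => co b (V x))) -> smooth phi -> csupp r phi ->
  exists D, forall e, 0 < e <= 1 ->
  `|\int[leb2]_x (divk V e false x * pd true phi x)
    - \int[leb2]_x (divk V e true x * pd false phi x)
    - (mass R * ddiv V phi
       - \int[leb2]_x ((cv (pd false (@eta R)) (fun y => co false (V y)) x
                        + cv (pd true (@eta R)) (fun y => co true (V y)) x) * phi x))| <= D * e.
Proof.
move=> bV iV sphi rphi.
have [D1 h1] := curl_conv false (iV false) sphi rphi.
have [D2 h2] := curl_conv true (iV true) sphi rphi.
have ip b : integ (pd b phi) by exact: integ_pd sphi rphi.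
have bdeta i : bmeas (pd i (@eta R)).
  apply: (bmeas_csupp (r := 1)); last by apply: csupp_pd; exact: csupp_eta.
  by apply: smooth_continuous; apply: smooth_pd; exact: smooth_eta.
have I3 i : integ (fun x => cv (pd i (@eta R)) (fun y => co i (V y)) x * phi x).
  by have [] := int_cv_bdm (bdeta i) (iV i) (integ_test sphi rphi).
exists (D1 + D2) => e e01.
have I i j l : integ (fun x => cv (dlk e i j) (fun y => co i (V y)) x * pd l phi x).
  by have [] := int_cv_bdm (bmeas_dlk i j e01) (iV i) (ip l).
have S j l : \int[leb2]_x (divk V e j x * pd l phi x) =
    \int[leb2]_x (cv (dlk e false j) (fun y => co false (V y)) x * pd l phi x)
    + \int[leb2]_x (cv (dlk e true j) (fun y => co true (V y)) x * pd l phi x).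
  by rewrite -(intD (I false j l) (I true j l)); apply: int_ext => x; exact: mulrDl.
have S3 : \int[leb2]_x ((cv (pd false (@eta R)) (fun y => co false (V y)) x
                        + cv (pd true (@eta R)) (fun y => co true (V y)) x) * phi x) =
    \int[leb2]_x (cv (pd false (@eta R)) (fun y => co false (V y)) x * phi x)
    + \int[leb2]_x (cv (pd true (@eta R)) (fun y => co true (V y)) x * phi x).
  by rewrite -(intD (I3 false) (I3 true)); apply: int_ext => x; exact: mulrDl.
have alg (A B T A1 A2 B1 B2 T1 T2 dV p q m s t : R) : A = A1 + A2 -> B = B1 + B2 -> T = T1 + T2 ->
    dV = - (p + q) -> `|A1 - B1 - (- (m * p) - T1)| <= s -> `|A2 - B2 - (- (m * q) - T2)| <= t ->
    `|A - B - (m * dV - T)| <= s + t.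
  move=> -> -> -> -> hs ht.
  have -> : A1 + A2 - (B1 + B2) - (m * - (p + q) - (T1 + T2)) =
     (A1 - B1 - (- (m * p) - T1)) + (A2 - B2 - (- (m * q) - T2)) by ring.
  by apply: le_trans (ler_normD _ _) _; exact: lerD.
rewrite mulrDl.
exact: (alg _ _ _ _ _ _ _ _ _ _ _ _ _ _ _ (S false true) (S true false) S3 (ddivE bV sphi rphi)
  (h1 e e01) (h2 e e01)).
Qed.

End RegularizedDerivative.

Section Equivalence.
Variable R : realType.
Notation leb2 := (@leb2 R).
Implicit Types (x y z : plane R) (b i j l : bool) (e h : R) (f phi : plane R -> R)
  (Y V : plane R -> plane R).
Variables (a C : R).
Hypotheses (a0 : 0 < a) (a1 : a < 1) (C0 : 0 < C) (KB : @kernel_bounds R C).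
Variables (om : plane R -> R) (N : R).
Hypotheses (iom : integ om) (omN : forall y, `|om y| <= N).

Let bom : bmeas om. Proof. exact: bmeas_integ iom omN. Qed.
Let N0 : 0 <= N. Proof. exact: le_trans (normr_ge0 _) (omN 0). Qed.

Definition regdir Y e j x : R :=
  co false (Y x) * cv (dkre e false j) om x + co true (Y x) * cv (dkre e true j) om x.

Definition dir1 Y j x : R :=
  co false (Y x) * cv (pd false (kr j)) om x + co true (Y x) * cv (pd true (kr j)) om x.

Let bdkr i j : bmeas (pd i (@kr R j)).
Proof.
have [kb _ _] := KB; split; last first.
  exists C => z; apply: le_trans (kb i j z); rewrite ler_peMr// exprn_ege1// lerDl; exact: enorm_ge0.
by apply: continuous_measurable_plane; apply: smooth_continuous; apply: smooth_pd; exact: smooth_kr.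
Qed.

Let bdkre e i j : bmeas (@dkre R e i j).
Proof.
split; last exact: dkre_bounded.
by apply: continuous_measurable_plane; apply: smooth_continuous; exact: smooth_dkre.
Qed.

Let bkre e j : bmeas (@kre R e j).
Proof.
split; last exact: kre_bounded.
by apply: continuous_measurable_plane; apply: smooth_continuous; exact: smooth_kre.
Qed.

Let icv f x : bmeas f -> integ (fun y => f (x - y) * om y).
Proof. by move=> [mf [M fM]]; apply: (@integM_bdd _ _ _ M) => //; exact: measurable_reflect. Qed.

Lemma regdirE Y e j x : 0 < e <= 1 -> regdir Y e j x = dir1 Y j x + dirgrad om Y e j x.
Proof.
move=> e01.
have E i : cv (dkre e i j) om x = cv (pd i (kr j)) om x + grade om e i j x.
  rewrite /grade /cv -(intD (icv x (bdkr i j)) (icv x (bmeas_dlk i j e01))).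
  have alg (p q w : R) : p * w = q * w + (p - q) * w by ring.
  by apply: int_ext => y; exact: alg.
have alg2 (c d p q p1 p2 q1 q2 : R) : p = p1 + p2 -> q = q1 + q2 ->
  c * p + d * q = c * p1 + d * q1 + (c * p2 + d * q2) by move=> -> ->; ring.
exact: (alg2 _ _ _ _ _ _ _ _ (E false) (E true)).
Qed.

(** By definition of the divergence of [Y], tested with the product of a kernel and
    the test function, the identity holds exactly for the regularized velocity. *)
Lemma regdir_weak Y g M j phi r : (forall b, holderM a M (fun x => co b (Y x))) ->
  bmeas g -> is_div Y g -> smooth phi -> csupp r phi ->
  (forall e, integ (fun x => regdir Y e j x * phi x)) /\
  exists D, forall e, 0 < e <= 1 ->
    `|\int[leb2]_x (regdir Y e j x * phi x) - dgrad Y g (vel om j) phi| <= D * e.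
Proof.
move=> hY bg dY sphi rphi; have bY b := bmeas_holderM a0 (hY b).
have ip := integ_test sphi rphi; have ipd b := integ_pd b sphi rphi.
have iYp b : integ (fun x => co b (Y x) * phi x) by exact: integ_bdm.
have iYd b : integ (fun x => co b (Y x) * pd b phi x) by exact: integ_bdm.
have igp : integ (fun x => g x * phi x) by exact: integ_bdm.
pose Phi x := co false (Y x) * pd false phi x + co true (Y x) * pd true phi x + g x * phi x.
have iPhi : integ Phi by apply: integD igp; exact: integD.
have iR e i : integ (fun x => cv (dkre e i j) om x * (co i (Y x) * phi x)).
  by have [] := int_cv_bdm (bdkre e i j) iom (iYp i).
have regE e x : regdir Y e j x * phi x =
    cv (dkre e false j) om x * (co false (Y x) * phi x)
    + cv (dkre e true j) om x * (co true (Y x) * phi x).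
  have alg (c d p q s : R) : (c * p + d * q) * s = p * (c * s) + q * (d * s) by ring.
  exact: alg.
split=> [e|].
  by apply: eq_integ (integD (iR e false) (iR e true)) => x; rewrite regE.
have [D _ hD] := int_vele_vel iom omN j iPhi; exists D => e e01.
have weakE : dgrad Y g (vel om j) phi = - \int[leb2]_x (vel om j x * Phi x).
  have iv f : integ f -> integ (fun x => vel om j x * f x) by exact: (integ_velM iom omN).
  have bv : bmeas (vel om j).
    by split; [exact: (measurable_vel iom omN)|eexists; exact: (vel_bound iom omN)].
  have bvY b : bmeas (fun x => co b (scalv (vel om j) Y x)).
    have := bmeasM bv (bY b).
    by rewrite (_ : (fun x => vel om j x * co b (Y x)) = (fun x => co b (scalv (vel om j) Y x)))//; apply/funext => x; rewrite co_scalv.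
  have E1 := ddivE bvY sphi rphi.
  have E2 b : \int[leb2]_x (co b (scalv (vel om j) Y x) * pd b phi x) =
      \int[leb2]_x (vel om j x * (co b (Y x) * pd b phi x)).
    by apply: int_ext => x; rewrite co_scalv; exact: esym (mulrA _ _ _).
  have E3 : \int[leb2]_x (vel om j x * g x * phi x) = \int[leb2]_x (vel om j x * (g x * phi x)).
    by apply: int_ext => x; exact: esym (mulrA _ _ _).
  have E4 := intD (integD (iv _ (iYd false)) (iv _ (iYd true))) (iv _ igp).
  have E5 := intD (iv _ (iYd false)) (iv _ (iYd true)).
  have E6 : \int[leb2]_x (vel om j x * Phi x) = \int[leb2]_x
      (vel om j x * (co false (Y x) * pd false phi x) + vel om j x * (co true (Y x) * pd true phi x)
       + vel om j x * (g x * phi x)).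
    have alg (c p q s : R) : c * (p + q + s) = c * p + c * q + c * s by ring.
    by apply: int_ext => x; exact: alg.
  have alg (dv A B A' B' G G' I S T : R) : dv = - (A + B) -> A = A' -> B = B' -> G = G' ->
     I = S -> S = T + G' -> T = A' + B' -> dv - G = - I.
    by move=> -> -> -> -> -> -> ->; ring.
  exact: (alg _ _ _ _ _ _ _ _ _ _ E1 (E2 false) (E2 true) E3 E6 E4 E5).
have [_ i1 E1] := int_cv_bdm (bdkre e false j) iom (iYp false).
have [_ i2 E2] := int_cv_bdm (bdkre e true j) iom (iYp true).
have [_ i3 E3] := int_cv_bdm (bkre e j) iom iPhi.
have sk y : smooth (fun x => kre e j (x - y)) by apply: smooth_trans; exact: smooth_kre.
have bk f y : bmeas f -> bmeas (fun x => f (x - y)).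
  move=> [mf fM]; split; first by rewrite transE; exact: (measurableT_comp mf (measurable_affine (- y) 1)).
  by have [K fK] := fM; exists K.
have point y : \int[leb2]_x (dkre e false j (x - y) * (co false (Y x) * phi x))
    + \int[leb2]_x (dkre e true j (x - y) * (co true (Y x) * phi x))
    = - \int[leb2]_x (kre e j (x - y) * Phi x).
  pose psi x := kre e j (x - y) * phi x.
  have spsi : smooth psi by exact: smoothM.
  have cpsi : csupp r psi by exact: csuppM.
  have T := (deqE _ _).1 dY _ _ spsi cpsi; rewrite (ddivE bY spsi cpsi) in T.
  have pdpsi b x : pd b psi x = kre e j (x - y) * pd b phi x + phi x * dkre e b j (x - y).
    apply: etrans (pdM _ _) _; [exact: smooth_derivable|exact: smooth_derivable|].
    apply: (congr1 (fun t : R => kre e j (x - y) * pd b phi x + phi x * t)).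
    by rewrite (pd_trans b y x (@smooth_kre R e j)) pd_kre.
  have j1 b := integ_bdm (bk _ y (bkre e j)) (iYd b).
  have j2 b := integ_bdm (bk _ y (bdkre e b j)) (iYp b).
  have j3 := integ_bdm (bk _ y (bkre e j)) igp.
  have S b : \int[leb2]_x (co b (Y x) * pd b psi x) =
      \int[leb2]_x (kre e j (x - y) * (co b (Y x) * pd b phi x))
      + \int[leb2]_x (dkre e b j (x - y) * (co b (Y x) * phi x)).
    rewrite -(intD (j1 b) (j2 b)); apply: int_ext => x.
    have alg (c k p s d : R) : c * (k * p + s * d) = k * (c * p) + d * (c * s) by ring.
    exact: etrans (congr1 (fun t : R => co b (Y x) * t) (pdpsi b x)) (alg _ _ _ _ _).
  have S3 : \int[leb2]_x (kre e j (x - y) * Phi x) =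
     \int[leb2]_x (kre e j (x - y) * (co false (Y x) * pd false phi x))
     + \int[leb2]_x (kre e j (x - y) * (co true (Y x) * pd true phi x))
     + \int[leb2]_x (kre e j (x - y) * (g x * phi x)).
    rewrite -(intD (j1 false) (j1 true)) -(intD (integD (j1 false) (j1 true)) j3).
    by apply: int_ext => x; rewrite -!mulrDr.
  have S4 : dfun g psi = \int[leb2]_x (kre e j (x - y) * (g x * phi x)).
    by apply: int_ext => x; exact: mulrCA.
  have alg (A B p q p' q' w gw I : R) : - (A + B) = gw -> A = p + p' -> B = q + q' ->
      gw = w -> I = p + q + w -> p' + q' = - I.
    by move=> <- -> -> <- ->; ring.
  exact: (alg _ _ _ _ _ _ _ _ _ T (S false) (S true) S4 S3).
have key : \int[leb2]_x (regdir Y e j x * phi x) = - \int[leb2]_x (vele om e j x * Phi x).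
  have E4 : \int[leb2]_x (regdir Y e j x * phi x) = 
      \int[leb2]_x (cv (dkre e false j) om x * (co false (Y x) * phi x))
      + \int[leb2]_x (cv (dkre e true j) om x * (co true (Y x) * phi x)).
    by rewrite -(intD (iR e false) (iR e true)); apply: int_ext => x; exact: regE.
  have E5 : \int[leb2]_y (om y * \int[leb2]_x (dkre e false j (x - y) * (co false (Y x) * phi x))
      + om y * \int[leb2]_x (dkre e true j (x - y) * (co true (Y x) * phi x))) =
      - \int[leb2]_y (om y * \int[leb2]_x (kre e j (x - y) * Phi x)).
    by rewrite -(intN i3); apply: int_ext => y; rewrite -mulrDr point mulrN.
  have alg (A p q p' q' S T T' : R) : A = p + q -> p = p' -> q = q' -> S = p' + q' -> S = - T' ->
      T = T' -> A = - T by move=> -> -> -> <- -> ->.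
  exact: (alg _ _ _ _ _ _ _ _ E4 E1 E2 (intD i1 i2) E5 E3).
have alg (v w : R) : - v - - w = - (v - w) by ring.
by rewrite key weakE alg normrN; exact: hD.
Qed.

Lemma hfam_ext K (F G : R -> plane R -> R) :
  (forall e x, 0 < e <= 1 -> F e x = G e x) -> hfam a K F -> hfam a K G.
Proof.
move=> FG [h1 h2]; split=> [e e01|e h x e0 eh hh1].
  by rewrite (_ : G e = F e); [exact: h1|apply/funext => x; rewrite FG].
by rewrite -!FG ?e0 ?(le_trans eh)// ?hh1 ?(lt_le_trans e0)//; exact: h2.
Qed.


(** Tested with the kernels, the function part gives a convolution with an
    integrable kernel and the divergence part gives commutators. *)
Lemma divk_hfam B : exists K, forall V f v j, (forall b, bmeas (fun y => co b (V y))) ->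
  holderM a B f -> (forall b, holderM a B (fun x => co b (v x))) ->
  deq (ddiv V) (Defs.dadd (dfun f) (ddiv v)) -> hfam a K (fun e => divk V e j).
Proof.
pose K1 := 2 * (B * (2 * C) * \int[leb2]_z @wsing R 1 z).
pose K2 := Kcomm a C B 1 0.
exists (K1 + (K2 + K2)) => V f v j bV hf hv dV.
have B0 := holderM_ge0 hf.
have hc i : hfam a K2 (kcomm i j (fun x => co i (v x)) (fun=> 1)).
  apply: (hfam_comm a0 a1 C0 KB (i := i) (j := j) B0 (proj2 (hv i))) => //.
  - by move=> y; rewrite normr1.
  - by move=> h z h01; rewrite (cv_dlk1 i j z h01) normr0.
apply: hfam_ext (hfamD (hfam_lk a0 a1 C0 KB j hf) (hfamN (hfamD (hc false) (hc true)))).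
move=> e x e01; rewrite -(ddiv_lk j x bV e01).
have sl := smooth_refl x (@smooth_lk R e j); have cl := csupp_refl (x := x) (@csupp_lk R e j e01).
have E := (deqE _ _).1 dV _ _ sl cl.
have E1 : dfun f (fun y => lk e j (x - y)) = cv (lk e j) f x by apply: int_ext => y; exact: mulrC.
have E2 := ddiv_lk j x (fun b => bmeas_holderM a0 (hv b)) e01.
have E3 i := cv_dlk_comm a0 a1 C0 KB i j x (hv i) e01.
have alg (T p q p' q' A A' : R) : T = A' + (p' + q') -> A' = A -> p' = - p -> q' = - q ->
  A + - (p + q) = T by move=> -> -> -> ->; rewrite -opprD.
exact: (alg _ _ _ _ _ _ _ (etrans E (congr1 (fun t : R => _ + t) E2)) E1 (E3 false) (E3 true)).
Qed.

Lemma dirgrad_of_divk M B : exists K, forall Y e j x,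
  (forall b, holderM a M (fun x => co b (Y x))) -> 0 < e <= 1 ->
  `|divk (scalv om Y) e j x| <= B -> `|dirgrad om Y e j x| <= K.
Proof.
pose K1 := M * N * (2 * C) * \int[leb2]_z @wsing R (2 - a) z.
exists (K1 + K1 + B) => Y e j x hY e01 hB; have [kb _ _] := KB.
have M0 := holderM_ge0 (hY true).
rewrite (dirgradE a0 a1 C0 KB iom omN j x hY e01).
have ck i : continuous (pd i (@kr R j)).
  by apply: smooth_continuous; apply: smooth_pd; exact: smooth_kr.
have h i := comm_bound a0 a1 C0 (ck i) (kb i j) (@hom_out_dkr R i j) (proj2 (hY i)) M0
  (proj1 bom) omN x e01.
apply: le_trans (ler_normD _ _) _; apply: lerD => //.
by apply: le_trans (ler_normD _ _) _; apply: lerD; exact: h.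
Qed.

(** What [regdir] contains besides the values [divk] of the divergence; it is
    Hoelder as soon as the truncated velocity gradient is bounded. *)
Definition rest Y j e x : R := dir1 Y j x +
  (kcomm false j (fun x => co false (Y x)) om e x + kcomm true j (fun x => co true (Y x)) om e x).

Lemma regdir_rest Y M e j x : (forall b, holderM a M (fun x => co b (Y x))) -> 0 < e <= 1 ->
  regdir Y e j x = rest Y j e x + divk (scalv om Y) e j x.
Proof.
move=> hY e01; rewrite (regdirE Y j x e01) (dirgradE a0 a1 C0 KB iom omN j x hY e01).
exact: addrA.
Qed.

Lemma rest_hfam M P : exists K, forall Y j,
  (forall b, holderM a M (fun x => co b (Y x))) ->
  (forall e i l x, 0 < e <= 1 -> `|grade om e i l x| <= P) -> hfam a K (rest Y j).
Proof.
pose K1 := 2 * (M * (2 * (C * \int[leb2]_y `|om y|))).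
pose K2 := Kcomm a C M N P.
exists (K1 + K1 + (K2 + K2)) => Y j hY hP; have [kb kl _] := KB.
have M0 := holderM_ge0 (hY true).
apply: hfamD.
  apply: hfam_cst => //.
  have h i : holderM a K1 (fun x => co i (Y x) * cv (pd i (kr j)) om x).
    apply: holderMM (hY i) _; apply: cv_lip => //; first exact: ltW.
    - by apply: smooth_continuous; apply: smooth_pd; exact: smooth_kr.
    - move=> z; apply: le_trans (kb i j z).
      by rewrite ler_peMr// exprn_ege1// lerDl; exact: enorm_ge0.
    - move=> z y zy; apply: le_trans (kl i j z y zy).
      by rewrite ler_peMr// exprn_ege1// lerDl; exact: enorm_ge0.
  exact: holderMD (h false) (h true).
have hc i : hfam a K2 (kcomm i j (fun x => co i (Y x)) om).
  apply: (hfam_comm a0 a1 C0 KB (i := i) (j := j) M0 (proj2 (hY i)) (proj1 bom) omN).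
  by move=> h z h01; exact: hP.
exact: hfamD.
Qed.

Lemma int_close (F G psi : plane R -> R) (c : R) : bmeas F -> bmeas G -> integ psi ->
  (forall x, `|F x - G x| <= c) ->
  `|\int[leb2]_x (F x * psi x) - \int[leb2]_x (G x * psi x)| <= c * \int[leb2]_x `|psi x|.
Proof.
move=> bF bG ip FG; have i1 := integ_bdm bF ip; have i2 := integ_bdm bG ip.
rewrite -(intB i1 i2) -(intZ _ (integ_norm ip)).
apply: norm_int_le (integZ c (integ_norm ip)); first exact: integ_measurable (integB i1 i2).
by move=> x; rewrite -mulrBl normrM ler_wpM2r.
Qed.

Lemma small_powR (X : R -> R) D : (forall e, 0 < e <= 1 -> `|X e| <= D * e) ->
  forall e, 0 < e <= 1 -> `|X e| <= D * e `^ a.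
Proof.
move=> h e e01; have D0 : 0 <= D.
  by have := h 1; rewrite ltr01 lexx mulr1 => /(_ isT); exact: le_trans.
apply: le_trans (h e e01) _; apply: ler_wpM2l => //.
by apply: ger1_powR; [exact: e01|exact: ltW].
Qed.

(** Regularity of the divergence passes to the directional derivative of the
    velocity, which is the limit of [regdir]. *)
Lemma dgrad_of_div M B P : exists K, forall Y g f v j,
  (forall b, holderM a M (fun x => co b (Y x))) -> bmeas g -> is_div Y g ->
  holderM a B f -> (forall b, holderM a B (fun x => co b (v x))) ->
  deq (div_scal om Y) (Defs.dadd (dfun f) (ddiv v)) ->
  (forall e i l x, 0 < e <= 1 -> `|grade om e i l x| <= P) ->
  exists2 G, holderM a K G & deq (dgrad Y g (vel om j)) (dfun G).
Proof.
have [K1 h1] := divk_hfam B; have [K2 h2] := rest_hfam M P.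
exists (4 * (K2 + K1)) => Y g f v j hY bg dY hf hv dV hP.
have bV := bmeas_scalv a0 iom omN hY.
have H : hfam a (K2 + K1) (fun e => regdir Y e j).
  apply: hfam_ext (hfamD (h2 Y j hY hP) (h1 _ _ _ j bV hf hv dV)) => e x e01.
  by rewrite (regdir_rest j x hY e01).
have [G [hG cG]] := hfam_limit a0 H; exists G; first exact: hG.
apply/deqE => phi r sphi rphi.
have ip := integ_test sphi rphi.
have [_ [D hD]] := regdir_weak j hY bg dY sphi rphi.
have bG := bmeas_holderM a0 hG.
apply: (@eq_of_small_powR _ _ _ (D + (K2 + K1) * \int[leb2]_x `|phi x|) a) => // e e01.
have d1 := small_powR hD e01.
have d2 := int_close (bmeas_holderM a0 (proj1 H e e01)) bG ip (fun x => cG e x e01).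
have alg (I T G' s t w : R) : `|I - T| <= s * w -> `|I - G'| <= t * w -> `|T - G'| <= (s + t) * w.
  move=> u1 u2; have -> : T - G' = - (I - T) + (I - G') by ring.
  by apply: le_trans (ler_normD _ _) _; rewrite normrN mulrDl; exact: lerD.
apply: (alg _ _ _ _ _ _ d1); apply: le_trans d2 _.
by rewrite mulrAC.
Qed.

(** Conversely, the limit of [divk] is known up to Hoelder terms, and the curl
    of the truncated kernels recovers the divergence from it. *)
Lemma div_of_dgrad M B P : exists K, forall Y g (f : bool -> plane R -> R),
  (forall b, holderM a M (fun x => co b (Y x))) -> bmeas g -> is_div Y g ->
  (forall j, holderM a B (f j)) -> (forall j, deq (dgrad Y g (vel om j)) (dfun (f j))) ->
  (forall e i l x, 0 < e <= 1 -> `|grade om e i l x| <= P) -> Crep a K (div_scal om Y).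
Proof.
have [K2 h2] := rest_hfam M P.
pose N1 := \int[leb2]_y `|om y|; have N10 : 0 <= N1 by exact: int_ge0.
have [C1 C10 hC1] : exists2 C1, 0 < C1 & forall i : bool,
    (forall z, `|pd i (@eta R) z| <= C1) /\
    (forall z y, `|pd i (@eta R) z - pd i (@eta R) y| <= C1 * enorm (z - y)).
  apply: bool_bound => [i c c' cc' [t1 t2]|i].
    split=> [z|z y]; first exact: le_trans (t1 z) cc'.
    by apply: le_trans (t2 z y) _; rewrite ler_wpM2r ?enorm_ge0.
  have sd := smooth_pd i (@smooth_eta R); have cd := csupp_pd i (@csupp_eta R).
  have [c1 c10 t1] := csupp_bounded (smooth_continuous sd) cd; have [c2 c20 t2] := csupp_lip sd cd.
  exists (c1 + c2); first exact: addr_gt0.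
  split=> [z|z y]; first by apply: le_trans (t1 z) _; rewrite lerDl ltW.
  by apply: le_trans (t2 z y) _; rewrite ler_wpM2r ?enorm_ge0// lerDr ltW.
have m0 := mass_gt0 R; have mi : 0 < (mass R)^-1 by rewrite invr_gt0.
pose K3 := 2 * (C1 * (M * N1)).
exists ((mass R)^-1 * (K3 + K3) + (mass R)^-1 * (B + 4 * K2)) => Y g f hY bg dY hf df hP.
have M0 := holderM_ge0 (hY true).
have H j := h2 Y j hY hP.
pose G0 j := projT1 (cid (hfam_limit a0 (H j))).
have hG0 j : holderM a (4 * K2) (G0 j) /\
    (forall e x, 0 < e <= 1 -> `|rest Y j e x - G0 j x| <= K2 * e `^ a).
  exact: (projT2 (cid (hfam_limit a0 (H j)))).
pose V0 j x : R := f j x - G0 j x.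
have hV0 j : holderM a (B + 4 * K2) (V0 j).
  by have := holderMD (hf j) (holderMN (proj1 (hG0 j))).
have bV0 j := bmeas_holderM a0 (hV0 j).
have bV := bmeas_scalv a0 iom omN hY.
have iV b : integ (fun x => co b (scalv om Y x)).
  have := integ_bdm (bmeas_holderM a0 (hY b)) iom; apply: eq_integ => x.
  by rewrite co_scalv mulrC.
pose Th x : R := cv (pd false (@eta R)) (fun y => co false (scalv om Y y)) x
                 + cv (pd true (@eta R)) (fun y => co true (scalv om Y y)) x.
have hTh : holderM a (K3 + K3) Th.
  have h i : holderM a K3 (cv (pd i (@eta R)) (fun y => co i (scalv om Y y))).
    have [t1 t2] := hC1 i.
    have ce : continuous (pd i (@eta R)).
      by apply: smooth_continuous; apply: smooth_pd; exact: smooth_eta.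
    apply: holderMW (cv_lip a0 a1 (ltW C10) ce t1 (fun z y _ => t2 z y) (iV i)).
    rewrite /K3 ler_wpM2l// ler_wpM2l ?(ltW C10)//.
    rewrite /N1 -(intZ _ (integ_norm iom)); apply: int_le.
    - exact: integ_norm (iV i).
    - exact: integZ (integ_norm iom).
    - by move=> y; rewrite co_scalv normrM mulrC ler_wpM2r//; exact: (proj1 (hY i)).
  exact: holderMD (h false) (h true).
have weak j psi r : smooth psi -> csupp r psi -> exists D, forall e, 0 < e <= 1 ->
    `|\int[leb2]_x (divk (scalv om Y) e j x * psi x) - \int[leb2]_x (V0 j x * psi x)| <= D * e `^ a.
  move=> sp rp; have ip := integ_test sp rp.
  have [ireg [D hD]] := regdir_weak j hY bg dY sp rp.
  exists (D + K2 * \int[leb2]_x `|psi x|) => e e01.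
  have d1 := small_powR hD e01; rewrite ((deqE _ _).1 (df j) _ _ sp rp) in d1.
  have bre := bmeas_holderM a0 (proj1 (H j) e e01).
  have bG := bmeas_holderM a0 (proj1 (hG0 j)).
  have d2 := int_close bre bG ip (fun x => proj2 (hG0 j) e x e01).
  have E1 : \int[leb2]_x (divk (scalv om Y) e j x * psi x) =
      \int[leb2]_x (regdir Y e j x * psi x) - \int[leb2]_x (rest Y j e x * psi x).
    rewrite -(intB (ireg e) (integ_bdm bre ip)); apply: int_ext => x.
    have alg (p q d s : R) : p = q + d -> d * s = p * s - q * s by move=> ->; ring.
    exact: alg (regdir_rest j x hY e01).
  have E2 : \int[leb2]_x (V0 j x * psi x) =
      \int[leb2]_x (f j x * psi x) - \int[leb2]_x (G0 j x * psi x).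
    rewrite -(intB (integ_bdm (bmeas_holderM a0 (hf j)) ip) (integ_bdm bG ip)).
    by apply: int_ext => x; exact: mulrBl.
  have alg (I J A B' F G s t w : R) : I = A - B' -> J = F - G -> `|A - F| <= s * w ->
      `|B' - G| <= t * w -> `|I - J| <= (s + t) * w.
    move=> -> -> u1 u2; have -> : A - B' - (F - G) = (A - F) + - (B' - G) by ring.
    by apply: le_trans (ler_normD _ _) _; rewrite normrN mulrDl; exact: lerD.
  by apply: (alg _ _ _ _ _ _ _ _ _ E1 E2 d1); apply: le_trans d2 _; rewrite mulrAC.
pose v x : plane R := ((mass R)^-1 * V0 true x, - ((mass R)^-1 * V0 false x)).
have hv b : holderM a ((mass R)^-1 * (B + 4 * K2)) (fun x => co b (v x)).
  have h j : holderM a ((mass R)^-1 * (B + 4 * K2)) (fun x => (mass R)^-1 * V0 j x).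
    by have := holderMZ (mass R)^-1 (hV0 j); rewrite gtr0_norm.
  by case: b; [exact: holderMN (h false)|exact: h].
have hf0 : holderM a ((mass R)^-1 * (K3 + K3)) (fun x => (mass R)^-1 * Th x).
  by have := holderMZ (mass R)^-1 hTh; rewrite gtr0_norm.
exists (fun x => (mass R)^-1 * Th x), v; split.
- by apply: holderMW hf0; rewrite lerDl (holderM_ge0 (hv true)).
- by move=> b; apply: holderMW (hv b); rewrite lerDr (holderM_ge0 hf0).
apply/deqE => phi r sphi rphi.
have ip := integ_test sphi rphi; have ipd b := integ_pd b sphi rphi.
have [D hD] := curl_divk bV iV sphi rphi.
have [D1 hD1] := weak false _ _ (smooth_pd true sphi) (csupp_pd true rphi).
have [D2 hD2] := weak true _ _ (smooth_pd false sphi) (csupp_pd false rphi).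
have lim : \int[leb2]_x (V0 false x * pd true phi x) - \int[leb2]_x (V0 true x * pd false phi x)
    = mass R * ddiv (scalv om Y) phi - \int[leb2]_x (Th x * phi x).
  apply: (@eq_of_small_powR _ _ _ (D1 + D2 + D) a) => // e e01.
  have d := small_powR hD e01.
  rewrite !mulrDl; apply: dist_sub d _ _.
    exact: hD1.
  exact: hD2.
have iV0 j b := integ_bdm (bV0 j) (ipd b).
have iTh := integ_bdm (bmeas_holderM a0 hTh) ip.
have E0 : dfun (fun x => (mass R)^-1 * Th x) phi = (mass R)^-1 * \int[leb2]_x (Th x * phi x).
  by rewrite -(intZ _ iTh); apply: int_ext => x; exact: esym (mulrA _ _ _).
have E1 : \int[leb2]_x (co false (v x) * pd false phi x) =
    (mass R)^-1 * \int[leb2]_x (V0 true x * pd false phi x).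
  by rewrite -(intZ _ (iV0 true false)); apply: int_ext => x; exact: esym (mulrA _ _ _).
have E2 : \int[leb2]_x (co true (v x) * pd true phi x) =
    - (mass R)^-1 * \int[leb2]_x (V0 false x * pd true phi x).
  rewrite -(intZ _ (iV0 false true)); apply: int_ext => x.
  have alg (m p q : R) : - (m * p) * q = - m * (p * q) by ring.
  exact: alg.
have alg (m p q T dv F p' q' : R) : m != 0 -> p - q = m * dv - T -> F = m^-1 * T ->
    q' = m^-1 * q -> p' = - m^-1 * p -> dv = F + - (q' + p').
  move=> mn L -> -> ->; have -> : p = m * dv - T + q by rewrite -L subrK.
  by field.
rewrite /Defs.dadd (ddivE (fun b => bmeas_holderM a0 (hv b)) sphi rphi).
exact: (alg _ _ _ _ _ _ _ _ (lt0r_neq0 m0) lim E0 E1 E2).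
Qed.

End Equivalence.

(** * The norms of the statement *)

Section Norms.
Variable R : realType.
Notation leb2 := (@leb2 R).
Implicit Types (x y z : plane R) (f : plane R -> R) (U : set (plane R)).

Lemma leb2_setT_gt0 : (0 < leb2 setT)%E.
Proof.
have mB : measurable (`[0, 1]%classic `*` `[0, 1]%classic : set (plane R)) by exact: measurableX.
apply: (@lt_le_trans _ _ (leb2 (`[0, 1]%classic `*` `[0, 1]%classic))).
  by rewrite leb2X//= !lebesgue_measure_itv/= lte_fin ltr01 sube0 mul1e.
by apply: le_measure; rewrite ?inE//.
Qed.

(** The point is found in a unit square at [x], which has positive measure. *)
Lemma ae_near_point (P : plane R -> Prop) x : {ae leb2, forall y, P y} ->
  exists2 y, enorm (x - y) <= 2 & P y.
Proof.
move=> [A [mA A0 PA]].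
pose B : set (plane R) := `[x.1, x.1 + 1]%classic `*` `[x.2, x.2 + 1]%classic.
have mB : measurable B by exact: measurableX.
apply: contrapT => H.
have BA : B `<=` A.
  move=> y [/=]; rewrite !in_itv/= => /andP[h1 h2] /andP[h3 h4]; apply: PA => /= Py.
  apply: H; exists y => //; apply: le_trans (enorm_le_coords _) _ => /=.
  by rewrite !ler0_norm ?subr_le0//; lra.
have : (leb2 B <= leb2 A)%E by apply: le_measure; rewrite ?inE.
rewrite A0 /B leb2X// !lebesgue_measure_itv/= !lte_fin !ltrDl ltr01 -!EFinD.
by rewrite [_ - x.1]addrAC subrr [_ - x.2]addrAC subrr add0r mule1 lee_fin ler10.
Qed.

Lemma Linfty_ae f M : ('N[leb2]_+oo [EFin \o f] <= M%:E)%E ->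
  {ae leb2, forall x, `|f x| <= M}.
Proof.
rewrite unlock leb2_setT_gt0 => /ess_supP; apply: filterS => x.
by rewrite /= lee_fin.
Qed.

Lemma Linfty_le f M : (forall x, `|f x| <= M) -> ('N[leb2]_+oo [EFin \o f] <= M%:E)%E.
Proof.
move=> h; rewrite unlock leb2_setT_gt0; apply/ess_supP.
by apply: aeW => x; rewrite /= lee_fin.
Qed.

Section HolderNorm.
Variables (V : zmodType) (N : V -> R) (a : R).
Hypotheses (a0 : 0 < a) (a1 : a < 1).
Hypotheses (N0 : N 0 = 0) (Nge0 : forall v, 0 <= N v).
Hypothesis (Ntri : forall v w, N v <= N w + N (v - w)).
Implicit Types (g : plane R -> V).

Let sup_ge0 U g := (maxe 0 (ereal_sup
     [set (N (g p.1 - g p.2) / enorm (p.1 - p.2) `^ a)%:E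
        | p in [set p : plane R * plane R |
                 [/\ p.1 \in U, p.2 \in U & p.1 <> p.2]]]))%E.

Lemma holder_norm_ge0 U g : (0 <= holder_norm N a U g)%E.
Proof. by apply: adde_ge0; [exact: Lnorm_ge0|rewrite le_max lexx]. Qed.

Lemma holder_norm_lip U g M x y : (holder_norm N a U g <= M%:E)%E -> U x -> U y ->
  N (g x - g y) <= M * enorm (x - y) `^ a.
Proof.
move=> h Ux Uy.
have M0 : 0 <= M by rewrite -lee_fin; exact: le_trans (holder_norm_ge0 U g) h.
have [->|xy] := eqVneq x y; first by rewrite subrr N0 mulr_ge0// powR_ge0.
have p0 : 0 < enorm (x - y) `^ a by rewrite powR_gt0// enorm_gt0// subr_eq0.
rewrite -ler_pdivrMr// -lee_fin.
apply: le_trans h; apply: (@le_trans _ _ (sup_ge0 U g)); last first.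
  by rewrite /holder_norm leeDr// Lnorm_ge0.
rewrite /sup_ge0 le_max; apply/orP; right; apply: ereal_sup_ubound.
exists (x, y) => //=; split; [exact: mem_set|exact: mem_set|exact/eqP].
Qed.

(** The essential supremum bounds the function at some point near [x], and the
    Hoelder seminorm does the rest. *)
Lemma holder_norm_bound g M x : (holder_norm N a setT g <= M%:E)%E -> N (g x) <= 3 * M.
Proof.
move=> h.
have M0 : 0 <= M by rewrite -lee_fin; exact: le_trans (holder_norm_ge0 setT g) h.
have h1 : ('N[leb2]_+oo [EFin \o ((N \o g) \_ setT)] <= M%:E)%E.
  by apply: le_trans h; rewrite /holder_norm leeDl// le_max lexx.
rewrite patch_setT in h1.
have [y xy gy] := ae_near_point x (Linfty_ae h1).
apply: le_trans (Ntri _ (g y)) _.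
have l := holder_norm_lip h (I : setT x) (I : setT y).
have y1 : N (g y) <= M by rewrite -(ger0_norm (Nge0 (g y))).
have p2 : enorm (x - y) `^ a <= 2.
  apply: (@le_trans _ _ (2 `^ a)).
    by apply: ge0_ler_powR; rewrite ?nnegrE ?enorm_ge0 ?(ltW a0).
  by rewrite -[leRHS](@powRr1 _ 2)//; apply: ler_powR; [rewrite ler1n|exact: ltW].
have := ler_wpM2l M0 p2; lra.
Qed.

Lemma holder_norm_le g M : (forall x, N (g x) <= M) ->
  (forall x y, N (g x - g y) <= M * enorm (x - y) `^ a) ->
  (holder_norm N a setT g <= (2 * M)%:E)%E.
Proof.
move=> h1 h2; have M0 : 0 <= M by exact: le_trans (h1 0).
rewrite mulr2n mulrDl mul1r EFinD /holder_norm; apply: leeD.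
  rewrite patch_setT; apply: Linfty_le => x /=; rewrite ger0_norm//.
rewrite ge_max lee_fin M0/=; apply: ge_ereal_sup => _ [[x y] /= [_ _ xy]] <-.
rewrite lee_fin ler_pdivrMr//; apply: powR_gt0; apply: enorm_gt0; rewrite subr_eq0; exact/eqP.
Qed.

End HolderNorm.

Variable a : R.
Hypotheses (a0 : 0 < a) (a1 : a < 1).

Lemma Ca_norm_holderM f M : (Ca_norm a setT f <= M%:E)%E -> holderM a (3 * M) f.
Proof.
have tri (v w : R) : `|v| <= `|w| + `|v - w|.
  by apply: le_trans (ler_normD _ _); rewrite addrC subrK.
move=> h; have n0 : `|0 : R| = 0 by exact: normr0.
have M0 : 0 <= M by rewrite -lee_fin; apply: le_trans h; exact: holder_norm_ge0.
split=> [x|x y]; first exact: (holder_norm_bound a0 a1 n0 (@normr_ge0 _ _) tri x h).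
apply: le_trans (holder_norm_lip n0 h (I : setT x) (I : setT y)) _.
by rewrite ler_wpM2r ?powR_ge0//; lra.
Qed.

Lemma holderM_Ca_norm f M : holderM a M f -> (Ca_norm a setT f <= (2 * M)%:E)%E.
Proof. by move=> [h1 h2]; apply: holder_norm_le. Qed.

Lemma Cav_norm_holderM (Y : plane R -> plane R) M b : (Cav_norm a setT Y <= M%:E)%E ->
  holderM a (3 * M) (fun x => co b (Y x)).
Proof.
move=> h.
have M0 : 0 <= M by rewrite -lee_fin; apply: le_trans h; exact: holder_norm_ge0.
split=> [x|x y].
  apply: le_trans (co_le_enorm _ _) _.
  exact: (holder_norm_bound a0 a1 (enorm0 R) (@enorm_ge0 R) (@ler_enorm_dist R) x h).
have -> : co b (Y x) - co b (Y y) = co b (Y x - Y y) by case: b.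
apply: le_trans (co_le_enorm _ _) _.
apply: le_trans (holder_norm_lip (enorm0 R) h (I : setT x) (I : setT y)) _.
by rewrite ler_wpM2r ?powR_ge0//; lra.
Qed.

Lemma holderM_Cav_norm (Y : plane R -> plane R) M :
  (forall b, holderM a M (fun x => co b (Y x))) -> (Cav_norm a setT Y <= (4 * M)%:E)%E.
Proof.
move=> h; have [h1 h2] := h false; have [h3 h4] := h true.
have -> : 4 * M = 2 * (2 * M) by ring.
apply: holder_norm_le => [|x|x y]; first exact: enorm_ge0.
  apply: le_trans (enorm_le_coords _) _; have := h1 x; have := h3 x; rewrite /co; lra.
apply: le_trans (enorm_le_coords _) _; have := h2 x y; have := h4 x y; rewrite /co.
rewrite -[(Y x - Y y).1]/((Y x).1 - (Y y).1) -[(Y x - Y y).2]/((Y x).2 - (Y y).2).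
rewrite -mulrA; lra.
Qed.

Lemma lt_pinfty_real (t : \bar R) : (t < +oo)%E -> exists M : R, (t <= M%:E)%E.
Proof. by case: t => [r _|//|_]; [exists r|exists 0; rewrite leNye]. Qed.

Lemma Crep_deq K S (T : distr R) : deq S T -> Crep a K S -> Crep a K T.
Proof.
move=> ST [f [v [hf hv dS]]]; exists f, v; split=> // phi tphi.
by rewrite -ST// dS.
Qed.

Lemma in_Cam1P (T : distr R) : in_Cam1 a T <-> exists K, Crep a K T.
Proof.
split=> [[[f v] /= [hf hv dT]]|[K [f [v [hf hv dT]]]]].
  have [M1 h1] := lt_pinfty_real hf; have [M2 h2] := lt_pinfty_real hv.
  have k1 := Ca_norm_holderM h1; have k2 b := Cav_norm_holderM b h2.
  exists (3 * M1 + 3 * M2), f, v; split=> //.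
    by apply: holderMW k1; rewrite lerDl (holderM_ge0 (k2 true)).
  by move=> b; apply: holderMW (k2 b); rewrite lerDr (holderM_ge0 k1).
exists (f, v); split=> //=.
  by apply: le_lt_trans (holderM_Ca_norm hf) _; rewrite ltry.
by apply: le_lt_trans (holderM_Cav_norm hv) _; rewrite ltry.
Qed.

Lemma Cam1_norm_Crep (T : distr R) (B : R) : (Cam1_norm a T <= B%:E)%E -> Crep a (3 * (B + 1)) T.
Proof.
move=> h; have : (Cam1_norm a T < (B + 1)%:E)%E.
  by apply: le_lt_trans h _; rewrite lte_fin ltrDl.
move=> /ereal_inf_lt[_ [[f v] /= [hf hv dT] <-]] /ltW h'; exists f, v.
have n1 := holder_norm_ge0 (@Num.norm R R) a setT f; have n2 := holder_norm_ge0 (@enorm R) a setT v.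
split=> //.
  by apply: Ca_norm_holderM; apply: le_trans h'; rewrite leeDl.
by move=> b; apply: Cav_norm_holderM; apply: le_trans h'; rewrite leeDr.
Qed.

Lemma Crep_Cam1_norm (T : distr R) K : Crep a K T -> (Cam1_norm a T <= (6 * K)%:E)%E.
Proof.
move=> [f [v [hf hv dT]]].
have h1 := holderM_Ca_norm hf; have h2 := holderM_Cav_norm hv.
apply: (@le_trans _ _ (Ca_norm a setT f + Cav_norm a setT v)%E).
  apply: ereal_inf_lbound; exists (f, v) => //=; split=> //.
    by apply: le_lt_trans h1 _; rewrite ltry.
  by apply: le_lt_trans h2 _; rewrite ltry.
have -> : 6 * K = 2 * K + 4 * K by ring.
by rewrite EFinD; exact: leeD.
Qed.

(** The quantitative form of [in_Cav_d]. *)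
Definition Cvrep K (T : vdistr R) := exists F : bool -> plane R -> R,
  (forall j, holderM a K (F j)) /\ forall j, deq (if j then T.2 else T.1) (dfun (F j)).

Lemma in_Cav_dP (T : vdistr R) : in_Cav_d a T <-> exists K, Cvrep K T.
Proof.
split=> [[Y [hY d1 d2]]|[K [F [hF dF]]]].
  have [M h] := lt_pinfty_real hY; exists (3 * M), (fun j x => co j (Y x)).
  by split=> [j|[]]; [exact: Cav_norm_holderM|exact: d2|exact: d1].
exists (fun x => (F false x, F true x)); split; [|exact: (dF false)|exact: (dF true)].
apply: (@le_lt_trans _ _ (4 * K)%:E); last by rewrite ltry.
by apply: holderM_Cav_norm => -[]; exact: hF.
Qed.

Lemma Cav_d_norm_Cvrep (T : vdistr R) (B : R) : (Cav_d_norm a T <= B%:E)%E ->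
  Cvrep (3 * (B + 1)) T.
Proof.
move=> h; have : (Cav_d_norm a T < (B + 1)%:E)%E.
  by apply: le_lt_trans h _; rewrite lte_fin ltrDl.
move=> /ereal_inf_lt[_ [Y [hY d1 d2] <-]] /ltW h'; exists (fun j x => co j (Y x)).
by split=> [j|[]]; [exact: Cav_norm_holderM|exact: d2|exact: d1].
Qed.

Lemma Cvrep_Cav_d_norm (T : vdistr R) K : Cvrep K T -> (Cav_d_norm a T <= (4 * K)%:E)%E.
Proof.
move=> [F [hF dF]]; pose Y x : plane R := (F false x, F true x).
have h : (Cav_norm a setT Y <= (4 * K)%:E)%E by apply: holderM_Cav_norm => -[]; exact: hF.
apply: (le_trans _ h); apply: ereal_inf_lbound; exists Y => //.
split; [|exact: (dF false)|exact: (dF true)].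
by apply: le_lt_trans h _; rewrite ltry.
Qed.

Lemma family_supP (L : Type) (n : L -> \bar R) :
  (family_sup n < +oo)%E <-> exists B : R, forall l, (n l <= B%:E)%E.
Proof.
split=> [/lt_pinfty_real[B h]|[B h]].
  by exists B => l; apply: le_trans h; apply: ereal_sup_ubound; exists l.
apply: (@le_lt_trans _ _ B%:E); last by rewrite ltry.
by apply: ge_ereal_sup => _ [l _ <-].
Qed.

Lemma nondegeneracy_gt0 (L : Type) (Y : L -> plane R -> plane R) :
  (0 < nondegeneracy Y)%E -> exists2 c : R, 0 < c & forall x, exists l, c <= enorm (Y l x).
Proof.
move=> h; have [c c0 cY] : exists2 c : R, 0 < c & (c%:E < nondegeneracy Y)%E.
  move: h; case: (nondegeneracy Y) => [r|_|//]; last by exists 1; rewrite ?ltr01 ?ltry.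
  rewrite lte_fin => r0; exists (r / 2); first by rewrite divr_gt0.
  by rewrite lte_fin; lra.
exists c => // x.
have : (c%:E < family_sup (fun l => (enorm (Y l x))%:E))%E.
  by apply: lt_le_trans cY _; apply: ereal_inf_lbound; exists x.
by move=> /ereal_sup_gt[_ [l _ <-]]; rewrite lte_fin => /ltW; exists l.
Qed.

End Norms.

(** * Uniform equivalence *)

Section BoundedVorticity.
Variable R : realType.
Notation leb2 := (@leb2 R).
Implicit Types (x y z : plane R) (b i j : bool) (e : R) (f g phi : plane R -> R)
  (Y V : plane R -> plane R).
Variables (a : R).
Hypotheses (a0 : 0 < a) (a1 : a < 1).
Variables (om : plane R -> R) (N : R).
Hypotheses (iom : integ om) (omN : forall y, `|om y| <= N).

Let bom : bmeas om. Proof. exact: bmeas_integ iom omN. Qed.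

Definition admissible M Y g :=
  [/\ (forall b, holderM a M (fun x => co b (Y x))), holderM a M g & is_div Y g].

(** The two products differ by the product of the vorticity and the divergence,
    which is bounded and integrable: [Crep_dfun] applies. *)
Lemma dgrad_div_scal M : exists K, forall Y g B, admissible M Y g ->
  (Crep a B (dgrad Y g om) -> Crep a (B + K) (div_scal om Y)) /\
  (Crep a B (div_scal om Y) -> Crep a (B + K) (dgrad Y g om)).
Proof.
have [K K0 hK] := @Crep_dfun R a a0 a1.
exists (K * (N * M + M * \int[leb2]_y `|om y|)) => Y g B [hY hg dY].
have M0 := holderM_ge0 hg; have N0 : 0 <= N by exact: le_trans (omN 0).
have iog : integ (fun x => om x * g x).
  by have := integ_bdm (bmeas_holderM a0 hg) iom; apply: eq_integ => x; exact: mulrC.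
have C : Crep a (K * (N * M + M * \int[leb2]_y `|om y|)) (dfun (fun x => om x * g x)).
  apply: hK => // [y|].
    by rewrite normrM; apply: ler_pM => //; exact: (proj1 hg).
  rewrite -(intZ _ (integ_norm iom)); apply: int_le => [||y].
  - exact: integ_norm iog.
  - exact: integZ (integ_norm iom).
  - by rewrite normrM mulrC ler_wpM2r//; exact: (proj1 hg).
split=> h.
  apply: (CrepD a0 h C) => phi _.
  by rewrite /dgrad /Defs.dsub subrK.
by apply: (CrepD a0 h (CrepN a0 C)) => phi _.
Qed.

Definition velf x : plane R := (vel om false x, vel om true x).

Lemma dgradv_velf Y g j :
  (if j then (dgradv Y g velf).2 else (dgradv Y g velf).1) = dgrad Y g (vel om j).
Proof. by case: j. Qed.

(** Both cases of the theorem: for a family, some member is bounded below at each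
    point; for a single field, off a neighbourhood of the singular set, the
    velocity gradient is bounded because the vorticity is Hoelder. *)
Lemma regularity_equiv (L : Type) (Y : L -> plane R -> plane R) (g : L -> plane R -> R) (M c P0 : R) :
  0 < c -> (forall l, admissible M (Y l) (g l)) ->
  (forall x, (exists l, c <= enorm (Y l x)) \/
             (forall e i j, 0 < e <= 1 -> `|grade om e i j x| <= P0)) ->
  ((exists K, forall l, Crep a K (dgrad (Y l) (g l) om)) <->
   (exists K, forall l, Crep a K (div_scal om (Y l)))) /\
  ((exists K, forall l, Crep a K (div_scal om (Y l))) <->
   (exists K, forall l, Cvrep a K (dgradv (Y l) (g l) velf))).
Proof.
move=> c0 adm dich; have [C C0 KB] := kernel_bounds_exist R.
have bg l : bmeas (g l) by case: (adm l) => _ hg _; exact: bmeas_holderM hg.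
have gradeP B : (forall l e j x, 0 < e <= 1 -> `|dirgrad om (Y l) e j x| <= B) ->
    exists P, forall e i j x, 0 < e <= 1 -> `|grade om e i j x| <= P.
  move=> hB; exists (Num.max P0 (2 * B / c + 2 * (N * (2 * mass R)))) => e i j x e01.
  rewrite le_max; case: (dich x) => [[l cl]|h]; last by rewrite h.
  by rewrite (grade_of_dirgrad iom omN c0 cl e01) ?orbT// => j'; exact: hB.
split.
  have [K hK] := dgrad_div_scal M.
  by split=> -[B hB]; exists (B + K) => l; have [h1 h2] := hK _ _ B (adm l); auto.
split=> -[B hB].
  have [K1 h1] := divk_hfam a0 a1 C0 KB B.
  have [K2 h2] := dirgrad_of_divk a0 a1 C0 KB iom omN M K1.
  have hD l e j x : 0 < e <= 1 -> `|dirgrad om (Y l) e j x| <= K2.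
    move=> e01; have [hY hg dY] := adm l; have [f [v [hf hv dV]]] := hB l.
    apply: h2 => //; have [H _] := h1 _ _ _ j (bmeas_scalv a0 iom omN hY) hf hv dV.
    exact: (proj1 (H e e01)).
  have [P hP] := gradeP _ hD.
  have [K hK] := dgrad_of_div a0 a1 C0 KB iom omN M B P.
  exists K => l; have [hY hg dY] := adm l; have [f [v [hf hv dV]]] := hB l.
  have G j := cid2 (hK _ _ _ _ j hY (bg l) dY hf hv dV hP).
  exists (fun j => s2val (G j)); split=> j; first exact: (s2valP (G j)).
  by rewrite dgradv_velf; exact: (s2valP' (G j)).
have [K2 h2] := dirgrad_of_dgrad a0 a1 iom omN M M B.
have hD l e j x : 0 < e <= 1 -> `|dirgrad om (Y l) e j x| <= K2.
  move=> e01; have [hY hg dY] := adm l; have [F [hF dF]] := hB l.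
  apply: (h2 _ (g l) (F j)) => //; [exact: (proj1 hg)|exact: bmeas_holderM (hF j)|exact: (proj1 (hF j))|].
  by have := dF j; rewrite dgradv_velf.
have [P hP] := gradeP _ hD.
have [K hK] := div_of_dgrad a0 a1 C0 KB iom omN M B P.
exists K => l; have [hY hg dY] := adm l; have [F [hF dF]] := hB l.
apply: (hK _ (g l) F) => // j; by have := dF j; rewrite dgradv_velf.
Qed.

End BoundedVorticity.

Section Reduction.
Variable R : realType.
Notation leb2 := (@leb2 R).
Implicit Types (x y z : plane R) (b j : bool) (f g phi : plane R -> R)
  (Y : plane R -> plane R).
Variables (a : R).
Hypotheses (a0 : 0 < a) (a1 : a < 1).

(** Truncation at the essential supremum, so that the bound holds everywhere. *)
Lemma L1_Linfty_truncate (w : plane R -> R) : L1_Linfty w -> exists om N,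
  [/\ integ om, (forall y, `|om y| <= N) & {ae leb2, forall x, w x = om x}].
Proof.
move=> [mw w1 woo]; have [N hN] := lt_pinfty_real woo.
have aeN := Linfty_ae hN.
have N0 : 0 <= N.
  by have [y _ h] := ae_near_point 0 aeN; exact: le_trans h.
pose om x := Num.max (- N) (Num.min (w x) N).
have mom : measurable_fun setT om.
  by apply: measurable_maxr => //; exact: measurable_minr.
have iw : integ w.
  apply/integrableP; split; first exact/measurable_EFinP.
  by move: w1; rewrite /finite_norm Lnorm1.
exists om, N; split.
- apply: (integ_le mom _ (integ_norm iw)) => x.
  rewrite /om ler_norml le_max ge_max le_min ge_min.
  have := normr_ge0 (w x); have := ler_norm (w x); have := ler_norm (- w x).
  rewrite normrN => h1 h2 h3.
  have -> : - `|w x| <= w x by lra.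
  have -> : - `|w x| <= N by lra.
  have -> : - N <= `|w x| by lra.
  by rewrite h2 orbT.
- move=> x; rewrite /om ler_norml le_max lexx/= ge_max ge_min lexx orbT andbT; lra.
- apply: filterS aeN => x; rewrite ler_norml /om => /andP[h1 h2].
  by rewrite (min_idPl h2) (max_idPr h1).
Qed.

Variables (w om : plane R -> R).
Hypotheses (mw : measurable_fun setT w) (mom : measurable_fun setT om).
Hypothesis (wom : {ae leb2, forall x, w x = om x}).

Let int_w f : measurable_fun setT f ->
  \int[leb2]_x (w x * f x) = \int[leb2]_x (om x * f x).
Proof.
move=> mf; apply: int_eq_ae; [exact: measurable_funM|exact: measurable_funM|].
by apply: filterS wom => x ->.
Qed.

Lemma div_scal_ae Y : (forall b, measurable_fun setT (fun x => co b (Y x))) ->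
  deq (div_scal w Y) (div_scal om Y).
Proof.
move=> mY; apply/deqE => phi r sphi rphi; apply: (congr1 (fun t : R => - t)).
have mpd b : measurable_fun setT (pd b phi).
  exact: integ_measurable (integ_pd b sphi rphi).
have E := int_w (measurable_funD (measurable_funM (mY false) (mpd false))
  (measurable_funM (mY true) (mpd true))).
have alg (c p q s t : R) : c * p * s + c * q * t = c * (p * s + q * t) by ring.
apply: etrans (etrans _ E) _; first by apply: int_ext => x; exact: alg.
by apply: int_ext => x; exact: esym (alg _ _ _ _ _).
Qed.

Lemma dgrad_ae Y g : (forall b, measurable_fun setT (fun x => co b (Y x))) ->
  measurable_fun setT g -> deq (dgrad Y g w) (dgrad Y g om).
Proof.
move=> mY mg; apply/deqE => phi r sphi rphi.
have E1 := (deqE _ _).1 (div_scal_ae mY) _ _ sphi rphi.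
have mphi := integ_measurable (integ_test sphi rphi).
have E := int_w (measurable_funM mg mphi).
have E2 : dfun (fun x => w x * g x) phi = dfun (fun x => om x * g x) phi.
  apply: etrans (etrans _ E) _; first by apply: int_ext => x; exact: esym (mulrA _ _ _).
  by apply: int_ext => x; exact: mulrA.
exact: (congr2 (fun s t : R => s - t) E1 E2).
Qed.

Lemma biot_savart_ae : biot_savart w = velf om.
Proof.
have E j x : \int[leb2]_y (kbs j (x - y) * w y) = vel om j x.
  have mk := measurable_reflect x (@measurable_kbs R j).
  apply: int_eq_ae; [exact: measurable_funM|exact: measurable_funM|].
  by apply: filterS wom => y ->.
apply/funext => x; exact: (congr2 (fun s t : R => (s, t) : plane R) (E false x) (E true x)).
Qed.

End Reduction.

Lemma iff_exists_congr (L : Type) (R : realType) (P Q : R -> L -> Prop) :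
  (forall K l, P K l <-> Q K l) ->
  ((exists K, forall l, P K l) <-> (exists K, forall l, Q K l)).
Proof. by move=> PQ; split=> -[K h]; exists K => l; exact/PQ. Qed.

Section FamilyNorms.
Variable R : realType.
Variables (a : R).
Hypotheses (a0 : 0 < a) (a1 : a < 1).

Lemma family_Cam1P (L : Type) (T : L -> distr R) :
  (family_sup (fun l => Cam1_norm a (T l)) < +oo)%E <-> exists K, forall l, Crep a K (T l).
Proof.
split=> [/family_supP[B h]|[K h]]; first by exists (3 * (B + 1)) => l; exact: Cam1_norm_Crep.
by apply/family_supP; exists (6 * K) => l; exact: Crep_Cam1_norm.
Qed.

Lemma family_Cav_dP (L : Type) (T : L -> vdistr R) :
  (family_sup (fun l => Cav_d_norm a (T l)) < +oo)%E <-> exists K, forall l, Cvrep a K (T l).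
Proof.
split=> [/family_supP[B h]|[K h]]; first by exists (3 * (B + 1)) => l; exact: Cav_d_norm_Cvrep.
by apply/family_supP; exists (4 * K) => l; exact: Cvrep_Cav_d_norm.
Qed.

Lemma admissible_norms (Y : plane R -> plane R) g (B1 B2 : R) :
  (Cav_norm a setT Y <= B1%:E)%E -> (Ca_norm a setT g <= B2%:E)%E -> is_div Y g ->
  admissible a (3 * B1 + 3 * B2) Y g.
Proof.
move=> h1 h2 dY.
have k1 b := Cav_norm_holderM a0 a1 b h1; have k2 := Ca_norm_holderM a0 a1 h2.
split=> // [b|]; first by apply: holderMW (k1 b); rewrite lerDl (holderM_ge0 k2).
by apply: holderMW k2; rewrite lerDr (holderM_ge0 (k1 true)).
Qed.

End FamilyNorms.

Theorem proposition9p1 (R : realType) (alpha : R)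
    (halpha0 : 0 < alpha) (halpha1 : alpha < 1)
    (omega0 : plane R -> R) (u0 : plane R -> plane R)
    (homega0 : L1_Linfty omega0)
    (hu0 : u0 = biot_savart omega0) :
  (* (A) a single vector field; divY0 is its divergence *)
  (forall (Sigma : set (plane R)) (Y0 : plane R -> plane R)
          (divY0 : plane R -> R) (c delta0 : R),
     closed Sigma ->
     ae_in_Ca alpha (~` Sigma) omega0 ->
     in_Cav alpha setT Y0 ->
     0 < c -> 0 < delta0 ->
     (forall x, (edist_set x Sigma < delta0%:E)%E -> c <= enorm (Y0 x)) ->
     is_div Y0 divY0 ->
     in_Ca alpha setT divY0 ->
     (in_Cam1 alpha (dgrad Y0 divY0 omega0) <->
        in_Cam1 alpha (div_scal omega0 Y0)) /\
     (in_Cam1 alpha (div_scal omega0 Y0) <->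
        in_Cav_d alpha (dgradv Y0 divY0 u0)))
  /\
  (* (B) a family of vector fields; divY0 l is the divergence of Y0 l *)
  (forall (Lambda : Type) (Y0 : Lambda -> plane R -> plane R)
          (divY0 : Lambda -> plane R -> R),
     (family_sup (fun l => Cav_norm alpha setT (Y0 l)) < +oo)%E ->
     (0 < nondegeneracy Y0)%E ->
     (forall l, is_div (Y0 l) (divY0 l)) ->
     (family_sup (fun l => Ca_norm alpha setT (divY0 l)) < +oo)%E ->
     ((family_sup (fun l => Cam1_norm alpha (dgrad (Y0 l) (divY0 l) omega0)) < +oo)%E <->
        (family_sup (fun l => Cam1_norm alpha (div_scal omega0 (Y0 l))) < +oo)%E) /\
     ((family_sup (fun l => Cam1_norm alpha (div_scal omega0 (Y0 l))) < +oo)%E <->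
        (family_sup (fun l => Cav_d_norm alpha (dgradv (Y0 l) (divY0 l) u0)) < +oo)%E)).
Proof.
have [om [N [iom omN wom]]] := L1_Linfty_truncate homega0.
have [mw _ _] := homega0; have mom := integ_measurable iom.
have wom' : {ae (@leb2 R), forall x, om x = omega0 x} by apply: filterS wom => x ->.
rewrite hu0 (biot_savart_ae mw mom wom) => {hu0 u0}.
have core (L : Type) (Y : L -> plane R -> plane R) (g : L -> plane R -> R) (M c P0 : R) :
    0 < c -> (forall l, admissible alpha M (Y l) (g l)) ->
    (forall x, (exists l, c <= enorm (Y l x)) \/
      (forall e i j, 0 < e <= 1 -> `|grade om e i j x| <= P0)) ->
    ((exists K, forall l, Crep alpha K (dgrad (Y l) (g l) omega0)) <->
     (exists K, forall l, Crep alpha K (div_scal omega0 (Y l)))) /\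
    ((exists K, forall l, Crep alpha K (div_scal omega0 (Y l))) <->
     (exists K, forall l, Cvrep alpha K (dgradv (Y l) (g l) (velf om)))).
  move=> c0 adm dich.
  have [E1 E2] := regularity_equiv halpha0 halpha1 iom omN c0 adm dich.
  have mY l b : measurable_fun setT (fun x => co b (Y l x)).
    by have [hY _ _] := adm l; exact: holderM_measurable (hY b).
  have mg l : measurable_fun setT (g l) by have [_ hg _] := adm l; exact: holderM_measurable hg.
  have D1 : (exists K, forall l, Crep alpha K (div_scal omega0 (Y l))) <->
            (exists K, forall l, Crep alpha K (div_scal om (Y l))).
    apply: iff_exists_congr => K l; split; apply: Crep_deq; exact: div_scal_ae.
  have D2 : (exists K, forall l, Crep alpha K (dgrad (Y l) (g l) omega0)) <->
            (exists K, forall l, Crep alpha K (dgrad (Y l) (g l) om)).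
    apply: iff_exists_congr => K l; split; apply: Crep_deq; exact: dgrad_ae.
  split; first exact: iff_trans D2 (iff_trans E1 (iff_sym D1)).
  exact: iff_trans D1 E2.
have unitP (P : R -> Prop) : (exists K, P K) <-> (exists K, forall _ : unit, P K).
  by split=> -[K h]; exists K => //; exact: h tt.
split=> [Sigma Y g c d _ [w' ww' hw'] hY c0 d0 Yc dY hg|L Y g hY nd dY hg].
- have [B1 b1] := lt_pinfty_real hY; have [B2 b2] := lt_pinfty_real hg.
  have [M1 m1] := lt_pinfty_real hw'.
  have M10 : 0 <= M1.
    by rewrite -lee_fin; apply: le_trans m1; exact: holder_norm_ge0.
  pose r := Num.min (d / 2) 1.
  have r01 : 0 < r <= 1 by rewrite /r lt_min ltr01 divr_gt0// ge_min lexx orbT.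
  have [C C0 KB] := kernel_bounds_exist R.
  have [P0 hP0] := grade_smooth halpha0 halpha1 C0 KB iom omN M1 r01.
  have dich x : (exists _ : unit, c <= enorm (Y x)) \/
      (forall e i j, 0 < e <= 1 -> `|grade om e i j x| <= P0).
    have [xS|xS] := ltP (edist_set x Sigma) d%:E; first by left; exists tt; exact: Yc.
    right=> e i j e01; apply: (hP0 w') => //.
    have far y : enorm (x - y) <= r -> (~` Sigma) y.
      move=> xy Sy; move: xS; apply/negP; rewrite -ltNge.
      apply: (@le_lt_trans _ _ (enorm (x - y))%:E).
        by apply: ereal_inf_lbound; exists y.
      rewrite lte_fin; apply: le_lt_trans xy _; apply: (@le_lt_trans _ _ (d / 2)).
        by rewrite ge_min lexx.
      lra.
    have Sx : (~` Sigma) x by apply: far; rewrite subrr enorm0; case/andP: r01 => /ltW.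
    apply: filterS2 wom ww' => y oy wy xy; rewrite -oy wy; last exact: far.
    rewrite distrC; apply: (holder_norm_lip _ m1 Sx (far y xy)); exact: normr0.
  have adm (_ : unit) := admissible_norms halpha0 halpha1 b1 b2 dY.
  have [E1 E2] := core unit (fun=> Y) (fun=> g) _ c P0 c0 adm dich.
  have c1 T := iff_trans (in_Cam1P halpha0 halpha1 T) (unitP (fun K => Crep alpha K T)).
  have c2 T := iff_trans (in_Cav_dP halpha0 halpha1 T) (unitP (fun K => Cvrep alpha K T)).
  split; first exact: iff_trans (c1 _) (iff_trans E1 (iff_sym (c1 _))).
  exact: iff_trans (c1 _) (iff_trans E2 (iff_sym (c2 _))).
have [B1 b1] := (family_supP _).1 hY; have [B2 b2] := (family_supP _).1 hg.
have [c c0 Yc] := nondegeneracy_gt0 nd.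
have adm l := admissible_norms halpha0 halpha1 (b1 l) (b2 l) (dY l).
have [E1 E2] := core L Y g _ c 0 c0 adm (fun x => or_introl (Yc x)).
have c1 T := family_Cam1P halpha0 halpha1 T.
have c2 T := family_Cav_dP halpha0 halpha1 T.
split; first exact: iff_trans (c1 L _) (iff_trans E1 (iff_sym (c1 L _))).
exact: iff_trans (c1 L _) (iff_trans E2 (iff_sym (c2 L _))).
Qed.
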